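(* Suppose that the processes $\pi^m$, $m\ge 1$, and $B$ are defined on a common probability space in such a way that, almost surely, in the quotient space $\widehat{\mathfrak h}^*_{\mathbb R}/\mathbb R\delta$, $\frac1m\pi^m(\lceil mt\rceil)$ converges to $B(t)$ as $m\to\infty$, uniformly for $t$ in compact subsets of $\mathbb R_+$. Then for every $t\ge 0$, every sequence $(i_k)_{k\ge 0}$ of integers in $\{0,\dots,n\}$ and every $k\ge 0$, both $$\frac1m\,\mathcal P_{\alpha_{i_k}}\cdots\mathcal P_{\alpha_{i_0}}\pi^m(mt)\quad\text{and}\quad \frac1m\,\mathcal P_{\alpha_{i_k}}\cdots\mathcal P_{\alpha_{i_0}}\pi^m(\lceil mt\rceil)$$ converge almost surely in $\widehat{\mathfrak h}^*_{\mathbb R}/\mathbb R\delta$, as $m\to\infty$, towards $\mathcal P_{\alpha_{i_k}}\cdots\mathcal P_{\alpha_{i_0}}B(t)$.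
   Context: Fix an integer $n\ge 1$. Let $\widehat{\mathfrak h}^*_{\mathbb R}$ be the real vector space with basis $\Lambda_0,\alpha_0,\dots,\alpha_n$ (real form of the dual of a Cartan subalgebra of the extended affine Lie algebra of type $A_n^{1}$, with simple roots $\alpha_i$), with the symmetric bilinear form $(\cdot|\cdot)$ given by $(\Lambda_0|\Lambda_0)=0$, $(\alpha_i|\Lambda_0)=1$ if $i=0$ and $0$ otherwise, $(\alpha_i|\alpha_i)=2$, and for $i\ne j$: if $n\ge 2$, $(\alpha_i|\alpha_j)=-1$ when $|i-j|\in\{1,n\}$ and $0$ otherwise; if $n=1$, $(\alpha_0|\alpha_1)=-2$. Write $\langle x,\alpha_i^\vee\rangle=(x|\alpha_i)$. Let $\delta=\sum_{i=0}^n\alpha_i$ (so $(\delta|\alpha_i)=0$ for all $i$), and $\mathfrak h^*_{\mathbb R}=\bigoplus_{i=1}^n\mathbb R\alpha_i$, on which $(\cdot|\cdot)$ is a scalar product. The quotient $\widehat{\mathfrak h}^*_{\mathbb R}/\mathbb R\delta$ is identified with $\mathbb R\Lambda_0\oplus\mathfrak h^*_{\mathbb R}$. Pitman transforms: for a continuous $\eta$ with values in $\widehat{\mathfrak h}^*_{\mathbb R}$ (or in the quotient, which makes sense since $\langle\delta,\alpha_i^\vee\rangle=0$), with $\eta(0)=0$, $\mathcal P_{\alpha_i}\eta(t)=\eta(t)-\inf_{s\le t}\langle\eta(s),\alpha_i^\vee\rangle\,\alpha_i$. Littelmann module: let $\pi_{\Lambda_0}(t)=t\Lambda_0$, $t\in[0,1]$.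 Fix a sequence $(j_k)_{k\ge0}$ in $\{0,\dots,n\}$ taking each value infinitely often. $B\pi_{\Lambda_0}$ is the set of continuous piecewise linear $\eta:[0,1]\to\widehat{\mathfrak h}^*_{\mathbb R}$ with $\eta(0)=0$ for which there is $k$ with $\mathcal P_{\alpha_{j_k}}\cdots\mathcal P_{\alpha_{j_0}}\eta=\pi_{\Lambda_0}$ and such that all numbers $a_l=-\inf_{s\le 1}\langle\mathcal P_{\alpha_{j_{l-1}}}\cdots\mathcal P_{\alpha_{j_0}}\eta(s),\alpha_{j_l}^\vee\rangle$, $l\ge0$, are integers; it does not depend on $(j_k)$. Let $\nu\in\mathfrak h^*_{\mathbb R}$ and $\widehat\nu=\Lambda_0+\nu$ be such that $\langle\widehat\nu,\alpha_i^\vee\rangle\ge0$ for all $i\in\{0,\dots,n\}$. For $m\ge1$ let $\mu^m$ be the probability measure on the countable set $B\pi_{\Lambda_0}$ with $\mu^m(\eta)$ proportional to $e^{\frac1m(\eta(1)|\widehat\nu)}$ (the normalising constant is the character $\mathrm{ch}_{\Lambda_0}(\widehat\nu/m)$ of the highest weight module $V(\Lambda_0)$, which is finite). Let $(\eta_i^m)_{i\ge0}$ be i.i.d. with law $\mu^m$ and let $\pi^m$ be the continuous random path $\pi^m(t)=\eta_1^m(1)+\dots+\eta_{k-1}^m(1)+\eta_k^m(t-k+1)$ for $t\in[k-1,k)$, $k\ge1$. $B(t)=B_t=t\Lambda_0+b_t$, where $(b_t)_{t\ge0}$ is a standard Brownian motion in the Euclidean space $(\mathfrak h^*_{\mathbb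 R},(\cdot|\cdot))$ with drift $\nu$, $b_0=0$. $\mathcal P_{\alpha_{i_k}}\cdots\mathcal P_{\alpha_{i_0}}\pi^m(s)$ means the transformed path evaluated at time $s$. *)

(* Defs.v *)
From HB Require Import structures.
From mathcomp Require Import all_boot all_order all_algebra.
From mathcomp Require Import all_classical all_reals all_analysis.

Set Implicit Arguments.
Unset Strict Implicit.
Unset Printing Implicit Defensive.

Import Order.TTheory GRing.Theory Num.Theory.
Import numFieldNormedType.Exports.

Local Open Scope classical_set_scope.
Local Open Scope ring_scope.

(** A vector of the space with basis Lambda_0, alpha_0, ..., alpha_n is the row
    of its n + 2 coordinates in that order: coordinate [ord0] is the one along
    Lambda_0, and coordinate [lift ord0 i] the one along alpha_i. *)
Notation hhat R n := ('rV[R]_n.+2) (only parsing).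

Section AffineRootData.
Context {R : realType} {n : nat}.

Definition Lambda0 : hhat R n := delta_mx 0 ord0.

Definition alpha (i : 'I_n.+1) : hhat R n := delta_mx 0 (lift ord0 i).

Definition delta : hhat R n := \sum_(i < n.+1) alpha i.

(* [i - j + (j - i)] is |i - j|, as subtraction on [nat] is truncated. *)
Definition cartan (i j : 'I_n.+1) : R :=
  if i == j then 2
  else if n == 1%N then - 2
  else if (i - j + (j - i))%N \in [:: 1%N; n] then - 1
  else 0.

Definition gram : 'M[R]_n.+2 :=
  \matrix_(p < n.+2, q < n.+2)
    match unlift ord0 p, unlift ord0 q with
    | None, None => 0
    | None, Some i => (i == ord0)%:R
    | Some i, None => (i == ord0)%:R
    | Some i, Some j => cartan i j
    end.

Definition hform (x y : hhat R n) : R :=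
  \sum_(p < n.+2) \sum_(q < n.+2) x 0 p * gram p q * y 0 q.

(* The span of alpha_1, ..., alpha_n. *)
Definition hfin : set (hhat R n) :=
  [set x | x 0 ord0 = 0 /\ x 0 (lift ord0 ord0) = 0].

(* Each class modulo R delta has exactly one representative without
   alpha_0-component, that is, in R Lambda_0 + hfin; [modd] computes it.
   Convergence in the quotient is convergence of the images by [modd]. *)
Definition modd (x : hhat R n) : hhat R n := x - x 0 (lift ord0 ord0) *: delta.

End AffineRootData.

Section Pitman.
Context {R : realType} {n : nat}.

Definition pitman (i : 'I_n.+1) (eta : R -> hhat R n) (t : R) : hhat R n :=
  eta t - inf [set hform (eta s) (alpha i) | s in `[0, t]] *: alpha i.

(* P_{i_(k-1)} ... P_{i_0} eta : the first [k] transforms of the sequence. *)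
Fixpoint pitman_iter (i : nat -> 'I_n.+1) (k : nat) (eta : R -> hhat R n) :
    R -> hhat R n :=
  if k is k'.+1 then pitman (i k') (pitman_iter i k' eta) else eta.

End Pitman.

Section LittelmannModule.
Context {R : realType} {n : nat}.

Definition piecewise_linear01 (eta : R -> hhat R n) : Prop :=
  exists (N : nat) (t : nat -> R),
    [/\ t 0%N = 0, t N = 1,
        forall k, (k < N)%N -> t k < t k.+1
      & forall k, (k < N)%N -> exists a b : hhat R n,
          forall s, t k <= s <= t k.+1 -> eta s = a + s *: b].

Definition infinitely_often (j : nat -> 'I_n.+1) : Prop :=
  forall (i : 'I_n.+1) (N : nat), exists2 k, (N <= k)%N & j k = i.

Definition string_coord (j : nat -> 'I_n.+1) (eta : R -> hhat R n) (l : nat) :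
    R :=
  - inf [set hform (pitman_iter j l eta s) (alpha (j l)) | s in `[0, 1]].

(* A path on [0, 1] is encoded by the function on R extending it by its
   end values, so that equal paths are equal functions. *)
Definition Bpi (j : nat -> 'I_n.+1) : set (R -> hhat R n) :=
  [set eta : R -> hhat R n |
    [/\ forall s, eta s = eta (Num.min (Num.max 0 s) 1),
        eta 0 = 0,
        {within `[0, 1], continuous eta} /\ piecewise_linear01 eta,
        exists k, forall t, 0 <= t <= 1 ->
          pitman_iter j k.+1 eta t = t *: Lambda0
      & forall l, string_coord j eta l \is a Num.int]].

Definition weight (nuhat : hhat R n) (m : nat) (eta : R -> hhat R n) : R :=
  expR (m%:R^-1 * hform (eta 1) nuhat).

Definition partition_function (j : nat -> 'I_n.+1) (nuhat : hhat R n)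
    (m : nat) : \bar R :=
  \esum_(eta in Bpi j) (weight nuhat m eta)%:E.

Definition mu_law (j : nat -> 'I_n.+1) (nuhat : hhat R n) (m : nat)
    (A : set (R -> hhat R n)) : \bar R :=
  \esum_(eta in A `&` Bpi j)
    (weight nuhat m eta / fine (partition_function j nuhat m))%:E.

(* For t in [k - 1, k) one has [Num.truncn t = k - 1]; the variable of index
   0 is not used. *)
Definition walk (eta : nat -> R -> hhat R n) (t : R) : hhat R n :=
  \sum_(1 <= i < (Num.truncn t).+1) eta i 1
    + eta (Num.truncn t).+1 (t - (Num.truncn t)%:R).

End LittelmannModule.

Section Independence.
Context {d : measure_display} {T : measurableType d} {R : realType}.
Variable P : probability T R.

Definition mutually_independent (I : choiceType) (F : I -> set (set T)) :
    Prop :=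
  forall (s : seq I) (A : I -> set T), uniq s ->
    (forall i, i \in s -> F i (A i)) ->
    (P (\bigcap_(i in [set` s]) A i) = \prod_(i <- s) P (A i))%E.

(* [S] is meant to be a countable set with its discrete sigma-algebra, and
   [mu] a law on it. *)
Definition iid_discrete (U : Type) (S : set U) (mu : set U -> \bar R)
    (X : nat -> T -> U) : Prop :=
  [/\ forall i w, S (X i w),
      forall i (A : set U), measurable (X i @^-1` A),
      forall i (A : set U), P (X i @^-1` A) = mu A
    & mutually_independent (fun i => preimage_set_system setT (X i) setT)].

End Independence.

Definition borel_sets (U : topologicalType) : set (set U) := <<s @open U >>.

Section BrownianMotion.
Context {d : measure_display} {T : measurableType d} {R : realType} {n : nat}.
Variable P : probability T R.

(* A random vector of hfin is Gaussian with mean u and covariance v times the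
   scalar product when its product with each nonzero x in hfin has law
   N((u|x), v (x|x)); [normal_prob] takes the standard deviation. *)
Definition brownian_motion_with_drift (nu : hhat R n)
    (b : R -> T -> hhat R n) : Prop :=
  [/\ (forall t, 0 <= t -> forall w, hfin (b t w)) /\
      (forall t, 0 <= t -> forall A, borel_sets A -> measurable (b t @^-1` A)),
      {ae P, forall w, b 0 w = 0},
      {ae P, forall w,
        {within [set t | 0 <= t], continuous (fun t => b t w)}},
      forall t : nat -> R, 0 <= t 0%N -> (forall k, t k <= t k.+1) ->
        mutually_independent P (fun k : nat =>
          preimage_set_system setT (fun w => b (t k.+1) w - b (t k) w)
            (@borel_sets (hhat R n)))
    & forall s t x, 0 <= s -> s < t -> hfin x -> x != 0 ->
        forall A : set R, measurable A ->
          P ((fun w => hform (b t w - b s w) x) @^-1` A) =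
          normal_prob ((t - s) * hform nu x)
            (Num.sqrt ((t - s) * hform x x)) A].

End BrownianMotion.

(* Main.v *)
Require Import Defs.
From HB Require Import structures.
From mathcomp Require Import all_boot all_order all_algebra.
From mathcomp Require Import all_classical all_reals all_analysis.
From mathcomp Require Import ring lra zify.

(* Write eps_i(eta) for minus the minimum of the i-th coordinate (eta | alpha_i)
   of a path eta of the module. These coordinates add up to s at time s, so the
   numbers eps_i control the whole path modulo delta. The interpolated walk thus
   stays close to its values at integer times as soon as eps_i <= m / q for all
   the steps used, almost surely for large m, and then the Pitman transforms,
   being running infima, inherit this closeness.

   To bound the tail of eps_i under mu^m, the string operators for alpha_i turn
   a path with eps_i >= x into one of at least the same weight whose end point
   has i-th coordinate at least x. They also make the character invariant under
   the affine Weyl group, and since all weights have level one its translations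
   give its exponential moments: that of order k / m is exp((k c_i + k^2) / m)
   with c_i = (Lambda_0 + nu | alpha_i). Taking k proportional to m, the tail at
   m / q is exponentially small in m, and Borel-Cantelli applies.

   The string operators of all i, not only of i = j_0, have to preserve the
   module. For this the module is identified with the set of LS paths, defined
   by a relation between the velocities before and after each time, which is
   checked to be stable under each operator by a rank two computation. *)

Set Implicit Arguments.
Unset Strict Implicit.
Unset Printing Implicit Defensive.

Import Order.TTheory GRing.Theory Num.Theory.
Import numFieldNormedType.Exports.

Local Open Scope classical_set_scope.
Local Open Scope ring_scope.

(** * The affine root system *)

(** The assumed convergence only sees integer times, whereas a running infimum also sees the inside
    of every step. About m steps precede time t, and all of them have to be small compared with m at
    once, so the tail of one step must remain summable in m after multiplication by m. The quadratic
    term k^2 / m of the exponential moment is half the squared length of the translation k alpha_i.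
    At the threshold x = 4k the Chernoff exponent is (k c_i + k^2 - 4 k^2) / m; once k exceeds c_i
    this is at most -2 k^2 / m, of order -m when k is proportional to m. Integrality is the delicate
    point in the stability of LS paths: an operator may change the velocity on one side of a time s
    only, which is allowed when the coordinate is an integer at s. Such a level is always reached at
    a local minimum, at an end point, or is the prescribed string coordinate. *)

Section RootForm.
Context {R : realType} {n : nat}.
Implicit Types (x y z : hhat R n) (i k : 'I_n.+1) (a : R).

Lemma hform_linl a x y z : hform (a *: x + y) z = a * hform x z + hform y z.
Proof.
rewrite /hform mulr_sumr -big_split; apply: eq_bigr => p _ /=.
rewrite mulr_sumr -big_split; apply: eq_bigr => q _ /=.
by rewrite !mxE; ring.
Qed.

Lemma cartanC i k : cartan i k = cartan k i :> R.
Proof. by rewrite /cartan eq_sym addnC. Qed.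

Lemma hformC x y : hform x y = hform y x.
Proof.
rewrite /hform exchange_big; apply: eq_bigr => p _; apply: eq_bigr => q _ /=.
have -> : gram q p = gram p q :> R.
  rewrite !mxE.
  by case: unlift => [u|]; case: unlift => [v|] //; rewrite cartanC.
by ring.
Qed.

Lemma hform0l z : hform 0 z = 0.
Proof.
rewrite /hform big1 // => p _; rewrite big1 // => q _.
by rewrite !mxE !mul0r.
Qed.

Lemma hformZl a x z : hform (a *: x) z = a * hform x z.
Proof. by rewrite -[a *: x]addr0 hform_linl hform0l addr0. Qed.

Lemma hformDl x y z : hform (x + y) z = hform x z + hform y z.
Proof. by have := hform_linl 1 x y z; rewrite scale1r mul1r. Qed.

Lemma hformNl x z : hform (- x) z = - hform x z.
Proof. by rewrite -scaleN1r hformZl mulN1r. Qed.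

Lemma hformBl x y z : hform (x - y) z = hform x z - hform y z.
Proof. by rewrite hformDl hformNl. Qed.

Lemma hform_suml (I : Type) (r : seq I) (Q : pred I) (F : I -> hhat R n) z :
  hform (\sum_(i <- r | Q i) F i) z = \sum_(i <- r | Q i) hform (F i) z.
Proof.
by elim/big_rec2: _ => [|i u v _ <-]; rewrite ?hform0l // hformDl.
Qed.

Lemma hformDr x y z : hform z (x + y) = hform z x + hform z y.
Proof. by rewrite ![hform z _]hformC hformDl. Qed.

Lemma hformZr a x z : hform z (a *: x) = a * hform z x.
Proof. by rewrite ![hform z _]hformC hformZl. Qed.

Lemma hformBr x y z : hform z (x - y) = hform z x - hform z y.
Proof. by rewrite ![hform z _]hformC hformBl. Qed.

Lemma hform_sumr (I : Type) (r : seq I) (Q : pred I) (F : I -> hhat R n) z :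
  hform z (\sum_(i <- r | Q i) F i) = \sum_(i <- r | Q i) hform z (F i).
Proof. by rewrite hformC hform_suml; apply: eq_bigr => i _; rewrite hformC. Qed.

(** The diagram is a cycle, so neighbours are the cyclic successor and predecessor. For n = 1 these
    coincide and their two contributions add up to -2, which makes one formula serve for all n. *)
Lemma cartanE i k : (1 <= n)%N ->
  cartan k i = (k == i)%:R *+ 2 - (k == ordS i)%:R - (k == ord_pred i)%:R :> R.
Proof.
move=> hn; rewrite /cartan -!val_eqE /=.
have lti := ltn_ord i; have ltk := ltn_ord k.
have Si : ((i.+1 %% n.+1)%N = if i == n :> nat then 0%N else i.+1).
  case: eqP => [->|/eqP nin]; first by rewrite modnn.
  by rewrite modn_small //; lia.
have Pi : (((i + n.+1).-1 %% n.+1)%N = if i == 0%N :> nat then n else i.-1).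
  case: eqP => [->|/eqP nin]; first by rewrite add0n /= modn_small.
  rewrite (_ : (i + n.+1).-1 = i.-1 + n.+1)%N; last by lia.
  by rewrite modnDr modn_small //; lia.
rewrite Si Pi !inE; set s := (if _ then 0%N else _).
set p := (if _ then n else _).
have hs : (i = n :> nat /\ s = 0%N \/ i < n /\ s = i.+1)%N.
  by rewrite /s; case: eqP; lia.
have hp : (i = 0%N :> nat /\ p = n \/ 0 < i /\ p = i.-1)%N.
  by rewrite /p; case: eqP; lia.
move: {Si Pi} s p hs hp; move: (val k) (val i) lti ltk => {k i} k i lti ltk s p hs hp.
have [->|nk] := eqVneq k i.
  have -> : (i == s) = false by lia.
  have -> : (i == p) = false by lia.
  by rewrite !subr0.
have [n1|n1] := eqVneq n 1%N.
  have -> : (k == s) = true by lia.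
  have -> : (k == p) = true by lia.
  by rewrite mul0rn sub0r -opprD.
have -> : ((k - i + (i - k))%N == 1%N) || ((k - i + (i - k))%N == n) =
    (k == s) || (k == p) by lia.
rewrite mul0rn sub0r.
have [e|e] := eqVneq k s.
  have kp : (k == p) = false by lia.
  by rewrite kp subr0.
by rewrite mulr0n oppr0 sub0r; case: (k == p); rewrite ?mulr0n ?oppr0.
Qed.

Lemma hform_alpha x i : (1 <= n)%N ->
  hform x (alpha i) = x 0 ord0 * (i == ord0)%:R + x 0 (lift ord0 i) *+ 2
    - x 0 (lift ord0 (ordS i)) - x 0 (lift ord0 (ord_pred i)).
Proof.
move=> hn.
have E : hform x (alpha i) = \sum_p x 0 p * gram p (lift ord0 i).
  apply: eq_bigr => p _; rewrite (bigD1 (lift ord0 i)) //= big1 => [|q nq].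
    by rewrite !mxE !eqxx mulr1 addr0.
  by rewrite [alpha i _ _]mxE (negbTE nq) andbF mulr0.
rewrite E big_ord_recl !mxE unlift_none liftK -!addrA; congr (_ + _).
under eq_bigr => k _ do
  rewrite !mxE !liftK (cartanE i k hn) !mulrBr mulrnAr.
have S1 l : \sum_k x 0 (lift ord0 k) * (k == l)%:R = x 0 (lift ord0 l).
  rewrite (bigD1 l) //= eqxx mulr1 big1 ?addr0 // => k /negbTE ->.
  by rewrite mulr0.
by rewrite !sumrB sumrMnl !S1; ring.
Qed.

Lemma hform_alpha_delta i : (1 <= n)%N -> hform delta (alpha i) = 0 :> R.
Proof.
move=> hn; rewrite hform_alpha //.
have D k : (delta : hhat R n) 0 (lift ord0 k) = 1.
  rewrite summxE (bigD1 k) //= mxE !eqxx big1 ?addr0 // => l nl.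
  by rewrite mxE eqxx (inj_eq (@lift_inj _ ord0)) eq_sym (negbTE nl).
have -> : (delta : hhat R n) 0 ord0 = 0.
  by rewrite summxE big1 // => k _; rewrite mxE.
by rewrite !D mul0r add0r mulr2n; ring.
Qed.

(** The coordinates along the simple roots enter as second differences around a cycle and cancel;
    what survives is the level. *)
Lemma hform_delta x : (1 <= n)%N -> hform x delta = x 0 ord0.
Proof.
move=> hn; rewrite hform_sumr.
under eq_bigr => i _ do rewrite hform_alpha //.
rewrite !sumrB big_split /= sumrMnl.
have S1 (f : 'I_n.+1 -> 'I_n.+1) : injective f ->
    \sum_k x 0 (lift ord0 (f k)) = \sum_k x 0 (lift ord0 k).
  by move=> fI; rewrite [RHS](reindex_inj fI).
rewrite (S1 _ (@ordS_inj _)) (S1 _ (@ord_pred_inj _)).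
set A := \sum_i _; set C := \sum_k _.
have -> : A + C *+ 2 - C - C = A by ring.
rewrite /A (bigD1 ord0) //= big1 => [|i /negbTE ->]; last by rewrite mulr0.
by rewrite mulr1 addr0.
Qed.

Lemma sum_hform_alpha x : (1 <= n)%N ->
  \sum_i hform x (alpha i) = x 0 ord0.
Proof. by move=> hn; rewrite -hform_delta // /delta hform_sumr. Qed.

Lemma hform_alphas i k : hform (alpha i : hhat R n) (alpha k) = cartan i k.
Proof.
have E p : p != lift ord0 i ->
    \sum_q (alpha i : hhat R n) 0 p * gram p q * (alpha k : hhat R n) 0 q = 0.
  move=> np; rewrite big1 // => q _.
  by rewrite [alpha i _ _]mxE (negbTE np) andbF !mul0r.
rewrite /hform (bigD1 (lift ord0 i)) //= [X in _ + X]big1 // addr0.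
rewrite (bigD1 (lift ord0 k)) //= big1 => [|q nq]; last first.
  by rewrite [alpha k _ _]mxE (negbTE nq) andbF mulr0.
by rewrite !mxE !eqxx !liftK mul1r mulr1 addr0.
Qed.

Lemma hform_alphaii i : hform (alpha i : hhat R n) (alpha i) = 2.
Proof. by rewrite hform_alphas /cartan eqxx. Qed.

Lemma hform_alpha_cases i k : (1 <= n)%N -> i != k ->
  [\/ hform (alpha i : hhat R n) (alpha k) = 0,
      hform (alpha i : hhat R n) (alpha k) = -1
    | n = 1%N /\ hform (alpha i : hhat R n) (alpha k) = -2].
Proof.
move=> hn nik; rewrite hform_alphas /cartan (negbTE nik).
by case: eqP => n1; [exact: Or33|case: ifP => _; [exact: Or32|exact: Or31]].
Qed.

Definition srefl i x : hhat R n := x - hform x (alpha i) *: alpha i.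

Lemma hform_srefl i k x : hform (srefl i x) (alpha k) =
  hform x (alpha k) - hform x (alpha i) * hform (alpha i) (alpha k).
Proof. by rewrite /srefl hformBl hformZl. Qed.

Lemma hform_sreflii i x : hform (srefl i x) (alpha i) = - hform x (alpha i).
Proof. by rewrite hform_srefl hform_alphaii; ring. Qed.

Lemma sreflK i : involutive (srefl i).
Proof.
move=> x; rewrite {1}/srefl hform_sreflii /srefl scaleNr opprK subrK //.
Qed.

Lemma srefl_fix i x : hform x (alpha i) = 0 -> srefl i x = x.
Proof. by move=> e; rewrite /srefl e scale0r subr0. Qed.

Lemma srefl_adj i x y : hform (srefl i x) y = hform x (srefl i y).
Proof.
rewrite /srefl hformBl hformZl hformBr hformZr.
by rewrite [hform (alpha i) y]hformC mulrC.
Qed.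

End RootForm.

Section TruncationBraid.
Context {R : realType}.

Lemma min0_cases (t : R) :
  Num.min t 0 = t /\ t <= 0 \/ Num.min t 0 = 0 /\ 0 <= t.
Proof.
by have [h|h] := ltP t 0; [left|right]; split=> //; exact: ltW.
Qed.

(** The coefficients of the two simple roots of type A_2 in the two triple products of truncated
    reflections; [smax_braid] is its vector form. *)
Lemma min0_braid (a b : R) :
  let a1 := Num.min a 0 in let a2 := Num.min (b + a1) 0 in
  let a3 := Num.min (a2 - a1 + (a - a1)) 0 in
  let b1 := Num.min b 0 in let b2 := Num.min (a + b1) 0 in
  let b3 := Num.min (b2 - b1 + (b - b1)) 0 in
  a1 + a3 = b2 /\ b1 + b3 = a2.
Proof.
move=> a1 a2 a3 b1 b2 b3.
have h1 : a1 = a /\ a <= 0 \/ a1 = 0 /\ 0 <= a := min0_cases _.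
have h2 := min0_cases (b + a1); have h3 := min0_cases (a2 - a1 + (a - a1)).
have k1 : b1 = b /\ b <= 0 \/ b1 = 0 /\ 0 <= b := min0_cases _.
have k2 := min0_cases (a + b1); have k3 := min0_cases (b2 - b1 + (b - b1)).
rewrite -/a2 in h2; rewrite -/a3 in h3; rewrite -/b2 in k2; rewrite -/b3 in k3.
clearbody a1 a2 a3 b1 b2 b3; clear -h1 h2 h3 k1 k2 k3.
case: h1 k1 h2 k2 h3 k3 => -[-> a0] [] [-> b0] [] [-> c0] [] [-> d0];
  try (exfalso; lra); case=> -[-> ?] [] [-> ?]; split; lra.
Qed.

End TruncationBraid.

(** * Chains in the orbit of Lambda_0 *)

Section AChains.
Context {R : realType} {n : nat} (hn : (1 <= n)%N).
Implicit Types (x y tau : hhat R n) (i k : 'I_n.+1) (s : R).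
Local Notation p i x := (hform x (alpha i)).

(** The larger, in the dominance order, of [x] and its reflection. Unlike reflections these maps are
    idempotent, but they satisfy the same braid relations. *)
Definition smax k x : hhat R n := x - Num.min (p k x) 0 *: alpha k.

(* Littelmann's a-chains at level one: [lsrel s tau tau'] says that [tau] and
   [tau'] lie in the orbit of Lambda_0 and can be the velocities of an LS path
   just before and just after time [s]. Both are lowered towards Lambda_0 by
   the same simple reflections; the reflection may act on [tau] alone only if
   it moves [s * tau] by an element of the root lattice. *)
Inductive lsrel s : hhat R n -> hhat R n -> Prop :=
| lsrel_base : lsrel s Lambda0 Lambda0
| lsrel_step k tau tau' : p k tau < 0 ->
    s * p k tau \is a Num.int \/ p k tau' < 0 ->
    lsrel s (srefl k tau) (smax k tau') -> lsrel s tau tau'.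

Lemma hform_smax k i x :
  p i (smax k x) = p i x - Num.min (p k x) 0 * p i (alpha k).
Proof. by rewrite /smax hformBl hformZl. Qed.

Lemma smax_srefl k x : p k x < 0 -> smax k x = srefl k x.
Proof. by move=> h; rewrite /smax min_l // ltW. Qed.

Lemma smax_id k x : 0 <= p k x -> smax k x = x.
Proof. by move=> h; rewrite /smax min_r // scale0r subr0. Qed.

Lemma hform_alphaC i k : p i (alpha k : hhat R n) = p k (alpha i).
Proof. exact: hformC. Qed.

Lemma srefl_comm i k x : p i (alpha k : hhat R n) = 0 ->
  srefl i (srefl k x) = srefl k (srefl i x).
Proof.
move=> e; have e' : p k (alpha i : hhat R n) = 0 by rewrite hform_alphaC.
rewrite {1}/srefl hform_srefl e mulr0 subr0 {2}/srefl hform_srefl e'.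
by rewrite mulr0 subr0 /srefl addrAC.
Qed.

Lemma smax_comm i k x : p i (alpha k : hhat R n) = 0 ->
  smax i (smax k x) = smax k (smax i x).
Proof.
move=> e; have e' : p k (alpha i : hhat R n) = 0 by rewrite hform_alphaC.
rewrite {1}/smax hform_smax e mulr0 subr0 {2}/smax hform_smax e'.
by rewrite mulr0 subr0 /smax addrAC.
Qed.

Lemma srefl_braid i k x : p i (alpha k : hhat R n) = -1 ->
  srefl i (srefl k (srefl i x)) = srefl k (srefl i (srefl k x)).
Proof.
move=> e; have e' : p k (alpha i : hhat R n) = -1 by rewrite hform_alphaC.
rewrite /srefl !(hformBl, hformZl) !hform_alphaii e e'.
by apply/rowP => q; rewrite !mxE; ring.
Qed.

Lemma smax_braid i k x : p i (alpha k : hhat R n) = -1 ->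
  smax i (smax k (smax i x)) = smax k (smax i (smax k x)).
Proof.
move=> e; have e' : p k (alpha i : hhat R n) = -1 by rewrite hform_alphaC.
have E a b c (u v : hhat R n) : x - a *: u - b *: v - c *: u =
    x - (a + c) *: u - b *: v.
  by apply/rowP => q; rewrite !mxE; ring.
rewrite /smax !(hformBl, hformZl) !hform_alphaii e e' !E.
set a := p i x; set b := p k x.
have -> : b - Num.min a 0 * -1 = b + Num.min a 0 by ring.
have -> : a - Num.min b 0 * -1 = a + Num.min b 0 by ring.
set a2 := Num.min (b + _) 0; set b2 := Num.min (a + _) 0.
have -> : a - Num.min a 0 * 2 - a2 * -1 =
    a2 - Num.min a 0 + (a - Num.min a 0) by ring.
have -> : b - Num.min b 0 * 2 - b2 * -1 =
    b2 - Num.min b 0 + (b - Num.min b 0) by ring.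
by have [-> ->] := min0_braid a b; rewrite addrAC.
Qed.

(** The number of simple roots subtracted from Lambda_0. It is nonnegative on the orbit and
    decreases along a chain, hence measures inductions. *)
Definition height x : R := - \sum_(k < n.+1) x 0 (lift ord0 k).

Lemma heightB a x k : height (x - a *: alpha k) = height x + a.
Proof.
rewrite /height; under eq_bigr => q _ do rewrite !mxE.
rewrite sumrB opprB addrC; congr (_ + _).
rewrite (bigD1 k) //= !eqxx mulr1 big1 ?addr0 // => q nq.
by rewrite (inj_eq (@lift_inj _ ord0)) (negbTE nq) /= mulr0.
Qed.

Lemma height_Lambda0 : height Lambda0 = 0.
Proof. by rewrite /height big1 ?oppr0 // => k _; rewrite mxE. Qed.

Lemma hform_Lambda0 i : p i (Lambda0 : hhat R n) = (i == ord0)%:R.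
Proof. by rewrite hform_alpha // !mxE /= mul1r mul0rn !subr0 addr0. Qed.

Lemma level_subZ a x k : (x - a *: alpha k) 0 ord0 = x 0 ord0.
Proof. by rewrite !mxE andbF mulr0 subr0. Qed.

Lemma hform_alphas_int i k : p i (alpha k : hhat R n) \is a Num.int.
Proof.
have [<-|] := eqVneq i k; first by rewrite hform_alphaii.
rewrite eq_sym => nik.
by have [->|->|[_ ->]] := hform_alpha_cases (R := R) hn nik;
  rewrite ?rpredN ?rpred0 ?rpred1 ?rpred_nat.
Qed.

Definition integral x := forall i, p i x \is a Num.int.

Lemma integral_sub a x k :
  a \is a Num.int -> integral x -> integral (x - a *: alpha k).
Proof.
move=> ha hx i; rewrite hformBl hformZl rpredB // rpredM //.
exact: hform_alphas_int.
Qed.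

Lemma integral_srefl k x : integral x -> integral (srefl k x).
Proof. by move=> hx; apply: integral_sub. Qed.

Definition orbit_like x := [/\ integral x, x 0 ord0 = 1 & 0 <= height x].

Lemma orbit_like_srefl k x : p k x <= 0 ->
  orbit_like (srefl k x) -> orbit_like x.
Proof.
move=> hx [h1 h2 h3].
have e : x = srefl k (srefl k x) by rewrite sreflK.
split; first by rewrite e; exact: integral_srefl.
  by rewrite -h2 /srefl level_subZ.
rewrite e {1}/srefl heightB hform_sreflii addr_ge0 //; lra.
Qed.

Lemma orbit_like_smax k x : orbit_like (smax k x) -> orbit_like x.
Proof.
have [h|h] := ltP (p k x) 0; last by rewrite smax_id.
by rewrite smax_srefl //; apply: orbit_like_srefl; exact: ltW.
Qed.

Lemma lsrel_orbit s tau tau' :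
  lsrel s tau tau' -> orbit_like tau /\ orbit_like tau'.
Proof.
elim=> [|k {}tau {}tau' h1 _ _ [h2 h3]].
  have h : orbit_like Lambda0.
    split; rewrite ?height_Lambda0 ?mxE // => i.
    by rewrite hform_Lambda0; case: (_ == _).
  by split.
split; last exact: orbit_like_smax h3.
by apply: orbit_like_srefl h2; exact: ltW.
Qed.

Lemma int_eq (a b : R) : a \is a Num.int -> b = a -> b \is a Num.int.
Proof. by move=> h ->. Qed.

(** Along a chain, a step reflecting both velocities reflects their difference, and a step
    reflecting [tau] alone changes s * tau by an integral multiple of a simple root. *)
Lemma lsrel_congr s tau tau' i : lsrel s tau tau' ->
  s * (p i tau - p i tau') \is a Num.int.
Proof.
move=> h; elim: h i => [i|k {}tau {}tau' h1 h2 h3 IH i].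
  by rewrite subrr mulr0.
have := IH k; have := IH i; rewrite !hform_srefl !hform_smax !hform_alphaii.
have aik := hform_alphas_int k i; have [h|h] := ltP (p k tau') 0.
  move=> Hi Hk.
  have E1 : s * (p k tau - p k tau') \is a Num.int.
    by rewrite -rpredN; apply: int_eq Hk _; ring.
  have := rpredD Hi (rpredM E1 aik).
  rewrite (hform_alphaC i k).
  by move=> h4; apply: int_eq h4 _; ring.
rewrite mul0r subr0 => Hi _.
have {}h2 : s * p k tau \is a Num.int by case: h2 => //; lra.
have := rpredD Hi (rpredM h2 aik).
rewrite (hform_alphaC i k).
by move=> h4; apply: int_eq h4 _; ring.
Qed.

Lemma int_lt0_le (a : R) : a \is a Num.int -> a < 0 -> a <= -1.
Proof.
clear hn; move=> /intrP[z ->]; rewrite ltrz0 => hz.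
by rewrite -[-1](mulrNz 1 1) ler_int; lia.
Qed.

(** This disposes of the infinite dihedral case in the rank two arguments: at level one the two
    coordinates cannot be nonpositive together. *)
Lemma rank1_sum i k : n = 1%N -> i != k ->
  forall x, p i x + p k x = x 0 ord0.
Proof.
move=> n1 nik x; rewrite -sum_hform_alpha // (bigD1 i) //= (bigD1 k) 1?eq_sym //=.
rewrite big1 ?addr0 // => l /andP[nli nlk].
have := ltn_ord l; have := ltn_ord i; have := ltn_ord k.
by move: nik nli nlk n1; rewrite -!val_eqE /=; lia.
Qed.

(** The exchange property: a chain may start with any reflection that does not raise [tau]. When the
    given chain starts with another k, the induction hypothesis continues it up to the longest word
    in i and k, and the commutation or braid relation rewrites that word so that it starts with
    i. *)
Lemma lsrel_invN N s tau tau' i : height tau < N%:R ->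
  lsrel s tau tau' -> p i tau <= 0 ->
  (s * p i tau \is a Num.int \/ p i tau' < 0) /\
  lsrel s (srefl i tau) (smax i tau').
Proof.
elim: N tau tau' i => [|N IH] tau tau' i hN h.
  by have [[_ _ h0] _] := lsrel_orbit h; move: hN; rewrite ltNge h0.
have [[hint hlev _] _] := lsrel_orbit h.
case: h => [|k {}tau {}tau' hk hc h] in hN hint hlev *.
  move=> h0; have e : p i (Lambda0 : hhat R n) = 0.
    by move: h0; rewrite hform_Lambda0; case: (i == ord0); rewrite ?ler10.
  rewrite e mulr0; split; [by left|rewrite srefl_fix // smax_id ?e //].
  exact: lsrel_base.
have ht x l : integral x -> p l x < 0 -> height x < N.+1%:R ->
    height (srefl l x) < N%:R.
  move=> hx hl; rewrite /srefl heightB -natr1.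
  by have := int_lt0_le (hx l) hl; lra.
have [->|nik] := eqVneq i k; first by [].
move=> hi.
have htk := ht _ _ hint hk hN.
have aki : k != i by rewrite eq_sym.
have [e|e|[n1 e]] := hform_alpha_cases (R := R) hn aki.
- have e' : p k (alpha i : hhat R n) = 0 by rewrite hform_alphaC.
  have [|h1 h2] := IH _ _ i htk h; first by rewrite hform_srefl e mulr0 subr0.
  move: h1; rewrite hform_srefl hform_smax e !mulr0 !subr0 => h1; split=> //.
  apply: (@lsrel_step s k).
  + by rewrite hform_srefl e' mulr0 subr0.
  + by rewrite hform_srefl hform_smax e' !mulr0 !subr0.
  + by rewrite srefl_comm // smax_comm.
- have e' : p k (alpha i : hhat R n) = -1 by rewrite hform_alphaC.
  have [|h1 h2] := IH _ _ i htk h; first by rewrite hform_srefl e; lra.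
  have hint1 := integral_srefl k hint.
  have hti : height (srefl i (srefl k tau)) < N%:R.
    apply: ht => //; first by rewrite hform_srefl e; lra.
    by apply: lt_trans htk _; rewrite ltr_nat.
  have [|h3 h4] := IH _ _ k hti h2.
    by rewrite !hform_srefl hform_alphaii e e'; lra.
  have S1 : p k (srefl i tau) = p k tau + p i tau.
    by rewrite hform_srefl e'; ring.
  have S2 : p i (srefl k (srefl i tau)) = p k tau.
    by rewrite !hform_srefl hform_alphaii e e'; ring.
  have S3 : p i (srefl k tau) = p k tau + p i tau.
    by rewrite hform_srefl e; ring.
  have S4 : p k (srefl i (srefl k tau)) = p i tau.
    by rewrite !hform_srefl hform_alphaii e e'; ring.
  move: h1 h3; rewrite S3 S4.
  rewrite !hform_smax !hform_alphaii e e' => h1 h3.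
  set a := p k tau in hk hc h1 h3 S1 S2 *.
  set b := p i tau in hi h1 h3 S1 *.
  set x := p k tau' in hc h1 h3 *; set y := p i tau' in h1 h3 *.
  have Iab : s * (a + b) \is a Num.int -> s * b \is a Num.int ->
      s * a \is a Num.int.
    move=> u v; rewrite (_ : s * a = s * (a + b) - s * b); first exact: rpredB.
    by ring.
  have Iab' : s * a \is a Num.int -> s * b \is a Num.int ->
      s * (a + b) \is a Num.int.
    by move=> u v; rewrite mulrDr rpredD.
  have Iab'' : s * a \is a Num.int -> s * (a + b) \is a Num.int ->
      s * b \is a Num.int.
    move=> u v; rewrite (_ : s * b = s * (a + b) - s * a); first exact: rpredB.
    by ring.
  (* The word k i k meets the positive roots with coordinates a, a + b, b in this order, and i k i
     meets them in the opposite order. These are the side conditions of the second word; the signs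
     of x and y decide which integrality statements of the first word provide them. *)
  have [C1 C2 C3] : [/\ s * b \is a Num.int \/ y < 0,
      s * (a + b) \is a Num.int \/ x - Num.min y 0 * -1 < 0 &
      s * a \is a Num.int \/ y - Num.min y 0 * 2 -
        Num.min (x - Num.min y 0 * -1) 0 * -1 < 0].
    have [x0|x0] := ltP x 0; have [y0|y0] := ltP y 0;
      rewrite ?(min_l (ltW x0)) ?(min_r x0) ?(min_l (ltW y0)) ?(min_r y0) in
        h1 h3 *.
    + by split; right; rewrite ?min_l; lra.
    + have hb : s * b \is a Num.int.
        case: h3 => //.
        by have [z|z] := ltP (y - x * -1) 0;
          rewrite ?(min_l (ltW z)) ?(min_r z); lra.
      split; [by left|by right; lra|].
      case: h1 => h1; first by left; apply: Iab.
      by right; rewrite min_l; lra.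
    + have ha : s * a \is a Num.int by case: hc => //; lra.
      split; [by right| |by left].
      case: h3 => h3; first by left; apply: Iab'.
      right; move: h3.
      by rewrite (min_l (_ : y - 0 * -1 <= 0)); lra.
    + have ha : s * a \is a Num.int by case: hc => //; lra.
      have hab : s * (a + b) \is a Num.int by case: h1 => //; lra.
      by split; left => //; apply: Iab''.
  split=> //; apply: (@lsrel_step s k).
  + by rewrite S1; lra.
  + by rewrite S1 hform_smax e'.
  apply: (@lsrel_step s i).
  + by rewrite S2.
  + by rewrite S2 !hform_smax !hform_alphaii e e'.
  by rewrite srefl_braid // smax_braid.
- by have := rank1_sum n1 nik tau; rewrite hlev; lra.
Qed.

Lemma lsrel_inv s tau tau' i : lsrel s tau tau' -> p i tau <= 0 ->
  (s * p i tau \is a Num.int \/ p i tau' < 0) /\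
  lsrel s (srefl i tau) (smax i tau').
Proof. by apply: lsrel_invN; exact: truncnS_gt. Qed.

(** The boundary case of the converse to [lsrel_inv]. The chain starts with some k different from i,
    as i fixes [tau], and the rank two relation carries the truncation by i past it; in the braid
    case it reappears as a truncation by k over a velocity fixed by k. *)
Lemma lsrel_unsmaxN N s tau tau' i : height tau < N%:R ->
  p i tau = 0 -> lsrel s tau (smax i tau') -> lsrel s tau tau'.
Proof.
elim: N tau tau' i => [|N IH] tau tau' i hN pi0 h.
  by have [[_ _ h0] _] := lsrel_orbit h; move: hN; rewrite ltNge h0.
have [pi'|pi'] := ltP (p i tau') 0; last by rewrite smax_id in h.
have [[hint hlev _] _] := lsrel_orbit h.
move: h; move E: (smax i tau') => sigma h.
case: h E hN pi0 hint hlev => [|k {}tau {}sigma hk hc h] E hN pi0 hint hlev.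
  have := hform_sreflii i tau'; rewrite -smax_srefl // E pi0; lra.
rewrite -{sigma}E in hc h.
have ht x l : integral x -> p l x < 0 -> height x < N.+1%:R ->
    height (srefl l x) < N%:R.
  move=> hx hl; rewrite /srefl heightB -natr1.
  by have := int_lt0_le (hx l) hl; lra.
have nik : i != k by apply: contraPneq hk => <-; rewrite pi0 ltxx.
have htk := ht _ _ hint hk hN.
have aki : k != i by rewrite eq_sym.
have [e|e|[n1 e]] := hform_alpha_cases (R := R) hn aki.
- have e' : p k (alpha i : hhat R n) = 0 by rewrite hform_alphaC.
  apply: (@lsrel_step s k) => //.
    by move: hc; rewrite hform_smax e' mulr0 subr0.
  apply: (IH _ _ i htk); last by rewrite smax_comm.
  by rewrite hform_srefl e mulr0 subr0.
- have e' : p k (alpha i : hhat R n) = -1 by rewrite hform_alphaC.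
  have S3 : p i (srefl k tau) = p k tau by rewrite hform_srefl e pi0; ring.
  have S4 : p k (srefl i (srefl k tau)) = 0.
    by rewrite !hform_srefl hform_alphaii e e' pi0; ring.
  have [|h1 h2] := lsrel_inv (i := i) h; first by rewrite S3 ltW.
  have hti : height (srefl i (srefl k tau)) < N%:R.
    apply: ht; [exact: integral_srefl|by rewrite S3|].
    by apply: lt_trans htk _; rewrite ltr_nat.
  rewrite smax_braid // in h2.
  have {}h2 := IH _ _ _ hti S4 h2.
  have [C1 C2] : (s * p k tau \is a Num.int \/ p k tau' < 0) /\
      (s * p k tau \is a Num.int \/ p i (smax k tau') < 0).
    move: h1 hc; rewrite S3 !hform_smax !hform_alphaii e e' (min_l (ltW pi')).
    move=> [|h1]; first by move=> hs _; split; left.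
    move=> [|h3]; first by move=> h4; split; left.
    move: h1; rewrite min_l; last exact: ltW.
    move=> h1; have pk : p k tau' < 0 by lra.
    by rewrite (min_l (ltW pk)); split; right; lra.
  apply: (@lsrel_step s k) => //; apply: (@lsrel_step s i) => //.
    by rewrite S3.
  by rewrite S3.
- by have := rank1_sum n1 nik tau; rewrite hlev; lra.
Qed.

Lemma lsrel_unsmax s tau tau' i :
  p i tau = 0 -> lsrel s tau (smax i tau') -> lsrel s tau tau'.
Proof. by apply: lsrel_unsmaxN; exact: truncnS_gt. Qed.

Lemma lsrel_unstep s tau tau' i : p i tau <= 0 ->
  s * p i tau \is a Num.int \/ p i tau' < 0 ->
  lsrel s (srefl i tau) (smax i tau') -> lsrel s tau tau'.
Proof.
rewrite le_eqVlt => /orP[/eqP h _|h]; last exact: lsrel_step.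
by rewrite srefl_fix //; exact: lsrel_unsmax.
Qed.

Lemma lsrel_dominant s tau tau' :
  lsrel s tau tau' -> (forall i, 0 <= p i tau) -> tau = Lambda0.
Proof. by case=> // k {}tau {}tau' hk _ _ h; move: (h k); rewrite leNgt hk. Qed.

Lemma lsrel_Lambda0 s tau' : lsrel s Lambda0 tau' -> tau' = Lambda0.
Proof.
move E: (Lambda0) => tau h; case: h E => // k {}tau {}tau' hk _ _ E.
by move: hk; rewrite -E hform_Lambda0; case: (_ == _); rewrite ?ltr10 ?ltxx.
Qed.

End AChains.

(** * Piecewise linear functions and their running minima *)

Section RunningMinimum.
Context {R : realType}.
Implicit Types (f g M : R -> R) (a b c r s t u v : R).

(** Real induction: the supremum of the points up to which [Q] holds satisfies [Q] by the left
    closure hypothesis, and lies below [b] only if the right extension hypothesis fails. It replaces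
    compactness throughout. *)
Lemma interval_ind (Q : R -> Prop) a b : Q a ->
  (forall s, a <= s < b -> Q s ->
     exists2 r, s < r <= b & forall u, s <= u <= r -> Q u) ->
  (forall s, a < s <= b -> (forall u, a <= u < s -> Q u) -> Q s) ->
  forall s, a <= s <= b -> Q s.
Proof.
move=> Qa Qr Ql s /andP[as_ sb].
pose A := [set x | a <= x <= b /\ forall u, a <= u <= x -> Q u].
have Aa : A a.
  split; first by rewrite lexx (le_trans as_ sb).
  by move=> u; rewrite -eq_le => /eqP <-.
have supA : has_sup A.
  by split; [exists a|exists b => x [/andP[_ ?] _]].
set S := sup A.
have aS : a <= S by apply: sup_upper_bound.
have Sb : S <= b by apply: ge_sup; [exists a|move=> x [/andP[_ ?] _]].
have lt_S u : a <= u < S -> Q u.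
  move=> /andP[au uS]; have e0 : 0 < S - u by rewrite subr_gt0.
  have [x [_ Ax] ux] := sup_adherent e0 supA.
  by apply: Ax; rewrite au /=; move: ux; rewrite -/S; lra.
have QS : Q S.
  have [->//|nS] := eqVneq S a.
  by apply: Ql => //; rewrite lt_neqAle eq_sym nS aS.
have le_S u : a <= u <= S -> Q u.
  move=> /andP[au]; rewrite le_eqVlt => /orP[/eqP -> //|uS].
  by apply: lt_S; rewrite au.
have [Sb'|bS] := ltP S b; last by apply: le_S; rewrite as_ (le_trans sb).
have [|r /andP[Sr rb] Hr] := Qr S _ QS; first by rewrite aS.
suff : A r by move=> /(sup_upper_bound supA); rewrite leNgt Sr.
split=> [|u /andP[au ur]]; first by rewrite rb (le_trans aS (ltW Sr)).
have [uS|Su] := leP u S; first by apply: le_S; rewrite au.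
by apply: Hr; rewrite ur ltW.
Qed.

(* Paths live on [0, 1]; only the values there matter. *)
Definition rslope f s a := exists2 r, s < r <= 1 &
  forall u, s <= u <= r -> f u = f s + (u - s) * a.
Definition lslope f s a := exists2 r, 0 <= r < s &
  forall u, r <= u <= s -> f u = f s + (u - s) * a.
(** Piecewise linearity without breakpoints. The one-sided form can be checked pointwise for running
    minima and folded paths; a finite subdivision is recovered by [interval_ind]. *)
Definition PL f := (forall s, 0 <= s < 1 -> exists a, rslope f s a) /\
  (forall s, 0 < s <= 1 -> exists a, lslope f s a).

Definition imin f t := inf [set f s | s in `[0, t]].

Lemma imin_eq f t m : (forall v, 0 <= v <= t -> m <= f v) ->
  (exists2 u, 0 <= u <= t & f u = m) -> imin f t = m.
Proof.
move=> hm [u hu fu]; have inu : [set f s | s in `[0, t]] m.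
  by exists u => //=; rewrite in_itv.
have lbm : lbound [set f s | s in `[0, t]] m.
  by move=> _ [v /= + <-]; rewrite in_itv /=; exact: hm.
apply/eqP; rewrite eq_le; apply/andP; split.
  by apply: ge_inf => //; exists m.
by apply: lb_le_inf => //; exists m.
Qed.

Lemma PL_min_exists f : PL f -> forall t, 0 <= t <= 1 ->
  exists2 u, 0 <= u <= t & forall v, 0 <= v <= t -> f u <= f v.
Proof.
move=> [fr fl]; apply: interval_ind.
- exists 0; first by rewrite lexx.
  by move=> v; rewrite -eq_le => /eqP <-.
- move=> s hs [u hu um]; have [a [r hr fE]] := fr s hs.
  exists r => // t ht; have [a0|a0] := leP 0 a.
    exists u => [|v hv]; first by lra.
    have [vs|sv] := leP v s; first by apply: um; lra.
    rewrite (fE v); last by lra.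
    have : f u <= f s by apply: um; lra.
    have : 0 <= (v - s) * a by apply: mulr_ge0; lra.
    lra.
  have [h|h] := leP (f u) (f t).
    exists u => [|v hv]; first by lra.
    have [vs|sv] := leP v s; first by apply: um; lra.
    apply: le_trans h _; rewrite (fE t) // (fE v); last by lra.
    by rewrite lerD2l ler_wnM2r //; lra.
  exists t => [|v hv]; first by lra.
  have [vs|sv] := leP v s; first by apply: le_trans (ltW h) (um _ _); lra.
  rewrite (fE t) // (fE v); last by lra.
  by rewrite lerD2l ler_wnM2r //; lra.
- move=> s hs IH; have [a [r hr fE]] := fl s hs.
  have [u hu um] : exists2 u, 0 <= u <= r &
      forall v, 0 <= v <= r -> f u <= f v by apply: IH; lra.
  have fr' : f u <= f r by apply: um; lra.
  have fE' := fE r; have [h|h] := leP (f u) (f s).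
    exists u => [|v hv]; first by lra.
    have [vs|sv] := leP v r; first by apply: um; lra.
    have [a0|a0] := leP 0 a.
      apply: le_trans fr' _; rewrite (fE r) ?(fE v); [|lra..].
      by rewrite lerD2l ler_wpM2r //; lra.
    apply: le_trans h _; rewrite (fE v); last by lra.
    by rewrite lerDl mulr_le0 //; lra.
  exists s => [|v hv]; first by lra.
  have [vs|sv] := leP v r; first by apply: le_trans (ltW h) (um _ _); lra.
  rewrite (fE v); last by lra.
  rewrite lerDl mulr_le0 //; first by lra.
  rewrite leNgt; apply/negP => a0.
  have : 0 < (s - r) * a by apply: mulr_gt0; lra.
  have /fE' : r <= r <= s by lra.
  lra.
Qed.

Lemma imin_attained f t : PL f -> 0 <= t <= 1 ->
  (exists2 u, 0 <= u <= t & f u = imin f t) /\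
  (forall v, 0 <= v <= t -> imin f t <= f v).
Proof.
move=> pf ht; have [u hu um] := PL_min_exists pf ht.
by rewrite (@imin_eq f t (f u)) //; [split=> //; exists u|exists u].
Qed.

Lemma imin_le f t v : PL f -> 0 <= t <= 1 -> 0 <= v <= t -> imin f t <= f v.
Proof. by move=> pf ht hv; have [_] := imin_attained pf ht; exact. Qed.

Lemma imin_anti f t t' : PL f -> 0 <= t <= t' -> t' <= 1 ->
  imin f t' <= imin f t.
Proof.
move=> pf ht ht'; have [|[u hu <-] _] := @imin_attained f t pf; first by lra.
by apply: imin_le => //; lra.
Qed.

Lemma imin0 f : imin f 0 = f 0.
Proof.
apply: imin_eq; last by exists 0; rewrite ?lexx.
by move=> v; rewrite -eq_le => /eqP <-.
Qed.

Lemma imin_right_dec f s a : PL f -> 0 <= s < 1 -> rslope f s a -> a < 0 ->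
  imin f s = f s ->
  exists2 r, s < r <= 1 & forall u, s <= u <= r -> imin f u = f u.
Proof.
move=> pf hs [r hr fE] a0 ms; exists r => // u hu.
apply: imin_eq => [v hv|]; last by exists u => //; lra.
have [vs|sv] := leP v s; last first.
  rewrite (fE u) // (fE v); last by lra.
  by rewrite lerD2l ler_wnM2r //; lra.
have fsv : f s <= f v by rewrite -ms; apply: imin_le => //; lra.
apply: le_trans fsv; rewrite (fE u) // gerDl mulr_ge0_le0 //; lra.
Qed.

Lemma imin_right_const f s a : PL f -> 0 <= s < 1 -> rslope f s a ->
  0 <= a \/ imin f s < f s ->
  exists2 r, s < r <= 1 & forall u, s <= u <= r -> imin f u = imin f s.
Proof.
move=> pf hs [r hr fE] h.
have [|[u0 hu0 fu0] low] := @imin_attained f s pf; first by lra.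
have [r' hr' ge] : exists2 r', s < r' <= r &
    forall u, s <= u <= r' -> imin f s <= f u.
  have [a0|a0] := leP 0 a.
    exists r => [|u hu]; first by lra.
    rewrite (fE u) //; apply: (@le_trans _ _ (f s)); first by apply: low; lra.
    by rewrite lerDl mulr_ge0 //; lra.
  have {}h : imin f s < f s by case: h => //; lra.
  (* The time needed at slope [a] to come down from [f s] to the current minimum. *)
  pose e := (imin f s - f s) / a.
  have e0 : 0 < e by rewrite /e -mulrNN -invrN divr_gt0 // oppr_gt0 // subr_lt0.
  exists (Num.min r (s + e)) => [|u].
    by rewrite lt_min ge_min lexx andbT; lra.
  rewrite le_min => /and3P[su ur ue]; rewrite (fE u); last by lra.
  have : e * a <= (u - s) * a by rewrite ler_wnM2r //; lra.
  by rewrite /e divfK; [lra|rewrite lt_eqF].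
exists r' => [|u hu]; first by lra.
apply: imin_eq => [v hv|]; last by exists u0 => //; lra.
by have [vs|sv] := leP v s; [apply: low|apply: ge]; lra.
Qed.

(** If the minimum over [0, s] is already reached before s, the running minimum is frozen from then
    on. Otherwise s is a strict record, approached along a decreasing piece, and the running minimum
    follows [f] on the last part of it. *)
Lemma imin_left f s a : PL f -> 0 < s <= 1 -> lslope f s a ->
  (exists2 r, 0 <= r < s & forall u, r <= u <= s -> imin f u = imin f s) \/
  [/\ a < 0, imin f s = f s, forall v, 0 <= v < s -> f s < f v
    & exists2 r, 0 <= r < s & forall u, r <= u <= s -> imin f u = f u].
Proof.
move=> pf hs [r hr fE].
have [|[u0 hu0 fu0] low] := @imin_attained f s pf; first by lra.
have [[v0 hv0 fv0]|nv] := pselect (exists2 v, 0 <= v < s & f v = imin f s).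
  left; exists v0 => // u hu; apply: imin_eq => [v hv|].
    by apply: low; lra.
  by exists v0 => //; lra.
right; have ms : imin f s = f s.
  have [e|nu0] := eqVneq u0 s; first by rewrite -fu0 e.
  case: nv; exists u0 => //; case/andP: hu0 => -> /=.
  by rewrite lt_neqAle nu0.
have lt_s v : 0 <= v < s -> f s < f v.
  move=> hv; rewrite lt_neqAle -ms low ?andbT; last by lra.
  by apply/eqP => e; apply: nv; exists v.
have a0 : a < 0.
  rewrite ltNge; apply/negP => a0; have := lt_s r hr; rewrite (fE r); last by lra.
  have : (r - s) * a <= 0 by apply: mulr_le0_ge0; lra.
  lra.
split=> //.
have [|[u1 hu1 fu1] low1] := @imin_attained f r pf; first by lra.
have fsr : f s < imin f r by rewrite -fu1; apply: lt_s; lra.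
pose e := (imin f r - f s) / - a.
have e0 : 0 < e by rewrite divr_gt0 ?oppr_gt0 ?subr_gt0.
exists (Num.max r (s - e)) => [|u].
  by rewrite le_max gt_max; apply/andP; split; [apply/orP; left|]; lra.
rewrite ge_max => /andP[/andP[ru eu] us].
apply: imin_eq => [v hv|]; last by exists u => //; lra.
have [vr|rv] := leP v r.
  apply: le_trans (low1 _ _); last by lra.
  rewrite (fE u); last by lra.
  have : (s - u) * - a <= e * - a by rewrite ler_wpM2r //; lra.
  by rewrite /e divfK; [lra|rewrite gt_eqF // oppr_gt0].
rewrite (fE u) ?(fE v); [|lra..].
by rewrite lerD2l ler_wnM2r //; lra.
Qed.

(** As long as [f] does not come back to the level M t while M is still there, neither local
    alternative lets M leave that level; real induction then reaches 1. Applied to running minima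
    and, after time reversal, to future minima. *)
Lemma touch_or_const M f :
  (forall s, 0 <= s < 1 ->
    (exists2 r, s < r <= 1 & forall u, s <= u <= r -> M u = M s) \/ M s = f s) ->
  (forall s, 0 < s <= 1 ->
    (exists2 r, 0 <= r < s & forall u, r <= u <= s -> M u = M s) \/
    (exists2 r, 0 <= r < s & forall u, r <= u <= s -> M u = f u)) ->
  forall t, 0 <= t <= 1 ->
  (exists v, [/\ t <= v <= 1, f v = M t & M v = M t]) \/ M 1 = M t.
Proof.
move=> Mr Ml t ht.
have [[v hv]|nv] := pselect (exists v, [/\ t <= v <= 1, f v = M t & M v = M t]).
  by left; exists v.
right; apply: (@interval_ind (fun u => M u = M t) t 1) => //; last by lra.
- move=> s hs e; case: (Mr s) => [|[r hr rE]|sE]; first by lra.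
    by exists r => // u hu; rewrite rE.
  by case: nv; exists s; split; rewrite -?sE //; lra.
- move=> s hs IH; case: (Ml s) => [|[r hr rE]|[r hr rE]]; first by lra.
    pose u := Num.max r t; have [ru tu us] : [/\ r <= u, t <= u & u < s].
      by rewrite /u !le_max gt_max !lexx orbT; split=> //; lra.
    by rewrite -(rE u) ?IH //; lra.
  pose u := Num.max r t; have [ru tu us] : [/\ r <= u, t <= u & u < s].
    by rewrite /u !le_max gt_max !lexx orbT; split=> //; lra.
  have uE : M u = M t by apply: IH; lra.
  case: nv; exists u; split=> //; first by lra.
  by rewrite -uE rE //; lra.
Qed.
End RunningMinimum.

(** * Future minima, by time reversal *)

Section FutureMinimum.
Context {R : realType}.
Implicit Types (f : R -> R) (a b c r s t u v : R).

Lemma lslope_le0 f s a r0 : lslope f s a -> r0 < s ->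
  (forall u, r0 <= u <= s -> f s <= f u) -> a <= 0.
Proof.
move=> [r hr fE] hr0 h; rewrite leNgt; apply/negP => a0.
pose u := Num.max r r0; have [ru tu us] : [/\ r <= u, r0 <= u & u < s].
  by rewrite /u !le_max gt_max !lexx orbT; split=> //; lra.
have := h u; rewrite (fE u); last by lra.
have : (u - s) * a < 0 by rewrite nmulr_rlt0 //; lra.
have hu : r0 <= u <= s by lra.
by move=> h1 /(_ hu); lra.
Qed.

Lemma rslope_ge0 f s a r0 : rslope f s a -> s < r0 ->
  (forall u, s <= u <= r0 -> f s <= f u) -> 0 <= a.
Proof.
move=> [r hr fE] hr0 h; rewrite leNgt; apply/negP => a0.
pose u := Num.min r r0; have [ru tu us] : [/\ u <= r, u <= r0 & s < u].
  by rewrite /u !ge_min lt_min !lexx orbT; split=> //; lra.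
have := h u; rewrite (fE u); last by lra.
have : (u - s) * a < 0 by rewrite pmulr_rlt0 //; lra.
have hu : s <= u <= r0 by lra.
by move=> h1 /(_ hu); lra.
Qed.

Lemma rslope_rev f s a :
  0 <= s < 1 -> rslope f s a -> lslope (fun v => f (1 - v)) (1 - s) (- a).
Proof.
move=> hs [r hr fE]; exists (1 - r) => [|u hu]; first by lra.
rewrite /= subKr (fE (1 - u)); last by lra.
by ring.
Qed.

Lemma lslope_rev f s a :
  0 < s <= 1 -> lslope f s a -> rslope (fun v => f (1 - v)) (1 - s) (- a).
Proof.
move=> hs [r hr fE]; exists (1 - r) => [|u hu]; first by lra.
rewrite /= subKr (fE (1 - u)); last by lra.
by ring.
Qed.

Lemma PL_rev f : PL f -> PL (fun v => f (1 - v)).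
Proof.
move=> [fr fl]; split=> s hs.
  have [|a fa] := fl (1 - s); first by lra.
  exists (- a); rewrite -[X in rslope _ X](_ : 1 - (1 - s) = s); last by ring.
  by apply: lslope_rev fa; lra.
have [|a fa] := fr (1 - s); first by lra.
exists (- a); rewrite -[X in lslope _ X](_ : 1 - (1 - s) = s); last by ring.
by apply: rslope_rev fa; lra.
Qed.

(** The last clause says that a cap never produces a positive slope, so wherever the capped function
    increases it is [f] itself. After reversal this identifies the times at which the future minimum
    moves. *)
Lemma rslope_min a f s b : 0 <= s < 1 -> rslope f s b ->
  exists c, rslope (fun v => Num.min a (f v)) s c /\
    (0 < c -> c = b /\
      exists2 r, s < r <= 1 & forall u, s <= u <= r -> Num.min a (f u) = f u).
Proof.
move=> hs [r hr fE].
have mul u : s <= u <= r ->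
  [/\ 0 <= u - s, 0 <= b -> 0 <= (u - s) * b & b <= 0 -> (u - s) * b <= 0].
  move=> hu; split=> [|b0|b0]; first by lra.
    by apply: mulr_ge0; lra.
  by apply: mulr_ge0_le0; lra.
have [[b0 fs]|[b0 fs]|[b0 fs]|[b0 fs]] : [\/ 0 < b /\ f s < a, 0 < b /\ a <= f s,
    b <= 0 /\ f s <= a | b <= 0 /\ a < f s].
- by have [?|?] := ltP 0 b; [have [?|?] := ltP (f s) a|have [?|?] := leP (f s) a];
    [apply: Or41|apply: Or42|apply: Or43|apply: Or44].
- exists b; pose e := (a - f s) / b.
  have e0 : 0 < e by rewrite divr_gt0 // subr_gt0.
  pose r' := Num.min r (s + e).
  have [r1 r2 r3] : [/\ r' <= r, r' <= s + e & s < r'].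
    by rewrite /r' !ge_min lt_min !lexx orbT; split=> //; lra.
  have mE u : s <= u <= r' -> Num.min a (f u) = f u.
    move=> hu; apply: min_r; rewrite (fE u); last by lra.
    have : (u - s) * b <= e * b by rewrite ler_wpM2r //; lra.
    by rewrite /e divfK; [lra|rewrite gt_eqF].
  split; last by move=> _; split=> //; exists r' => //; lra.
  by exists r' => [|u hu]; [lra|rewrite !mE ?(fE u) //; lra].
- exists 0; split; last by rewrite ltxx.
  exists r => // u hu; rewrite mulr0 addr0 (min_l fs) min_l // fE //.
  by have [_ h _] := mul u hu; have := h (ltW b0); lra.
- exists b; have mE u : s <= u <= r -> Num.min a (f u) = f u.
    move=> hu; apply: min_r; rewrite (fE u) //.
    by have [_ _ h] := mul u hu; have := h b0; lra.
  split; last by move=> _; split=> //; exists r.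
  by exists r => // u hu; rewrite !mE ?(fE u) //; lra.
- exists 0; split; last by rewrite ltxx.
  have [b00|nb0] := eqVneq b 0.
    exists r => // u hu; rewrite (fE u) // b00 !mulr0 !addr0 //.
  have {}b0 : 0 < - b by rewrite oppr_gt0 lt_neqAle nb0.
  pose e := (f s - a) / - b.
  have e0 : 0 < e by rewrite divr_gt0 // subr_gt0.
  pose r' := Num.min r (s + e).
  have [r1 r2 r3] : [/\ r' <= r, r' <= s + e & s < r'].
    by rewrite /r' !ge_min lt_min !lexx orbT; split=> //; lra.
  exists r' => [|u hu]; first by lra.
  rewrite mulr0 addr0 (min_l (ltW fs)) min_l // fE; last by lra.
  have : (u - s) * - b <= e * - b by rewrite ler_wpM2r //; lra.
  by rewrite /e divfK; [lra|rewrite gt_eqF].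
Qed.

Lemma lslope_min a f s b : 0 < s <= 1 -> lslope f s b ->
  exists c, lslope (fun v => Num.min a (f v)) s c /\
    (0 < c -> c = b /\
      exists2 r, 0 <= r < s & forall u, r <= u <= s -> Num.min a (f u) = f u).
Proof.
move=> hs [r hr fE].
have mul u : r <= u <= s ->
  (0 <= b -> (u - s) * b <= 0) /\ (b <= 0 -> 0 <= (u - s) * b).
  move=> hu; split=> b0; first by apply: mulr_le0_ge0; lra.
  by apply: mulr_le0; lra.
have [[b0 fs]|[b0 fs]|[b0 fs]|[b0 fs]] : [\/ 0 <= b /\ f s <= a, 0 <= b /\ a < f s,
    b < 0 /\ f s < a | b < 0 /\ a <= f s].
- by have [?|?] := leP 0 b; [have [?|?] := leP (f s) a|have [?|?] := ltP (f s) a];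
    [apply: Or41|apply: Or42|apply: Or43|apply: Or44].
- exists b; have mE u : r <= u <= s -> Num.min a (f u) = f u.
    move=> hu; apply: min_r; rewrite (fE u) //.
    by have [h _] := mul u hu; have := h b0; lra.
  split; last by move=> _; split=> //; exists r.
  by exists r => // u hu; rewrite !mE ?(fE u) //; lra.
- exists 0; split; last by rewrite ltxx.
  have [b00|nb0] := eqVneq b 0.
    exists r => // u hu; rewrite (fE u) // b00 !mulr0 !addr0 //.
  have {}b0 : 0 < b by rewrite lt_neqAle eq_sym nb0.
  pose e := (f s - a) / b.
  have e0 : 0 < e by rewrite divr_gt0 // subr_gt0.
  pose r' := Num.max r (s - e).
  have [r1 r2 r3] : [/\ r <= r', s - e <= r' & r' < s].
    by rewrite /r' !le_max gt_max !lexx orbT; split=> //; lra.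
  exists r' => [|u hu]; first by lra.
  rewrite mulr0 addr0 (min_l (ltW fs)) min_l // fE; last by lra.
  have : (s - u) * b <= e * b by rewrite ler_wpM2r //; lra.
  by rewrite /e divfK; [lra|rewrite gt_eqF].
- exists b; split; last by move=> ?; lra.
  pose e := (a - f s) / - b.
  have nb0 : 0 < - b by rewrite oppr_gt0.
  have e0 : 0 < e by rewrite divr_gt0 // subr_gt0.
  pose r' := Num.max r (s - e).
  have [r1 r2 r3] : [/\ r <= r', s - e <= r' & r' < s].
    by rewrite /r' !le_max gt_max !lexx orbT; split=> //; lra.
  have mE u : r' <= u <= s -> Num.min a (f u) = f u.
    move=> hu; apply: min_r; rewrite (fE u); last by lra.
    have : (s - u) * - b <= e * - b by rewrite ler_wpM2r //; lra.
    by rewrite /e divfK; [lra|rewrite gt_eqF].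
  by exists r' => [|u hu]; [lra|rewrite !mE ?(fE u) //; lra].
- exists 0; split; last by rewrite ltxx.
  exists r => // u hu; rewrite mulr0 addr0 (min_l fs) min_l // fE //.
  by have [_ h] := mul u hu; have := h (ltW b0); lra.
Qed.

Lemma PL_min a f : PL f -> PL (fun v => Num.min a (f v)).
Proof.
move=> [fr fl]; split=> s hs.
  have [b fb] := fr s hs; have [c [hc _]] := rslope_min a hs fb.
  by exists c.
have [b fb] := fl s hs; have [c [hc _]] := lslope_min a hs fb.
by exists c.
Qed.

(* [min(a, inf_[t, 1] f)], as a running minimum of the reversed path. *)
Definition fmin a f t := imin (fun v => Num.min a (f (1 - v))) (1 - t).

Section FminTheory.
Variables (a : R) (f : R -> R).
Hypothesis pf : PL f.
Let g v := Num.min a (f (1 - v)).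

Let pg : PL g. Proof. exact: (PL_rev (PL_min a pf)). Qed.

Lemma fmin_le t u : 0 <= t <= u -> u <= 1 -> fmin a f t <= Num.min a (f u).
Proof.
move=> ht hu; have -> : Num.min a (f u) = g (1 - u) by rewrite /g subKr.
by apply: imin_le => //; lra.
Qed.

Lemma fmin_le_f t u : 0 <= t <= u -> u <= 1 -> fmin a f t <= f u.
Proof.
by move=> ht hu; apply: le_trans (fmin_le ht hu) _; rewrite ge_min lexx orbT.
Qed.

Lemma fmin_attained t : 0 <= t <= 1 ->
  exists2 u, t <= u <= 1 & Num.min a (f u) = fmin a f t.
Proof.
move=> ht; have [|[v hv gv] _] := @imin_attained _ g (1 - t) pg; first by lra.
by exists (1 - v); [lra|].
Qed.

Lemma fmin1 : fmin a f 1 = Num.min a (f 1).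
Proof. by rewrite /fmin subrr imin0 subr0. Qed.

Lemma fmin_right s b : 0 <= s < 1 -> rslope f s b ->
  (exists2 r, s < r <= 1 & forall u, s <= u <= r -> fmin a f u = fmin a f s) \/
  [/\ 0 < b, fmin a f s = f s
    & exists2 r, s < r <= 1 & forall u, s <= u <= r -> fmin a f u = f u].
Proof.
move=> hs fb; have [c [gc hc]] := rslope_min a hs fb.
have g1 : lslope g (1 - s) (- c) by apply: (rslope_rev hs gc).
have [|[r hr rE]|[c0 gs _ [r hr rE]]] := imin_left pg _ g1; first by lra.
  left; exists (1 - r) => [|u hu]; first by lra.
  by rewrite /fmin rE //; lra.
right; have [|cb [r' hr' rE']] := hc; first by lra.
split; first by lra.
  by rewrite /fmin gs /g subKr rE' //; lra.
pose q := Num.min (1 - r) r'; have [q1 q2 q3] : [/\ q <= 1 - r, q <= r' & s < q].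
  by rewrite /q !ge_min lt_min !lexx orbT; split=> //; lra.
exists q => [|u hu]; first by lra.
rewrite /fmin rE ?/g ?subKr; last by lra.
by rewrite rE' //; lra.
Qed.

Lemma fmin_left s b : 0 < s <= 1 -> lslope f s b ->
  (exists2 r, 0 <= r < s & forall u, r <= u <= s -> fmin a f u = fmin a f s) \/
  [/\ 0 < b, fmin a f s = f s
    & exists2 r, 0 <= r < s & forall u, r <= u <= s -> fmin a f u = f u].
Proof.
move=> hs fb; have [c [gc hc]] := lslope_min a hs fb.
have g1 : rslope g (1 - s) (- c) by apply: (lslope_rev hs gc).
have hs' : 0 <= 1 - s < 1 by lra.
have [/andP[c0 /eqP ms]|h] := boolP ((0 < c) && (imin g (1 - s) == g (1 - s))).
  right; have [cb [r' hr' rE']] := hc c0.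
  have [|r hr rE] := imin_right_dec pg hs' g1 _ ms; first by lra.
  split; first by lra.
    by rewrite /fmin ms /g subKr rE' //; lra.
  pose q := Num.max (1 - r) r'.
  have [q1 q2 q3] : [/\ 1 - r <= q, r' <= q & q < s].
    by rewrite /q !le_max gt_max !lexx orbT; split=> //; lra.
  exists q => [|u hu]; first by lra.
  rewrite /fmin rE ?/g ?subKr; last by lra.
  by rewrite rE' //; lra.
left; have [|r hr rE] := imin_right_const pg hs' g1.
  move: h; rewrite negb_and -leNgt => /orP[|h]; first by left; lra.
  by right; rewrite lt_neqAle h imin_le //; lra.
exists (1 - r) => [|u hu]; first by lra.
by rewrite /fmin rE //; lra.
Qed.

End FminTheory.
End FutureMinimum.

(** * LS paths and their stability under root operators *)

Section LSPaths.
Context {R : realType} {n : nat} (hn : (1 <= n)%N).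
Implicit Types (x tau : hhat R n) (i k : 'I_n.+1) (a b c r s t u v : R)
  (eta : R -> hhat R n).
Local Notation p i x := (hform x (alpha i)).

Definition rvel eta s tau := exists2 r, s < r <= 1 &
  forall u, s <= u <= r -> eta u = eta s + (u - s) *: tau.
Definition lvel eta s tau := exists2 r, 0 <= r < s &
  forall u, r <= u <= s -> eta u = eta s + (u - s) *: tau.

Definition PLpath eta := (forall s, 0 <= s < 1 -> exists tau, rvel eta s tau) /\
  (forall s, 0 < s <= 1 -> exists tau, lvel eta s tau).

(* The LS paths of shape Lambda_0, described by their velocities just before
   and just after each time. *)
Definition LS eta := [/\ eta 0 = 0, PLpath eta & forall s, 0 < s < 1 ->
  exists tau tau', [/\ lvel eta s tau, rvel eta s tau' & lsrel s tau tau']].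

Lemma rvel_slope eta s tau i :
  rvel eta s tau -> rslope (fun u => p i (eta u)) s (p i tau).
Proof.
by move=> [r hr rE]; exists r => // u hu; rewrite rE // hformDl hformZl.
Qed.

Lemma lvel_slope eta s tau i :
  lvel eta s tau -> lslope (fun u => p i (eta u)) s (p i tau).
Proof.
by move=> [r hr rE]; exists r => // u hu; rewrite rE // hformDl hformZl.
Qed.

Lemma PLpath_PL eta i : PLpath eta -> PL (fun u => p i (eta u)).
Proof.
move=> [er el]; split=> s hs.
  by have [tau h] := er s hs; exists (p i tau); exact: rvel_slope.
by have [tau h] := el s hs; exists (p i tau); exact: lvel_slope.
Qed.

Lemma lvel_uniq eta s tau sigma : lvel eta s tau -> lvel eta s sigma ->
  tau = sigma.
Proof.
move=> [r hr rE] [r' hr' rE']; pose u := Num.max r r'.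
have [q1 q2 q3] : [/\ r <= u, r' <= u & u < s].
  by rewrite /u !le_max gt_max !lexx orbT; split=> //; lra.
have : eta s + (u - s) *: tau = eta s + (u - s) *: sigma.
  by rewrite -(rE u) ?(rE' u) //; lra.
by move=> /addrI /scalerI; apply; rewrite lt_eqF // subr_lt0.
Qed.

Lemma rvel_uniq eta s tau sigma : rvel eta s tau -> rvel eta s sigma ->
  tau = sigma.
Proof.
move=> [r hr rE] [r' hr' rE']; pose u := Num.min r r'.
have [q1 q2 q3] : [/\ u <= r, u <= r' & s < u].
  by rewrite /u !ge_min lt_min !lexx orbT; split=> //; lra.
have : eta s + (u - s) *: tau = eta s + (u - s) *: sigma.
  by rewrite -(rE u) ?(rE' u) //; lra.
by move=> /addrI /scalerI; apply; rewrite gt_eqF // subr_gt0.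
Qed.

Lemma rvel_within eta s tau r :
  (forall u, s <= u <= r -> eta u = eta s + (u - s) *: tau) ->
  forall u, s < u <= r -> 0 <= s -> lvel eta u tau.
Proof.
move=> rE u hu s0; exists s => [|v hv]; first by lra.
by rewrite (rE u) ?(rE v) -?addrA -?scalerDl; [congr (_ + _ *: _); ring|lra..].
Qed.

Lemma lvel_within eta s tau r :
  (forall u, r <= u <= s -> eta u = eta s + (u - s) *: tau) ->
  forall u, r <= u < s -> s <= 1 -> rvel eta u tau.
Proof.
move=> rE u hu s0; exists s => [|v hv]; first by lra.
by rewrite (rE u) ?(rE v) -?addrA -?scalerDl; [congr (_ + _ *: _); ring|lra..].
Qed.

Lemma LS_left_orbit eta s tau : LS eta -> 0 < s <= 1 -> lvel eta s tau ->
  orbit_like tau.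
Proof.
move=> [_ _ h] hs [r hr rE]; pose u := (r + s) / 2.
have hu : r < u < s by rewrite /u; lra.
have [|sg [sg' [_ h2 h3]]] := h u; first by lra.
have h4 : rvel eta u tau by apply: (lvel_within rE); lra.
by rewrite (rvel_uniq h4 h2); have [] := lsrel_orbit hn h3.
Qed.

Lemma LS_right_orbit eta s tau : LS eta -> 0 <= s < 1 -> rvel eta s tau ->
  orbit_like tau.
Proof.
move=> [_ _ h] hs [r hr rE]; pose u := (r + s) / 2.
have hu : s < u < r by rewrite /u; lra.
have [|sg [sg' [h2 _ h3]]] := h u; first by lra.
have h4 : lvel eta u tau by apply: (rvel_within rE); lra.
by rewrite (lvel_uniq h4 h2); have [] := lsrel_orbit hn h3.
Qed.

(** The quantity is constant on linear pieces, vanishes at time 0, and jumps at a change of velocity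
    by an integer, by [lsrel_congr]. *)
Lemma LS_congr eta i : LS eta -> forall s, 0 <= s <= 1 ->
  0 < s -> forall tau, lvel eta s tau ->
  p i (eta s) - s * p i tau \is a Num.int.
Proof.
move=> hLS; have [e0 [er el] h] := hLS; apply: interval_ind.
- by rewrite ltxx.
- move=> s hs IH.
  have [tau [[r hr rE] hint]] : exists tau, rvel eta s tau /\
      p i (eta s) - s * p i tau \is a Num.int.
    have [s0|s0] := eqVneq s 0.
      have [tau ht] := er s hs; exists tau; split=> //.
      by rewrite s0 e0 hform0l mul0r subr0.
    have {}s0 : 0 < s by rewrite lt_neqAle eq_sym s0; lra.
    have [|tau [tau' [h1 h2 h3]]] := h s; first by lra.
    exists tau'; split=> //.
    have := rpredD (IH s0 _ h1) (lsrel_congr hn i h3).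
    by move=> h4; apply: int_eq h4 _; ring.
  exists r => // u hu u0 sg hsg.
  have [us|us] := eqVneq u s; first by rewrite us in u0 hsg *; exact: IH.
  have {}us : s < u by rewrite lt_neqAle eq_sym us; lra.
  have h1 : lvel eta u tau by apply: (rvel_within rE); lra.
  rewrite (lvel_uniq hsg h1) rE // hformDl hformZl.
  by apply: int_eq hint _; ring.
- move=> s hs IH s0 tau [r hr rE]; pose u := (r + s) / 2.
  have hu : r < u < s by rewrite /u; lra.
  have h1 : lvel eta u tau.
    exists r => [|v hv]; first by lra.
    rewrite (rE u) ?(rE v) -?addrA -?scalerDl; [|lra..].
    by congr (_ + _ *: _); ring.
  have : p i (eta u) - u * p i tau \is a Num.int by apply: IH => //; lra.
  rewrite rE ?hformDl ?hformZl; last by lra.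
  by move=> h2; apply: int_eq h2 _; ring.
Qed.

Lemma LS_end_int eta i : LS eta -> p i (eta 1) \is a Num.int.
Proof.
move=> h; have [_ [_ el] _] := h.
have [|tau ht] := el 1; first by lra.
have /= := LS_congr i h (s := 1) _ _ ht; rewrite mul1r => h1.
have [hint _ _] : orbit_like tau by apply: LS_left_orbit ht => //; lra.
have := rpredD (h1 _ _) (hint i).
by move=> h2; apply: int_eq (h2 _ _) _; [lra..|ring].
Qed.

(** At a local minimum the reflection i lowers the left velocity but fixes the right one, so the
    exchange property makes s * p i tau an integer; [LS_congr] transfers this to the coordinate. *)
Lemma LS_local_min_int eta i s tau tau' : LS eta -> 0 < s < 1 ->
  lvel eta s tau -> lsrel s tau tau' -> p i tau <= 0 -> 0 <= p i tau' ->
  p i (eta s) \is a Num.int.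
Proof.
move=> hLS hs hl hr h1 h2.
have : p i (eta s) - s * p i tau \is a Num.int by apply: LS_congr => //; lra.
have [[h3|h3] _] := lsrel_inv hn hr h1; last by move: h3; rewrite ltNge h2.
by move=> h4; apply: int_eq (rpredD h3 h4) _; ring.
Qed.

Definition fold_path i (M : R -> R) eta : R -> hhat R n :=
  fun u => eta u - M u *: alpha i.

Section Fold.
Variables (i : 'I_n.+1) (M : R -> R) (eta : R -> hhat R n).
Local Notation f := (fun u => p i (eta u)).

Lemma fold_lvel_const s tau : lvel eta s tau ->
  (exists2 r, 0 <= r < s & forall u, r <= u <= s -> M u = M s) ->
  lvel (fold_path i M eta) s tau.
Proof.
move=> [r hr rE] [r' hr' rE']; exists (Num.max r r') => [|u].
  by rewrite le_max gt_max; apply/andP; split; [apply/orP; left|]; lra.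
rewrite ge_max => hu; rewrite /fold_path (rE u) ?(rE' u); [|lra..].
by rewrite addrAC.
Qed.

Lemma fold_rvel_const s tau : rvel eta s tau ->
  (exists2 r, s < r <= 1 & forall u, s <= u <= r -> M u = M s) ->
  rvel (fold_path i M eta) s tau.
Proof.
move=> [r hr rE] [r' hr' rE']; exists (Num.min r r') => [|u].
  by rewrite ge_min lt_min; apply/andP; split; [|apply/orP; left]; lra.
rewrite le_min => hu; rewrite /fold_path (rE u) ?(rE' u); [|lra..].
by rewrite addrAC.
Qed.

Lemma fold_lvel_refl s tau : lvel eta s tau ->
  (exists2 r, 0 <= r < s & forall u, r <= u <= s -> M u = p i (eta u)) ->
  lvel (fold_path i M eta) s (srefl i tau).
Proof.
move=> [r hr rE] [r' hr' rE']; exists (Num.max r r') => [|u].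
  by rewrite le_max gt_max; apply/andP; split; [apply/orP; left|]; lra.
rewrite ge_max => hu; rewrite /fold_path (rE' u) ?(rE' s) ?(rE u); [|lra..].
rewrite hformDl hformZl /srefl.
by apply/rowP => q; rewrite !mxE; ring.
Qed.

Lemma fold_rvel_refl s tau : rvel eta s tau ->
  (exists2 r, s < r <= 1 & forall u, s <= u <= r -> M u = p i (eta u)) ->
  rvel (fold_path i M eta) s (srefl i tau).
Proof.
move=> [r hr rE] [r' hr' rE']; exists (Num.min r r') => [|u].
  by rewrite ge_min lt_min; apply/andP; split; [|apply/orP; left]; lra.
rewrite le_min => hu; rewrite /fold_path (rE' u) ?(rE' s) ?(rE u); [|lra..].
rewrite hformDl hformZl /srefl.
by apply/rowP => q; rewrite !mxE; ring.
Qed.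
End Fold.

Lemma pitmanE i eta : pitman i eta = fold_path i (imin (fun u => p i (eta u))) eta.
Proof. by []. Qed.

Lemma PLpath_pitman i eta : PLpath eta -> PLpath (pitman i eta).
Proof.
move=> h; have pf := PLpath_PL i h; have [er el] := h.
rewrite pitmanE; set M := imin _; split=> s hs.
  have [tau ht] := er s hs; have ft := rvel_slope i ht.
  have [/andP[c0 /eqP ms]|nd] := boolP ((p i tau < 0) && (M s == p i (eta s))).
    have hM := imin_right_dec pf hs ft c0 ms.
    by exists (srefl i tau); exact: fold_rvel_refl.
  exists tau; apply: fold_rvel_const => //; apply: imin_right_const ft _ => //.
  move: nd; rewrite negb_and -leNgt => /orP[|nd]; first by left.
  by right; rewrite lt_neqAle nd imin_le //; lra.
have [tau ht] := el s hs; have ft := lvel_slope i ht.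
have [hM|[_ _ _ hM]] := imin_left pf hs ft.
  by exists tau; exact: fold_lvel_const.
by exists (srefl i tau); exact: fold_lvel_refl.
Qed.

Lemma pitman0 i eta : eta 0 = 0 -> pitman i eta 0 = 0.
Proof.
move=> e; rewrite pitmanE /fold_path imin0 e hform0l scale0r subr0 //.
Qed.

(** On each side of s the velocity is either kept or reflected. [lsrel_inv] covers the cases where
    the left one is reflected; the remaining hard case reflects the right one alone, when the path
    resumes its descent from a level reached before. *)
Lemma LS_pitman i eta : LS eta -> LS (pitman i eta).
Proof.
move=> hLS; have [e0 hPL h] := hLS; have pf := PLpath_PL i hPL.
split; [exact: pitman0|exact: PLpath_pitman|] => s hs.
rewrite pitmanE; set M := imin _.
have [tau [tau' [hl hr hst]]] := h s hs.
have fl := lvel_slope i hl; have fr := rvel_slope i hr.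
have hs1 : 0 < s <= 1 by lra.
have hs2 : 0 <= s < 1 by lra.
have rdec : p i tau' < 0 -> M s = p i (eta s) ->
    exists2 r, s < r <= 1 & forall u, s <= u <= r -> M u = p i (eta u).
  by move=> c0 ms; exact: (imin_right_dec pf hs2 fr c0 ms).
have rconst : 0 <= p i tau' \/ M s < p i (eta s) ->
    exists2 r, s < r <= 1 & forall u, s <= u <= r -> M u = M s.
  by move=> hc; exact: (imin_right_const pf hs2 fr hc).
have [lc|[c0 ms lt_s ldec]] := imin_left pf hs1 fl; last first.
  have [_ hst'] := lsrel_inv hn hst (ltW c0).
  have [c1|c1] := ltP (p i tau') 0.
    exists (srefl i tau), (srefl i tau'); split.
    - exact: fold_lvel_refl.
    - by apply: fold_rvel_refl => //; exact: rdec.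
    - by rewrite smax_srefl in hst'.
  exists (srefl i tau), tau'; split.
  - exact: fold_lvel_refl.
  - by apply: fold_rvel_const => //; apply: rconst; left.
  - by rewrite smax_id in hst'.
have [/andP[c0 /eqP ms]|nd] := boolP ((p i tau' < 0) && (M s == p i (eta s))).
  exists tau, (srefl i tau'); split.
  - exact: fold_lvel_const.
  - by apply: fold_rvel_refl => //; exact: rdec.
  case: (lc) => r hr'; rewrite -/M => rE.
  have c1 : p i tau <= 0.
    apply: (lslope_le0 fl (r0 := r)) => [|u hu]; first by lra.
    by rewrite -ms -(rE u) //; apply: imin_le => //; lra.
  (* The running minimum is constant just before s, so its value was attained at some v < s. Unless
     v = 0, where the path vanishes, v is a local minimum of the coordinate. *)
  have fsint : p i (eta s) \is a Num.int.
    have [|[v hv fv] low] := @imin_attained _ _ r pf; first by lra.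
    rewrite -ms -(rE r) ?lexx //; last by lra.
    rewrite /M -fv; have [v0|v0] := eqVneq v 0.
      by rewrite v0 e0 hform0l.
    have {}v0 : 0 < v by rewrite lt_neqAle eq_sym v0; lra.
    have [|sg [sg' [hl1 hr1 hst1]]] := h v; first by lra.
    have low1 u : 0 <= u <= s -> p i (eta v) <= p i (eta u).
      move=> hu; rewrite fv -[imin _ r]/(M r) rE; last by lra.
      by apply: imin_le => //; lra.
    apply: (LS_local_min_int hLS _ hl1 hst1); first by lra.
      apply: (lslope_le0 (lvel_slope i hl1) v0) => u hu; apply: low1; lra.
    by apply: (rslope_ge0 (rvel_slope i hr1) (r0 := s)) => [|u hu];
      [lra|apply: low1; lra].
  have sint : s * p i tau \is a Num.int.
    have := LS_congr i hLS _ _ hl => /(_ _ _) h3.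
    have h4 : p i (eta s) - s * p i tau \is a Num.int by apply: h3; lra.
    by apply: int_eq (rpredB fsint h4) _; ring.
  have [_ hst'] := lsrel_inv hn hst c1.
  apply: (lsrel_unstep hn c1); first by left.
  rewrite smax_srefl // in hst'.
  by rewrite smax_id // hform_sreflii; lra.
exists tau, tau'; split=> //.
- exact: fold_lvel_const.
- apply: fold_rvel_const => //; apply: rconst.
  move: nd; rewrite negb_and -leNgt => /orP[|nd]; first by left.
  by right; rewrite lt_neqAle nd imin_le //; lra.
Qed.
End LSPaths.

(** * Inverting a Pitman transform with future minima *)

Section LiftPaths.
Context {R : realType} {n : nat} (hn : (1 <= n)%N).
Implicit Types (x tau : hhat R n) (i k : 'I_n.+1) (a b c r s t u v : R)
  (eta zeta : R -> hhat R n).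
Local Notation p i x := (hform x (alpha i)).

(* The path with string coordinate [a] in the string of the [i]-dominant path
   [zeta]. *)
Definition lift_path a i zeta : R -> hhat R n :=
  fold_path i (fmin a (fun u => p i (zeta u))) zeta.

Lemma imin_right_or (f : R -> R) : PL f -> forall s, 0 <= s < 1 ->
  (exists2 r, s < r <= 1 & forall u, s <= u <= r -> imin f u = imin f s) \/
  imin f s = f s.
Proof.
move=> pf s hs; have [e|ne] := eqVneq (imin f s) (f s); first by right.
left; have [fr _] := pf; have [b fb] := fr s hs.
by apply: imin_right_const fb _ => //; right; rewrite lt_neqAle ne imin_le //; lra.
Qed.

Lemma imin_left_or (f : R -> R) : PL f -> forall s, 0 < s <= 1 ->
  (exists2 r, 0 <= r < s & forall u, r <= u <= s -> imin f u = imin f s) \/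
  (exists2 r, 0 <= r < s & forall u, r <= u <= s -> imin f u = f u).
Proof.
move=> pf s hs; have [_ fl] := pf; have [b fb] := fl s hs.
by case: (imin_left pf hs fb) => [|[]]; [left|right].
Qed.

Lemma fmin_eq a (f : R -> R) t m :
  (forall u, t <= u <= 1 -> m <= Num.min a (f u)) ->
  (exists2 u, t <= u <= 1 & Num.min a (f u) = m) -> fmin a f t = m.
Proof.
move=> low [u hu e]; apply: imin_eq => [v hv|]; first by apply: low; lra.
by exists (1 - u); [lra|rewrite subKr].
Qed.

Lemma imin_fold1 i (M : R -> R) eta t :
  p i (fold_path i M eta t) = p i (eta t) - M t * 2.
Proof. by rewrite /fold_path hformBl hformZl hform_alphaii. Qed.

Section PitmanLift.
Variables (i : 'I_n.+1) (eta : R -> hhat R n).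
Hypotheses (hPL : PLpath eta) (e0 : eta 0 = 0).
Let f u := p i (eta u).
Let pf : PL f. Proof. exact: PLpath_PL. Qed.
Let f0 : f 0 = 0. Proof. by rewrite /f e0 hform0l. Qed.

Lemma imin_le0 t : 0 <= t <= 1 -> imin f t <= 0.
Proof. by move=> ht; rewrite -f0; apply: imin_le => //; lra. Qed.

Lemma pitman_ge0 t : 0 <= t <= 1 -> 0 <= p i (pitman i eta t).
Proof.
move=> ht; rewrite pitmanE imin_fold1 -/(f t).
have : imin f t <= f t by apply: imin_le => //; lra.
by have := imin_le0 ht; rewrite -/f; lra.
Qed.

(** Pitman's inversion: with M the running minimum of f, the future minimum of f - 2M capped at
    -M(1) is -M(t). It is attained where f next returns to the level M(t), or at time 1 through the
    cap if M does not move any more. *)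
Lemma lift_pitmanK t : 0 <= t <= 1 ->
  lift_path (- imin f 1) i (pitman i eta) t = eta t.
Proof.
move=> ht; rewrite /lift_path {1}/fold_path.
rewrite (_ : fmin _ _ _ = - imin f t); first by rewrite pitmanE scaleNr opprK subrK.
have M1 u : 0 <= u <= 1 -> imin f 1 <= imin f u by move=> hu; apply: imin_anti => //; lra.
apply: fmin_eq => [u hu|].
  rewrite pitmanE imin_fold1 -/(f u) le_min lerN2 M1 /=; last by lra.
  have : imin f u <= f u by apply: imin_le => //; lra.
  have : imin f u <= imin f t by apply: imin_anti => //; lra.
  by rewrite -/f; lra.
have [[v [hv fv Mv]]|M1t] := touch_or_const (imin_right_or pf) (imin_left_or pf) ht.
  exists v => //; rewrite pitmanE imin_fold1 -/(f v) -/f fv Mv min_r; first by ring.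
  by have := M1 t ht; lra.
exists 1; first by lra.
rewrite pitmanE imin_fold1 -/(f 1) -/f M1t min_l //.
have : imin f 1 <= f 1 by apply: imin_le => //; lra.
by lra.
Qed.
End PitmanLift.

Section LiftPitman.
Variables (a : R) (i : 'I_n.+1) (zeta : R -> hhat R n).
Let f u := p i (zeta u).
Hypotheses (hPL : PLpath zeta) (z0 : zeta 0 = 0) (a0 : 0 <= a).
Hypothesis (f_ge0 : forall u, 0 <= u <= 1 -> 0 <= f u).
Let pf : PL f. Proof. exact: PLpath_PL. Qed.
Let f0 : f 0 = 0. Proof. by rewrite /f z0 hform0l. Qed.

Lemma fmin_0 : fmin a f 0 = 0.
Proof.
apply: fmin_eq => [u hu|]; first by rewrite le_min a0 f_ge0.
by exists 0; [lra|rewrite f0 min_r].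
Qed.

Lemma lift_path0 : lift_path a i zeta 0 = 0.
Proof. by rewrite /lift_path /fold_path fmin_0 scale0r subr0. Qed.

Lemma PLpath_lift : PLpath (lift_path a i zeta).
Proof.
have [zr zl] := hPL; split=> s hs.
  have [tau ht] := zr s hs.
  have [hc|[_ _ hc]] := fmin_right a pf hs (rvel_slope i ht).
    by exists tau; exact: fold_rvel_const.
  by exists (srefl i tau); exact: fold_rvel_refl.
have [tau ht] := zl s hs.
have [hc|[_ _ hc]] := fmin_left a pf hs (lvel_slope i ht).
  by exists tau; exact: fold_lvel_const.
by exists (srefl i tau); exact: fold_lvel_refl.
Qed.

(** The dual of [lift_pitmanK]: [touch_or_const] is applied to the reversed future minimum, which is
    0 at time 0 because the path is dominant. *)
Lemma imin_lift t : 0 <= t <= 1 ->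
  imin (fun u => p i (lift_path a i zeta u)) t = - fmin a f t.
Proof.
move=> ht; apply: imin_eq => [v hv|].
  rewrite imin_fold1 -/f -/(f v).
  have : fmin a f v <= f v by apply: fmin_le_f => //; lra.
  have : fmin a f v <= fmin a f t.
    by apply: imin_anti; [exact: (PL_rev (PL_min a pf))|lra..].
  by lra.
have [|||[v [hv fv mv]]|m0] :=
  @touch_or_const _ (fun u => fmin a f (1 - u)) (fun u => f (1 - u)) _ _ (1 - t).
- move=> s hs; have [_ fl] := pf; have [|b fb] := fl (1 - s); first by lra.
  have [|[r hr rE]|[_ hc _]] := fmin_left a pf _ fb; [lra|left|by right].
  exists (1 - r); first by lra.
  by move=> u hu; apply: rE; lra.
- move=> s hs; have [fr _] := pf; have [|b fb] := fr (1 - s); first by lra.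
  have [|[r hr rE]|[_ _ [r hr rE]]] := fmin_right a pf _ fb; [lra|left|right];
    by exists (1 - r); [lra|move=> u hu; apply: rE; lra].
- by lra.
- exists (1 - v); first by lra.
  by rewrite imin_fold1 -/f -/(f (1 - v)) mv fv subKr; ring.
- exists 0; first by lra.
  move: m0; rewrite subrr subKr fmin_0 => <-.
  by rewrite lift_path0 hform0l oppr0.
Qed.

Lemma pitman_liftK t : 0 <= t <= 1 -> pitman i (lift_path a i zeta) t = zeta t.
Proof.
move=> ht; rewrite pitmanE /fold_path imin_lift // scaleNr opprK.
by rewrite /lift_path /fold_path subrK.
Qed.

Lemma lift_path1 : a <= f 1 -> lift_path a i zeta 1 = zeta 1 - a *: alpha i.
Proof. by move=> h; rewrite /lift_path /fold_path fmin1 min_l. Qed.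

Lemma imin_lift1 : a <= f 1 -> imin (fun u => p i (lift_path a i zeta u)) 1 = - a.
Proof. by move=> h; rewrite imin_lift ?fmin1 ?min_l //; lra. Qed.

(** The mirror image of [LS_pitman]: now the hard case is a reflected left velocity followed by an
    unchanged right one. *)
Lemma LS_lift : LS zeta -> a \is a Num.int -> LS (lift_path a i zeta).
Proof.
move=> hLS aint; have [_ _ h] := hLS.
split; [exact: lift_path0|exact: PLpath_lift|] => s hs.
rewrite /lift_path; set M := fmin a _.
have [tau [tau' [hl hr hst]]] := h s hs.
have hs1 : 0 < s <= 1 by lra.
have hs2 : 0 <= s < 1 by lra.
have fl := lvel_slope i hl; have fr := rvel_slope i hr.
have [lc|[c0 ms linc]] := fmin_left a pf hs1 fl;
  have [rc|[c1 ms' rinc]] := fmin_right a pf hs2 fr.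
- exists tau, tau'; split=> //; first exact: fold_lvel_const.
  exact: fold_rvel_const.
- exists tau, (srefl i tau'); split.
  + exact: fold_lvel_const.
  + exact: fold_rvel_refl.
  case: (lc) => r hr' rE.
  have c2 : p i tau <= 0.
    apply: (lslope_le0 fl (r0 := r)) => [|u hu]; first by lra.
    by rewrite -[p i (zeta s)]ms' -(rE u) //; apply: fmin_le_f => //; lra.
  have [_ hst'] := lsrel_inv hn hst c2.
  apply: (lsrel_unstep hn c2); first by right; rewrite hform_sreflii; lra.
  rewrite smax_srefl ?sreflK; last by rewrite hform_sreflii; lra.
  by rewrite smax_id ?ltW in hst'.
- exists (srefl i tau), tau'; split.
  + exact: fold_lvel_refl.
  + exact: fold_rvel_const.
  case: (rc) => r hr' rE.
  have c1 : 0 <= p i tau'.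
    apply: (rslope_ge0 fr (r0 := r)) => [|u hu]; first by lra.
    by rewrite -[p i (zeta s)]ms -(rE u) //; apply: fmin_le_f => //; lra.
  (* The future minimum is constant just after s, so its value is attained at some later v: it is
     the cap [a], the value at the end point, or a local minimum. *)
  have fsint : f s \is a Num.int.
    have [|v hv gv] := @fmin_attained _ a f pf r; first by lra.
    rewrite (rE r) ?ms in gv; last by lra.
    have [af|fa] := leP a (f v); first by rewrite (min_l af) in gv; rewrite -gv.
    rewrite (min_r (ltW fa)) in gv; rewrite -gv.
    have [->|v1] := eqVneq v 1; first exact: (LS_end_int hn i hLS).
    have {}v1 : v < 1 by rewrite lt_neqAle v1; lra.
    have [|sg [sg' [hl1 hr1 hst1]]] := h v; first by lra.
    have low u : s <= u <= 1 -> f v <= f u.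
      by move=> hu; rewrite gv -ms; apply: fmin_le_f => //; lra.
    apply: (LS_local_min_int hn hLS _ hl1 hst1); first by lra.
      apply: (lslope_le0 (lvel_slope i hl1) (r0 := s)) => [|u hu]; first by lra.
      by apply: low; lra.
    apply: (rslope_ge0 (rvel_slope i hr1) v1) => u hu; apply: low; lra.
  have h3 : p i (zeta s) - s * p i tau \is a Num.int.
    by apply: (LS_congr hn) => //; lra.
  apply: (lsrel_unstep hn (i := i)); first by rewrite hform_sreflii; lra.
    left; rewrite hform_sreflii.
    by apply: int_eq (rpredB h3 fsint) _; rewrite /f; ring.
  by rewrite sreflK smax_id.
- exists (srefl i tau), (srefl i tau'); split.
  + exact: fold_lvel_refl.
  + exact: fold_rvel_refl.
  apply: (lsrel_unstep hn (i := i)); first by rewrite hform_sreflii; lra.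
    by right; rewrite hform_sreflii; lra.
  have c2 : p i (srefl i tau') < 0 by rewrite hform_sreflii; lra.
  by rewrite smax_srefl // !sreflK.
Qed.
End LiftPitman.
End LiftPaths.

(** * The module generated by the straight path *)

Section LittelmannModuleLS.
Context {R : realType} {n : nat} (hn : (1 <= n)%N).
Implicit Types (x tau : hhat R n) (i k : 'I_n.+1) (a b c r s t u v : R)
  (eta zeta : R -> hhat R n) (j : nat -> 'I_n.+1).
Local Notation p i x := (hform x (alpha i)).

Lemma PLpath_ext eta zeta : (forall t, 0 <= t <= 1 -> zeta t = eta t) ->
  PLpath eta -> PLpath zeta.
Proof.
move=> e [er el]; split=> s hs.
  have [tau [r hr rE]] := er s hs; exists tau, r => // u hu.
  by rewrite (e u) ?(e s) ?(rE u) //; lra.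
have [tau [r hr rE]] := el s hs; exists tau, r => // u hu.
by rewrite (e u) ?(e s) ?(rE u) //; lra.
Qed.

Lemma LS_ext eta zeta : (forall t, 0 <= t <= 1 -> zeta t = eta t) ->
  LS eta -> LS zeta.
Proof.
move=> e [e0 hPL h]; split=> [||s hs]; first by rewrite e //; lra.
  exact: PLpath_ext hPL.
have [tau [tau' [[r hr rE] [r' hr' rE'] h3]]] := h s hs.
exists tau, tau'; split=> //.
  by exists r => // u hu; rewrite (e u) ?(e s) ?(rE u) //; lra.
by exists r' => // u hu; rewrite (e u) ?(e s) ?(rE' u) //; lra.
Qed.

Lemma imin_ext (f g : R -> R) t : (forall u, 0 <= u <= t -> f u = g u) ->
  imin f t = imin g t.
Proof.
move=> e; congr inf; apply/seteqP.
by split=> _ [v hv <-]; exists v => //; rewrite e //; move: hv; rewrite /= in_itv.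
Qed.

Lemma pitman_ext i eta zeta : (forall t, 0 <= t <= 1 -> zeta t = eta t) ->
  forall t, 0 <= t <= 1 -> pitman i zeta t = pitman i eta t.
Proof.
move=> e t ht; rewrite !pitmanE /fold_path e //; congr (_ - _ *: _).
by apply: imin_ext => u hu; rewrite e //; lra.
Qed.

Lemma PLpath_line tau : PLpath (fun t : R => t *: tau).
Proof.
split=> s hs; exists tau.
  by exists 1 => [|u hu]; [lra|rewrite -scalerDl; congr (_ *: _); ring].
by exists 0 => [|u hu]; [lra|rewrite -scalerDl; congr (_ *: _); ring].
Qed.

Lemma LS_Lambda0 : LS (fun t : R => t *: (Lambda0 : hhat R n)).
Proof.
split=> [||s hs]; [by rewrite scale0r|exact: PLpath_line|].
exists Lambda0, Lambda0; split; last exact: lsrel_base.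
  by exists 0 => [|u hu]; [lra|rewrite -scalerDl; congr (_ *: _); ring].
by exists 1 => [|u hu]; [lra|rewrite -scalerDl; congr (_ *: _); ring].
Qed.

Lemma breakpoint_right N (t : nat -> R) s : t 0%N <= s < t N ->
  exists2 k, (k < N)%N & t k <= s < t k.+1.
Proof.
elim: N => [|N IH] h; first by exfalso; lra.
have [sN|Ns] := ltP s (t N).
  by have [|k kN hk] := IH; [lra|exists k => //; exact: ltnW].
by exists N => //; lra.
Qed.

Lemma breakpoint_left N (t : nat -> R) s : t 0%N < s <= t N ->
  exists2 k, (k < N)%N & t k < s <= t k.+1.
Proof.
elim: N => [|N IH] h; first by exfalso; lra.
have [sN|Ns] := leP s (t N).
  by have [|k kN hk] := IH; [lra|exists k => //; exact: ltnW].
by exists N => //; lra.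
Qed.

Lemma piecewise_linear01_PLpath eta : piecewise_linear01 eta -> PLpath eta.
Proof.
have E (x y : hhat R n) u s : x + u *: y = x + s *: y + (u - s) *: y.
  by rewrite -addrA -scalerDl; congr (_ + _ *: _); ring.
move=> [N [t [t0 tN _ h]]]; split=> s hs.
  have [|k kN hk] := @breakpoint_right N t s; first by rewrite t0 tN.
  have [x [y xy]] := h k kN; exists y, (Num.min (t k.+1) 1).
    by rewrite lt_min ge_min lexx orbT andbT; lra.
  move=> u; rewrite le_min => hu; rewrite !xy; [exact: E|lra..].
have [|k kN hk] := @breakpoint_left N t s; first by rewrite t0 tN.
have [x [y xy]] := h k kN; exists y, (Num.max (t k) 0).
  by rewrite gt_max le_max lexx orbT; lra.
move=> u; rewrite ge_max => hu; rewrite !xy; [exact: E|lra..].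
Qed.

(** Real induction on the existence of a finite subdivision of [0, s]; each extension appends one
    linear piece. *)
Lemma PLpath_piecewise_linear01 eta : PLpath eta -> piecewise_linear01 eta.
Proof.
move=> [er el].
pose Q b := exists (N : nat) (t : nat -> R), [/\ t 0%N = 0, t N = b,
  forall k : nat, (k < N)%N -> t k < t k.+1 &
  forall k : nat, (k < N)%N -> exists x y : hhat R n,
    forall s, t k <= s <= t k.+1 -> eta s = x + s *: y].
have ext s r tau : Q s -> s < r ->
    (forall u, s <= u <= r -> eta u = eta s + (u - s) *: tau) -> Q r.
  move=> [N [t [t0 tN tinc tlin]]] sr rE.
  exists N.+1, (fun k : nat => if (k <= N)%N then t k else r); split=> //.
  - by rewrite ltnn.
  - move=> k kN1; have [->|kN] : k = N \/ (k < N)%N by lia.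
      by rewrite leqnn ltnn tN.
    by rewrite (ltnW kN) kN; exact: tinc.
  - move=> k kN1; have [->|kN] : k = N \/ (k < N)%N by lia.
      rewrite leqnn ltnn tN; exists (eta s - s *: tau), tau => u hu.
      by rewrite rE // scalerBl; rewrite -addrA [- _ + _]addrC.
    by rewrite (ltnW kN) kN; exact: tlin.
suff : forall s, 0 <= s <= 1 -> Q s by move=> /(_ 1); apply; lra.
apply: interval_ind.
- by exists 0%N, (fun=> 0); split.
- move=> s hs Qs; have [tau [r hr rE]] := er s hs; exists r => // u hu.
  have [->//|us] := eqVneq u s; apply: (ext s _ tau) => //.
    by rewrite lt_neqAle eq_sym us; lra.
  by move=> v hv; apply: rE; lra.
- move=> s hs IH; have [tau [r hr rE]] := el s hs.
  apply: (ext r _ tau); [by apply: IH; lra|by lra|] => u hu.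
  rewrite (rE u) // (rE r); last by lra.
  by rewrite -addrA -scalerDl; congr (_ + _ *: _); ring.
Qed.

Lemma PLpath_continuous eta : PLpath eta -> {within `[0, 1], continuous eta}.
Proof.
move=> [er el]; apply/subspace_continuousP => s; rewrite /= in_itv /= => hs.
have small (tau : hhat R n) e : 0 < e -> exists2 d, 0 < d &
    forall u, `|u - s| < d -> `|(u - s) *: tau| < e.
  move=> e0; have t0 : 0 < `|tau| + 1 by rewrite ltr_wpDl.
  exists (e / (`|tau| + 1)) => [|u]; first exact: divr_gt0.
  rewrite ltr_pdivlMr // normrZ => h.
  by apply: le_lt_trans h; rewrite ler_wpM2l // lerDl.
apply/cvgrPdist_lt => e e0.
have hr : exists2 d, 0 < d & forall u, s <= u <= 1 -> `|u - s| < d ->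
    `|eta s - eta u| < e.
  have [s1|s1] := ltP s 1; last first.
    exists 1 => // u hu _; have -> : u = s by lra.
    by rewrite subrr normr0.
  have [|tau [r hr rE]] := er s; first by lra.
  have [d d0 hd] := small tau e e0.
  exists (Num.min d (r - s)); first by rewrite lt_min d0 subr_gt0; lra.
  move=> u hu; rewrite lt_min => /andP[h1 h2].
  rewrite (rE u); last by move: h2; rewrite ger0_norm; lra.
  by rewrite opprD addNKr normrN; exact: hd.
have hl : exists2 d, 0 < d & forall u, 0 <= u <= s -> `|u - s| < d ->
    `|eta s - eta u| < e.
  have [s1|s1] := ltP 0 s; last first.
    exists 1 => // u hu _; have -> : u = s by lra.
    by rewrite subrr normr0.
  have [|tau [r hr' rE]] := el s; first by lra.
  have [d d0 hd] := small tau e e0.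
  exists (Num.min d (s - r)); first by rewrite lt_min d0 subr_gt0; lra.
  move=> u hu; rewrite lt_min => /andP[h1 h2].
  rewrite (rE u); last by move: h2; rewrite ler0_norm; lra.
  by rewrite opprD addNKr normrN; exact: hd.
have [d d0 hd] := hr; have [d' d0' hd'] := hl.
rewrite near_withinE; near=> u => /=; rewrite in_itv /= => hu.
have h1 : `|u - s| < d.
  by rewrite distrC; near: u; have := nbhsx_ballx s _ d0; rewrite -ball_normE.
have h2 : `|u - s| < d'.
  by rewrite distrC; near: u; have := nbhsx_ballx s _ d0'; rewrite -ball_normE.
have [us|us] := leP u s; first by apply: hd' => //; lra.
by apply: hd => //; lra.
Unshelve. all: by end_near. Qed.

Lemma heightD a x y : height (x + a *: y) = height x + a * height y.
Proof.
rewrite /height mulrN -opprD mulr_sumr -big_split /=; congr (- _).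
by apply: eq_bigr => k _; rewrite !mxE.
Qed.

Lemma LS_height_ge0 eta : LS eta -> forall t, 0 <= t <= 1 -> 0 <= height (eta t).
Proof.
move=> hLS; have [e0 [er el] _] := hLS; apply: interval_ind.
- by rewrite e0 /height big1 ?oppr0 // => k _; rewrite mxE.
- move=> s hs Qs; have [tau ht] := er s hs.
  have [_ _ ht0] := LS_right_orbit hn hLS hs ht.
  have [r hr rE] := ht; exists r => // u hu; rewrite rE // heightD.
  by rewrite addr_ge0 // mulr_ge0 //; lra.
- move=> s hs IH; have [tau ht] := el s hs.
  have [_ _ ht0] := LS_left_orbit hn hLS hs ht.
  have [r hr rE] := ht; have : 0 <= height (eta r) by apply: IH; lra.
  rewrite rE ?heightD; last by lra.
  have : 0 <= (s - r) * height tau by rewrite mulr_ge0 //; lra.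
  by lra.
Qed.

(** The initial velocity is dominant, hence equal to Lambda_0, and no chain leads from Lambda_0 to
    another velocity. Carrying the left velocity in the induction propagates this to all times. *)
Lemma LS_dominant eta : LS eta ->
  (forall i t, 0 <= t <= 1 -> 0 <= p i (eta t)) ->
  forall t, 0 <= t <= 1 -> eta t = t *: Lambda0.
Proof.
move=> hLS hdom; have [e0 [er el] h] := hLS.
suff : forall t, 0 <= t <= 1 -> eta t = t *: Lambda0 /\
    (0 < t -> lvel eta t Lambda0) by move=> H t /H[].
have lin s u : s *: Lambda0 + (u - s) *: Lambda0 = u *: Lambda0 :> hhat R n.
  by rewrite -scalerDl; congr (_ *: _); ring.
apply: interval_ind.
- by rewrite e0 scale0r ltxx.
- move=> s hs [Q1 Q2].
  have [r hr rE] : rvel eta s Lambda0.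
    have [s0|s0] := eqVneq s 0.
      have [tau ht] := er s hs; suff <- : tau = Lambda0 by [].
      have [r hr rE] := ht; pose u := (s + r) / 2.
      have hu : s < u < r by rewrite /u; lra.
      have [|sg [sg' [h1 _ h3]]] := h u; first by lra.
      have h4 : lvel eta u tau by apply: (rvel_within rE); lra.
      apply: lsrel_dominant (_ : lsrel u tau sg') _.
        by rewrite (lvel_uniq h4 h1).
      move=> i; apply: (rslope_ge0 (rvel_slope i ht) (r0 := 1)); first by lra.
      by move=> v hv; rewrite s0 e0 hform0l; apply: hdom; lra.
    have {}s0 : 0 < s by rewrite lt_neqAle eq_sym s0; lra.
    have [|sg [sg' [h1 h2 h3]]] := h s; first by lra.
    have E := lvel_uniq h1 (Q2 s0); rewrite E in h3.
    by rewrite -(lsrel_Lambda0 hn h3).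
  exists r => // u hu; split; first by rewrite rE // Q1 lin.
  have [->//|us] := eqVneq u s => _.
  have {}us : s < u by rewrite lt_neqAle eq_sym us; lra.
  by apply: (rvel_within rE); lra.
- move=> s hs IH; have [tau ht] := el s hs.
  have [r hr rE] := ht; pose u := (s + r) / 2.
  have hu : r < u < s by rewrite /u; lra.
  have [|Q1 Q2] := IH u; first by lra.
  have h1 : lvel eta u tau.
    exists r => [|v hv]; first by lra.
    rewrite (rE u) ?(rE v) -?addrA -?scalerDl; [|lra..].
    by congr (_ + _ *: _); ring.
  have E : tau = Lambda0 by apply: lvel_uniq h1 (Q2 _); lra.
  rewrite E in rE ht; split=> //.
  have := rE u; rewrite Q1 => /(_ _) e.
  by apply: (addIr ((u - s) *: Lambda0)); rewrite -e ?lin //; lra.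
Qed.
End LittelmannModuleLS.

(** * String operators on the module *)

Section StringOperators.
Context {R : realType} {n : nat} (hn : (1 <= n)%N).
Variables (j : nat -> 'I_n.+1) (hj : infinitely_often j).
Implicit Types (x tau : hhat R n) (i : 'I_n.+1) (a b c r s t u v : R)
  (eta zeta : R -> hhat R n).
Local Notation p i x := (hform x (alpha i)).

Definition depth i eta : R := - imin (fun u => p i (eta u)) 1.

Lemma string_coordE eta l : string_coord j eta l = depth (j l) (pitman_iter j l eta).
Proof. by []. Qed.

Lemma depth_int i eta : LS eta -> depth i eta \is a Num.int.
Proof.
move=> hLS; have [e0 hPL h] := hLS; rewrite rpredN.
have pf := PLpath_PL i hPL.
have [|[v hv fv] low] := @imin_attained _ _ 1 pf; first by lra.
rewrite -fv; have [->|v0] := eqVneq v 0; first by rewrite /= e0 hform0l rpred0.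
have [->|v1] := eqVneq v 1; first exact: (LS_end_int hn i hLS).
have {}v0 : 0 < v by rewrite lt_neqAle eq_sym v0; lra.
have {}v1 : v < 1 by rewrite lt_neqAle v1; lra.
have [|sg [sg' [hl hr hst]]] := h v; first by lra.
apply: (LS_local_min_int hn hLS _ hl hst); first by lra.
  by apply: (lslope_le0 (lvel_slope i hl) v0) => u hu; rewrite fv low //; lra.
by apply: (rslope_ge0 (rvel_slope i hr) v1) => u hu; rewrite fv low //; lra.
Qed.

Lemma depth_ge0 i eta : PLpath eta -> eta 0 = 0 -> 0 <= depth i eta.
Proof.
by move=> hPL e0; rewrite oppr_ge0; apply: imin_le0 => //; lra.
Qed.

Lemma depth_le i eta : PLpath eta -> depth i eta <= p i (pitman i eta 1).
Proof.
move=> hPL; rewrite pitmanE imin_fold1.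
have h1 : 0 <= (1 : R) <= 1 by rewrite ler01 lexx.
by have := imin_le (PLpath_PL i hPL) h1 h1; rewrite /depth; lra.
Qed.

Lemma pitman_end i eta : pitman i eta 1 = eta 1 + depth i eta *: alpha i.
Proof. by rewrite pitmanE /fold_path /depth (scaleNr (imin _ _)). Qed.

Lemma PLpath_iter eta : PLpath eta -> eta 0 = 0 ->
  forall l, PLpath (pitman_iter j l eta) /\ pitman_iter j l eta 0 = 0.
Proof.
move=> hPL e0; elim=> [//|l [h1 h2]] /=.
by split; [exact: PLpath_pitman|exact: pitman0].
Qed.

Lemma LS_iter eta : LS eta -> forall l, LS (pitman_iter j l eta).
Proof. by move=> h; elim=> [//|l] /=; exact: LS_pitman. Qed.

(** Each transform lowers the height of the end point by its depth, which is a nonnegative integer,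
    and the height of an LS path stays nonnegative. *)
Lemma depth_eventually0 eta : LS eta ->
  exists K, forall l, (K <= l)%N -> depth (j l) (pitman_iter j l eta) = 0.
Proof.
move=> hLS; suff H N l : height (pitman_iter j l eta 1) < N%:R ->
    exists K, forall l, (K <= l)%N -> depth (j l) (pitman_iter j l eta) = 0.
  exact: (H _ 0%N (truncnS_gt _)).
elim: N l => [|N IH] l hl.
  have h1 : 0 <= (1 : R) <= 1 by rewrite ler01 lexx.
  by have := LS_height_ge0 hn (LS_iter hLS l) h1; rewrite leNgt hl.
have [h|] := pselect (forall l', (l <= l')%N ->
    depth (j l') (pitman_iter j l' eta) = 0); first by exists l.
have step k : height (pitman_iter j k.+1 eta 1) =
    height (pitman_iter j k eta 1) - depth (j k) (pitman_iter j k eta).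
  by rewrite /= pitman_end -[_ *: alpha _]opprK -scaleNr heightB.
have dge k : 0 <= depth (j k) (pitman_iter j k eta).
  by have [e0 hPL _] := LS_iter hLS k; exact: depth_ge0.
have mono k : (l <= k)%N -> height (pitman_iter j k eta 1) < N.+1%:R.
  move=> /subnK <-; elim: (k - l)%N => [//|q IHq].
  by rewrite addSn step; have := dge (q + l)%N; lra.
move=> /existsNP[k /not_implyP[lk dk]]; apply: (IH k.+1).
rewrite step.
have dint := depth_int (j k) (LS_iter hLS k).
have : - depth (j k) (pitman_iter j k eta) <= -1.
  apply: int_lt0_le; first by rewrite rpredN.
  by rewrite oppr_lt0 lt_neqAle dge eq_sym andbT; apply/eqP.
by have := mono k lk; rewrite -natr1; lra.
Qed.

Lemma pitman_depth0 i eta : PLpath eta -> eta 0 = 0 -> depth i eta = 0 ->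
  forall t, 0 <= t <= 1 -> pitman i eta t = eta t /\ 0 <= p i (eta t).
Proof.
move=> hPL e0 d0 t ht; have pf := PLpath_PL i hPL.
have m0 : imin (fun u => p i (eta u)) t = 0.
  apply/eqP; rewrite eq_le imin_le0 //=.
  have m1 : imin (fun u => p i (eta u)) 1 = 0 by apply: oppr_inj; rewrite oppr0.
  by rewrite -m1; apply: imin_anti => //; lra.
split; first by rewrite pitmanE /fold_path m0 scale0r subr0.
by rewrite -m0; apply: imin_le => //; lra.
Qed.

Definition clamped eta := forall s, eta s = eta (Num.min (Num.max 0 s) 1).

Definition clamp eta s : hhat R n := eta (Num.min (Num.max 0 s) 1).

Lemma clamp_in t : 0 <= Num.min (Num.max 0 t) 1 <= 1.
Proof. by rewrite le_min le_max lexx ler01 ge_min lexx orbT. Qed.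

Lemma clamp_id t : 0 <= t <= 1 -> Num.min (Num.max 0 t) 1 = t :> R.
Proof. by move=> /andP[t0 t1]; rewrite max_r // min_l. Qed.

Lemma clampE eta t : 0 <= t <= 1 -> clamp eta t = eta t.
Proof. by move=> ht; rewrite /clamp clamp_id. Qed.

Lemma clamp_clamped eta : clamped (clamp eta).
Proof. by move=> s; rewrite {2}/clamp clamp_id ?clamp_in. Qed.

Lemma clamped_ext eta zeta : clamped eta -> clamped zeta ->
  (forall t, 0 <= t <= 1 -> zeta t = eta t) -> zeta = eta.
Proof.
by move=> h1 h2 e; apply/funext => s; rewrite h1 h2 e ?clamp_in.
Qed.

(** From left to right, the straight path is an LS path and the transforms are undone one by one by
    lifts with the integral string coordinates. Conversely the transforms become stationary, and as
    [j] takes every value again after that, the limit is dominant, hence straight. *)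
Lemma Bpi_LS eta : Bpi j eta <-> clamped eta /\ LS eta.
Proof.
split=> [[hc e0 [_ /piecewise_linear01_PLpath hPL] [k hk] hint]|[hc hLS]].
  split=> //; have H := PLpath_iter hPL e0.
  have : LS (pitman_iter j k.+1 eta) by apply: LS_ext LS_Lambda0; exact: hk.
  elim: (k.+1) => [//|l IH] /= hl; apply: IH.
  have [hPLl el0] := H l.
  apply: LS_ext (LS_lift hn (i := j l) (a := depth (j l) (pitman_iter j l eta)) _ _ _ _ hl _).
  - by move=> t ht; rewrite /depth lift_pitmanK.
  - exact: PLpath_pitman.
  - exact: pitman0.
  - exact: depth_ge0.
  - by move=> u hu; exact: pitman_ge0.
  - by have := hint l; rewrite string_coordE.
have [e0 hPL _] := hLS.
split=> //.
- split; first exact: PLpath_continuous.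
  exact: PLpath_piecewise_linear01.
- have [K hK] := depth_eventually0 hLS.
  have stat l t : 0 <= t <= 1 -> (K <= l)%N ->
      pitman_iter j l eta t = pitman_iter j K eta t.
    move=> ht /subnK <-; elim: (l - K)%N => [//|q IH].
    have [h1 h2] := PLpath_iter hPL e0 (q + K)%N.
    rewrite addSn /=; have [-> _] := pitman_depth0 h1 h2 (hK _ (leq_addl _ _)) ht.
    exact: IH.
  exists K => t ht; rewrite stat //.
  apply: (LS_dominant hn) ht; first exact: LS_iter.
  move=> i u hu; have [l Kl jl] := hj i K.
  have [h1 h2] := PLpath_iter hPL e0 l.
  rewrite -(stat l) // -jl.
  by have [_] := pitman_depth0 h1 h2 (hK _ Kl) hu.
- by move=> l; rewrite string_coordE; apply: depth_int; exact: LS_iter.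
Qed.

(** The element of depth [a] in the i-string of [eta]: all powers of the two root operators at once.
    Clamping restores the encoding of paths on [0, 1] as functions on the line. *)
Definition set_depth i a eta := clamp (lift_path a i (pitman i eta)).

Section SetDepth.
Variables (i : 'I_n.+1) (a : R) (eta : R -> hhat R n).
Hypotheses (he : Bpi j eta) (aint : a \is a Num.int) (a0 : 0 <= a)
  (al : a <= p i (pitman i eta 1)).

Let hLS : LS eta. Proof. by case/Bpi_LS: he. Qed.
Let hPL : PLpath (pitman i eta). Proof. by apply: PLpath_pitman; case: hLS. Qed.
Let z0 : pitman i eta 0 = 0. Proof. by apply: pitman0; case: hLS. Qed.
Let dom u : 0 <= u <= 1 -> 0 <= p i (pitman i eta u).
Proof. by case: hLS => e0 h _ hu; exact: pitman_ge0. Qed.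

Lemma set_depth_Bpi : Bpi j (set_depth i a eta).
Proof.
apply/Bpi_LS; split; first exact: clamp_clamped.
apply: LS_ext (LS_lift hn hPL z0 a0 dom (LS_pitman hn i hLS) aint).
by move=> t ht; rewrite /set_depth clampE.
Qed.

Lemma set_depth_end : set_depth i a eta 1 = pitman i eta 1 - a *: alpha i.
Proof. by rewrite /set_depth clampE ?lift_path1 ?ler01 ?lexx. Qed.

Lemma depth_set_depth : depth i (set_depth i a eta) = a.
Proof.
rewrite /depth -[RHS]opprK; congr (- _).
rewrite -(imin_lift1 hPL z0 a0 dom al).
by apply: imin_ext => u hu; rewrite /set_depth clampE.
Qed.

Lemma pitman_set_depth t : 0 <= t <= 1 ->
  pitman i (set_depth i a eta) t = pitman i eta t.
Proof.
move=> ht; rewrite -[RHS](pitman_liftK hPL z0 a0 dom ht).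
by apply: pitman_ext ht => u hu; rewrite /set_depth clampE.
Qed.
End SetDepth.

Lemma lift_path_ext a i eta zeta : (forall t, 0 <= t <= 1 -> zeta t = eta t) ->
  forall t, 0 <= t <= 1 -> lift_path a i zeta t = lift_path a i eta t.
Proof.
move=> e t ht; rewrite /lift_path /fold_path e //; congr (_ - _ *: _).
by apply: imin_ext => u hu; rewrite e //; lra.
Qed.

Lemma set_depthK i eta zeta : Bpi j eta -> zeta = eta \/
  (forall t, 0 <= t <= 1 -> pitman i zeta t = pitman i eta t) ->
  set_depth i (depth i eta) zeta = eta.
Proof.
move=> /Bpi_LS[hc [_ hPL _]] h; apply: clamped_ext => //.
  exact: clamp_clamped.
move=> t ht; rewrite /set_depth clampE // -[RHS](lift_pitmanK i hPL ht).
by case: h => [->//|h]; exact: lift_path_ext.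
Qed.

Lemma set_depth_inj i a b eta zeta : Bpi j eta -> Bpi j zeta ->
  0 <= a -> a <= p i (pitman i eta 1) ->
  0 <= b -> b <= p i (pitman i zeta 1) ->
  set_depth i a eta = set_depth i b zeta ->
  a = b /\ (forall t, 0 <= t <= 1 -> pitman i zeta t = pitman i eta t).
Proof.
move=> h1 h2 a2 a3 b2 b3 e; split.
  by rewrite -(depth_set_depth h1 a2 a3) e depth_set_depth.
move=> t ht; rewrite -(pitman_set_depth i h1 a2 ht) e.
by rewrite pitman_set_depth.
Qed.
End StringOperators.

(** * Translations of the affine Weyl group *)

Section RealReflections.
Context {R : realType} {n : nat} (hn : (1 <= n)%N).
Implicit Types (x y beta : hhat R n) (i k l : 'I_n.+1) (A B : {set 'I_n.+1}).
Local Notation p i x := (hform x (alpha i)).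

Definition refl beta x : hhat R n := x - hform x beta *: beta.

Lemma refl_srefl k beta x :
  refl (srefl k beta) x = srefl k (refl beta (srefl k x)).
Proof.
have sD (a : R) u v : srefl k (u - a *: v) = srefl k u - a *: srefl k v.
  rewrite /srefl hformBl hformZl; apply/rowP => q; rewrite !mxE; ring.
by rewrite /refl sD sreflK srefl_adj.
Qed.

Definition sum_alpha A : hhat R n := \sum_(k in A) alpha k.

Lemma hform_sum_alpha A l : p l (sum_alpha A) =
  (l \in A)%:R *+ 2 - (ordS l \in A)%:R - (ord_pred l \in A)%:R.
Proof.
rewrite hform_suml.
under eq_bigr => k _ do rewrite hform_alphas cartanE //.
have S1 q : \sum_(k in A) (k == q)%:R = (q \in A)%:R :> R.
  rewrite big_mkcond /= (bigD1 q) //= eqxx big1 => [|k /negbTE ->].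
    by rewrite addr0; case: (q \in A).
  by case: ifP.
by rewrite !sumrB sumrMnl !S1.
Qed.

Lemma hform_sum_alphas A : hform (sum_alpha A) (sum_alpha A) =
  \sum_(k in A) p k (sum_alpha A).
Proof. by rewrite {2}/sum_alpha hform_sumr. Qed.

Lemma val_iter_ordS l m : iter m (@ordS n.+1) l = ((l + m) %% n.+1)%N :> nat.
Proof.
elim: m => [|m IH] /=; first by rewrite addn0 modn_small.
by rewrite IH addnS -(addn1 (_ %% _)) modnDml addn1.
Qed.

Lemma iter_ordS_surj l k :
  exists2 m, (m <= n.+1 + n.+1)%N & k = iter m (@ordS n.+1) l.
Proof.
have h1 := ltn_ord l; have h2 := ltn_ord k.
exists (k + (n.+1 - l))%N; first by lia.
apply: val_inj; rewrite /= val_iter_ordS.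
rewrite (_ : l + (k + (n.+1 - l)) = k + n.+1)%N; last by lia.
by rewrite modnDr modn_small.
Qed.

Lemma ordS_closed A l k :
  (forall q, q \in A -> ordS q \in A) -> l \in A -> k \in A.
Proof.
move=> hA lA; have [m _ ->] := iter_ordS_surj l k.
by elim: m => //= m; exact: hA.
Qed.

(** The norm is the sum over A of the pairings with A, each nonnegative. If all vanish, A is closed
    under the cyclic successor, so it is empty or everything. *)
Lemma sum_alpha_isotropic A k :
  hform (sum_alpha A) (sum_alpha A) = 0 -> k \notin A -> A = finset.set0.
Proof.
rewrite hform_sum_alphas => h kA; apply/finset.setP => l; rewrite inE.
apply/negP => lA; case/negP: kA; apply: (@ordS_closed A l k _ lA) => q qA.
have ge0 r : r \in A -> 0 <= p r (sum_alpha A).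
  move=> rA; rewrite hform_sum_alpha rA mulr2n.
  by case: (ordS r \in A); case: (ord_pred r \in A); rewrite /=; lra.
have := (@psumr_eq0P _ _ _ _ ge0 h) q qA.
rewrite hform_sum_alpha qA mulr2n.
by case: (ordS q \in A) => //; case: (ord_pred q \in A) => /=; lra.
Qed.

Lemma hform_delta_delta : hform (delta : hhat R n) delta = 0.
Proof. by rewrite hform_sumr big1 // => k _; exact: hform_alpha_delta. Qed.

(** Later the invariance of the character under a map. Reasoning with such a predicate gives the
    real reflections without introducing the Weyl group. *)
Variable (Inv : (hhat R n -> hhat R n) -> Prop).
Hypotheses (Inv_srefl : forall k, Inv (srefl k))
  (Inv_comp : forall f g, Inv f -> Inv g -> Inv (f \o g)).

(** Since the norm is positive, some k in A has positive pairing with the sum. If it is 1, removing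
    k amounts to reflecting by k, and the reflection is a conjugate; if it is 2, the remainder is
    isotropic, hence zero. *)
Lemma Inv_refl_sum_alpha N A : (#|A| <= N)%N ->
  hform (sum_alpha A) (sum_alpha A) = 2 -> Inv (refl (sum_alpha A)).
Proof.
elim: N A => [|N IH] A cA h2.
  move: cA h2; rewrite leqn0 cards_eq0 => /eqP ->.
  by rewrite /sum_alpha big_set0 hform0l => /eqP; rewrite lt_eqF.
have [k kA pk] : exists2 k, k \in A & 0 < p k (sum_alpha A).
  apply: contrapT => h.
  have : \sum_(k in A) p k (sum_alpha A) <= 0.
    apply: sumr_le0 => k kA; rewrite leNgt; apply/negP => pk.
    by apply: h; exists k.
  by rewrite -hform_sum_alphas h2; lra.
have EA : sum_alpha A = sum_alpha (A :\ k) + alpha k.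
  by rewrite /sum_alpha (big_setD1 k) //= addrC.
have cB : (#|A :\ k| <= N)%N by move: cA; rewrite (cardsD1 k) kA.
have [pk1|pk2] : p k (sum_alpha A) = 1 \/ p k (sum_alpha A) = 2.
  move: pk; rewrite hform_sum_alpha kA mulr2n.
  by case: (ordS k \in A); case: (ord_pred k \in A) => /=; lra.
- have EB : sum_alpha (A :\ k) = srefl k (sum_alpha A).
    by rewrite /srefl pk1 scale1r EA addrK.
  have h : hform (sum_alpha (A :\ k)) (sum_alpha (A :\ k)) = 2.
    by rewrite EB srefl_adj sreflK.
  have -> : refl (sum_alpha A) = srefl k \o (refl (sum_alpha (A :\ k)) \o srefl k).
    by apply/funext => x /=; rewrite -refl_srefl EB sreflK.
  by apply: Inv_comp => //; apply: Inv_comp => //; exact: IH.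
- have h0 : hform (sum_alpha (A :\ k)) (sum_alpha (A :\ k)) = 0.
    have -> : sum_alpha (A :\ k) = sum_alpha A - alpha k by rewrite EA addrK.
    rewrite hformBl !hformBr h2 pk2 hform_alphaii [hform (alpha k) _]hformC pk2.
    by ring.
  have B0 := sum_alpha_isotropic h0 (negbT (setD11 k A)).
  have -> : refl (sum_alpha A) = srefl k; last exact: Inv_srefl.
  by rewrite EA B0 /sum_alpha big_set0 add0r.
Qed.

Lemma Inv_refl_delta_sub i : Inv (refl (delta - alpha i)).
Proof.
have h : hform (delta - alpha i : hhat R n) (delta - alpha i) = 2.
  rewrite hformBl !hformBr hform_alphaii [hform (alpha i) delta]hformC.
  by rewrite hform_alpha_delta // hform_delta_delta; ring.
have E : delta - alpha i = sum_alpha (~: [set i])%SET.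
  rewrite /delta /sum_alpha (bigD1 i) //= [alpha i + _]addrC addrK.
  by apply: eq_bigl => k; rewrite !inE.
by rewrite E in h *; apply: (Inv_refl_sum_alpha (leqnn _)).
Qed.

Lemma refl_delta_sub_srefl i x :
  refl (delta - alpha i) (srefl i x) = x + hform x delta *: alpha i
    - (p i x + hform x delta) *: delta.
Proof.
rewrite /refl hformBr hform_sreflii /srefl hformBl hformZl.
rewrite [hform (alpha i) delta]hformC hform_alpha_delta //.
by apply/rowP => q; rewrite !mxE; ring.
Qed.

Fixpoint translation i (k : nat) x : hhat R n :=
  if k is k'.+1 then refl (delta - alpha i) (srefl i (translation i k' x)) else x.

(** The classical formula for the translation by a multiple of a coroot, here k alpha_i, whose half
    squared length is k ^ 2. *)
Lemma translationE i (k : nat) x : translation i k x =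
  x + (k%:R * hform x delta) *: alpha i
    - (k%:R * p i x + k%:R ^+ 2 * hform x delta) *: delta.
Proof.
elim: k => [|k IH] /=.
  by rewrite expr0n /= !mul0r addr0 !scale0r addr0 subr0.
rewrite refl_delta_sub_srefl IH.
rewrite !hformBl !hformDl !hformZl hform_alphaii hform_alpha_delta //.
rewrite hform_delta_delta [hform (alpha i) delta]hformC hform_alpha_delta //.
by apply/rowP => q; rewrite !mxE -natr1; ring.
Qed.

End RealReflections.

(** * Characters and tail estimates *)

Section EsumComparison.
Context {R : realType}.
Local Open Scope ereal_scope.

Lemma esum_subset (U : choiceType) (A B : set U) (a : U -> \bar R) :
  A `<=` B -> \esum_(x in A) a x <= \esum_(x in B) a x.
Proof.
move=> AB; apply: ge_ereal_sup => _ [X [finX XA] <-].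
by apply: esum_ge; exists X => //; split=> // x /XA /AB.
Qed.

Lemma esum_inj_le (U : choiceType) (A B : set U) (f : U -> U)
    (a b : U -> \bar R) :
  set_inj A f -> (forall x, A x -> B (f x)) ->
  (forall x, A x -> a x <= b (f x)) ->
  \esum_(x in A) a x <= \esum_(x in B) b x.
Proof.
move=> finj fAB ab; apply: (le_trans (le_esum ab)).
by rewrite -esum_image //; apply: esum_subset => _ [x Ax <-]; exact: fAB.
Qed.

Lemma le_esum_scale (U : choiceType) (A : set U) (a b : U -> R) (c : R) :
  (0 <= c)%R -> (forall x, A x -> (a x <= c * b x)%R) ->
  \esum_(x in A) (a x)%:E <= c%:E * \esum_(x in A) (b x)%:E.
Proof.
move=> c0 ab; apply: (@le_trans _ _ (\esum_(x in A) (c * b x)%:E)).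
  by apply: le_esum => x Ax; rewrite lee_fin ab.
apply: ge_ereal_sup => _ [X [finX XA] <-].
rewrite (_ : \sum_(x \in X) _ = c%:E * \sum_(x \in X) (b x)%:E); last first.
  rewrite !fsumEFin // -EFinM; congr (_%:E).
  by rewrite !fsbig_finite // mulr_sumr.
by apply: lee_wpmul2l; [rewrite lee_fin|apply: esum_ge; exists X].
Qed.

End EsumComparison.

(** * Weyl invariance of the character, and tails of end points and depths *)

Section CharacterTail.
Context {R : realType} {n : nat} (hn : (1 <= n)%N).
Variables (j : nat -> 'I_n.+1) (hj : infinitely_often j).
Implicit Types (x h : hhat R n) (i : 'I_n.+1) (a b c q r s t u v : R)
  (eta zeta : R -> hhat R n).
Local Notation p i x := (hform x (alpha i)).

Lemma Bpi_level eta t : Bpi j eta -> 0 <= t <= 1 -> (eta t) 0 ord0 = t.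
Proof.
move=> [_ _ _ [k hk] _] ht.
transitivity ((t *: (Lambda0 : hhat R n)) 0 ord0).
  rewrite -(hk t ht); elim: (k.+1) => //= l ->.
  by rewrite pitmanE /fold_path level_subZ.
by rewrite !mxE !eqxx mulr1.
Qed.

(** The reversal of the i-string, that is, the Weyl group action on the crystal: it exchanges the
    numbers of times the two root operators can be applied. *)
Definition weyl_path i eta :=
  set_depth i (p i (pitman i eta 1) - depth i eta) eta.

Section WeylPath.
Variables (i : 'I_n.+1) (eta : R -> hhat R n).
Hypothesis (he : Bpi j eta).

Lemma hform_pitman_end : p i (pitman i eta 1) = p i (eta 1) + depth i eta * 2.
Proof. by rewrite pitman_end hformDl hformZl hform_alphaii. Qed.

Lemma Bpi_depth_int : depth i eta \is a Num.int.
Proof. by case/(Bpi_LS hn hj): he => _; exact: depth_int. Qed.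

Lemma Bpi_depth_ge0 : 0 <= depth i eta.
Proof. by case/(Bpi_LS hn hj): he => _ [h1 h2 _]; exact: depth_ge0. Qed.

Lemma Bpi_depth_le : depth i eta <= p i (pitman i eta 1).
Proof. by case/(Bpi_LS hn hj): he => _ [h1 h2 _]; exact: depth_le. Qed.

Lemma Bpi_pitman_end_int : p i (pitman i eta 1) \is a Num.int.
Proof.
by case/(Bpi_LS hn hj): he => _ h; apply: LS_end_int => //; exact: LS_pitman.
Qed.

Lemma weyl_path_Bpi : Bpi j (weyl_path i eta).
Proof.
have h0 := Bpi_depth_ge0; have hl := Bpi_depth_le.
apply: set_depth_Bpi => //; [|lra..].
by rewrite rpredB ?Bpi_depth_int ?Bpi_pitman_end_int.
Qed.

Lemma weyl_path_end : weyl_path i eta 1 = srefl i (eta 1).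
Proof.
have h0 := Bpi_depth_ge0; have hl := Bpi_depth_le.
rewrite /weyl_path set_depth_end; [|lra..].
rewrite hform_pitman_end pitman_end /srefl.
by apply/rowP => q; rewrite !mxE; ring.
Qed.

Lemma pitman_weyl_path t : 0 <= t <= 1 ->
  pitman i (weyl_path i eta) t = pitman i eta t.
Proof.
have hl := Bpi_depth_le.
by move=> ht; apply: (pitman_set_depth hn hj) => //; lra.
Qed.

Lemma weyl_pathK : weyl_path i (weyl_path i eta) = eta.
Proof.
rewrite {1}/weyl_path pitman_weyl_path ?ler01 ?lexx //.
rewrite (_ : depth i (weyl_path i eta) = p i (pitman i eta 1) - depth i eta).
  rewrite subKr; apply: (set_depthK hn hj he); right.
  exact: pitman_weyl_path.
have h0 := Bpi_depth_ge0; have hl := Bpi_depth_le.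
by apply: (depth_set_depth hn hj) => //; lra.
Qed.
End WeylPath.

Lemma weyl_path_inj i eta zeta : Bpi j eta -> Bpi j zeta ->
  weyl_path i eta = weyl_path i zeta -> eta = zeta.
Proof. by move=> h1 h2 e; rewrite -(weyl_pathK i h1) e weyl_pathK. Qed.

(** The factor [q] will be the inverse of the normalising constant; kept inside the sum, it makes
    the total mass one and avoids divisions of extended reals. *)
Definition charq q h : \bar R :=
  \esum_(eta in Bpi j) (q * expR (hform (eta 1) h))%:E.

Lemma charq_srefl q i h : charq q (srefl i h) = charq q h.
Proof.
rewrite /charq [RHS](reindex_esum (Bpi j) _ (weyl_path i)).
  apply: eq_esum => eta he.
  by rewrite weyl_path_end // srefl_adj.
split=> [eta he|eta zeta|eta he].
- exact: weyl_path_Bpi.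
- by move=> /set_mem h1 /set_mem h2; exact: weyl_path_inj.
- by exists (weyl_path i eta); [exact: weyl_path_Bpi|exact: weyl_pathK].
Qed.

Lemma charq_translation q i (k : nat) h : charq q (translation i k h) = charq q h.
Proof.
pose Inv f := forall h, charq q (f h) = charq q h.
have Is l : Inv (srefl l) by move=> x; exact: charq_srefl.
have Ic f g : Inv f -> Inv g -> Inv (f \o g) by move=> hf hg x /=; rewrite hf hg.
have Ir := Inv_refl_delta_sub hn Is Ic i.
by elim: k => [//|k IH] /=; rewrite Ir Is.
Qed.

(** All end points have level one, so the multiple of [delta] in the translation contributes the
    same scalar to each term. *)
Lemma charq_shift_le q i (k : nat) h : 0 <= q ->
  (charq q (h + (k%:R * hform h delta) *: alpha i) <=
   (expR (k%:R * p i h + k%:R ^+ 2 * hform h delta))%:E * charq q h)%E.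
Proof.
move=> q0; rewrite -(charq_translation q i k h).
apply: le_esum_scale => [|eta he]; first exact: expR_ge0.
rewrite translationE // mulrCA -expRD ler_wpM2l // ler_expR.
rewrite hformBr [X in _ - X]hformZr (hform_delta (eta 1)) // (Bpi_level he) ?ler01 ?lexx //.
by lra.
Qed.

Definition weighted q h (A : set (R -> hhat R n)) : \bar R :=
  \esum_(eta in A `&` Bpi j) (q * expR (hform (eta 1) h))%:E.

(** Chernoff's bound with the exponent l = k (h | delta), the shifts by l alpha_i being those that
    [charq_shift_le] evaluates. *)
Lemma end_tail q i (k x : nat) h : 0 <= q -> 0 <= hform h delta ->
  (weighted q h [set eta | (x%:R <= p i (eta 1))%R] <=
   (expR (k%:R * p i h + k%:R ^+ 2 * hform h delta
      - k%:R * hform h delta * x%:R))%:E * charq q h)%E.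
Proof.
move=> q0 u0; set l := k%:R * hform h delta.
have l0 : 0 <= l by rewrite mulr_ge0.
rewrite expRD mulrC EFinM -muleA.
apply: (@le_trans _ _ ((expR (- (l * x%:R)))%:E *
    charq q (h + l *: alpha i))%E); last first.
  by apply: lee_wpmul2l; [rewrite lee_fin expR_ge0|exact: charq_shift_le].
apply: (@le_trans _ _ ((expR (- (l * x%:R)))%:E * weighted q (h + l *: alpha i)
    [set eta | (x%:R <= p i (eta 1))%R])%E); last first.
  apply: lee_wpmul2l; first by rewrite lee_fin expR_ge0.
  by apply: esum_subset => eta [].
apply: le_esum_scale => [|eta [/= hx he]]; first exact: expR_ge0.
rewrite mulrCA -expRD ler_wpM2l // ler_expR hformDr hformZr.
have : l * x%:R <= l * p i (eta 1) by rewrite ler_wpM2l.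
by lra.
Qed.

(* A path of depth at least [x] is turned into one whose end point has
   [i]-coordinate at least [x], without losing weight: raise it by [x] if its
   end point is not far in the negative direction, reflect it otherwise. *)
Lemma depth_tail q i (x : nat) h : 0 <= q -> 0 <= p i h ->
  (weighted q h [set eta | (x%:R <= depth i eta)%R] <=
   weighted q h [set eta | (x%:R <= p i (eta 1))%R] *+ 2)%E.
Proof.
move=> q0 c0; rewrite mule2n; have x0 : 0 <= x%:R :> R by [].
set A := [set eta | (_ <= depth i eta)%R].
pose N := [set eta : R -> hhat R n | (- x%:R <= p i (eta 1))%R].
rewrite {1}/weighted (esumID N); last first.
  by move=> eta _; rewrite lee_fin mulr_ge0 // expR_ge0.
apply: leeD.
- apply: (@esum_inj_le _ _ _ _ (fun eta => set_depth i (depth i eta - x%:R) eta)).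
  + move=> eta zeta; rewrite !inE => -[[a1 b1] _] [[a2 b2] _] e.
    rewrite /A /= in a1 a2.
    have d1 := Bpi_depth_le i b1; have d2 := Bpi_depth_le i b2.
    have [||||e1 e2] := set_depth_inj hn hj b1 b2 _ _ _ _ e; [lra..|].
    have e3 : depth i eta = depth i zeta by lra.
    rewrite -(set_depthK hn hj (i := i) b1 (or_intror e2)) e3.
    by apply: (set_depthK hn hj b2); left.
  + move=> eta [[a1 b1] Nx]; rewrite /A /= in a1; have d1 := Bpi_depth_le i b1.
    split; last first.
      apply: set_depth_Bpi => //; [|lra..].
      by rewrite rpredB ?Bpi_depth_int ?rpred_nat.
    rewrite /= set_depth_end; [|lra..].
    rewrite pitman_end hformBl hformDl !hformZl hform_alphaii.
    by move: Nx; rewrite /N /=; lra.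
  + move=> eta [[a1 b1] Nx]; rewrite /A /= in a1; have d1 := Bpi_depth_le i b1.
    rewrite lee_fin ler_wpM2l // ler_expR set_depth_end; [|lra..].
    rewrite pitman_end hformBl hformDl !hformZl [hform (alpha i) h]hformC.
    have : 0 <= x%:R * p i h by rewrite mulr_ge0.
    by lra.
- apply: (@esum_inj_le _ _ _ _ (weyl_path i)).
  + move=> eta zeta /set_mem[[_ b1] _] /set_mem[[_ b2] _].
    exact: weyl_path_inj.
  + move=> eta [[_ b1] Nx]; split; last exact: weyl_path_Bpi.
    rewrite /= weyl_path_end // hform_sreflii.
    by move: Nx; rewrite /N /= => /negP; rewrite -ltNge; lra.
  + move=> eta [[_ b1] Nx].
    rewrite lee_fin ler_wpM2l // ler_expR weyl_path_end // /srefl.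
    rewrite hformBl hformZl [hform (alpha i) h]hformC.
    have {}Nx : p i (eta 1) <= 0.
      move: Nx; rewrite /N /= => /negP; rewrite -ltNge.
      by lra.
    have : 0 <= - p i (eta 1) * p i h by rewrite mulr_ge0 //; lra.
    by lra.
Qed.

End CharacterTail.

(** * Borel-Cantelli with exponential tails *)

Section BorelCantelli.
Context {d : measure_display} {T : measurableType d} {R : realType}.
Variable P : probability T R.

Lemma ae_eventually_not (F : nat -> set T) (M : nat) (C r : R) :
  (forall m, measurable (F m)) -> 0 <= C -> 0 <= r < 1 ->
  (forall m, (M <= m)%N -> (P (F m) <= (C * r ^+ m)%:E)%E) ->
  {ae P, forall w, \forall m \near \oo, ~ F m w}.
Proof.
move=> mF C0 hr PF; pose G m := if (M <= m)%N then F m else set0.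
have mG m : measurable (G m) by rewrite /G; case: ifP.
have PG m : (P (G m) <= (C * r ^+ m)%:E)%E.
  rewrite /G; case: ifP => [|_]; first exact: PF.
  by rewrite measure0 lee_fin mulr_ge0 // exprn_ge0 //; lra.
have sumG : (\sum_(m <oo) P (G m) <= (C / (1 - r))%:E)%E.
  apply: lime_le; first by apply: is_cvg_nneseries => m _ _; exact: measure_ge0.
  apply: nearW => N; apply: (@le_trans _ _ (\sum_(0 <= m < N) (C * r ^+ m)%:E)%E).
    by apply: lee_sum => m _.
  rewrite sumEFin lee_fin.
  have r1 : r != 1 by apply/eqP; lra.
  have -> : \sum_(0 <= m < N) C * r ^+ m = series (geometric C r) N by [].
  rewrite geometric_seriesE // ler_pM2r ?invr_gt0; last by lra.
  by rewrite ler_piMr // gerBl exprn_ge0 //; lra.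
have lim0 : P (lim_sup_set G) = 0%E.
  by apply: lim_sup_set_cvg0 => //; apply: le_lt_trans sumG _; rewrite ltry.
exists (lim_sup_set G); split=> //.
  by apply: bigcap_measurable => // k _; exact: bigcup_measurable.
move=> w /= hw N _; apply: contrapT => hN; apply: hw.
exists (maxn M N) => // m /= hm Fm; apply: hN; exists m.
  by rewrite /= (leq_trans (leq_maxr M N)).
by rewrite /G (leq_trans (leq_maxl M N)).
Qed.

(** For m beyond [M] one has c <= k and m <= 8 p k, so the exponent k (c - 3k) / m is at most -2 k^2
    / m, hence at most -a m with a = 1 / (32 p^2). Half of this absorbs the linear number of steps,
    as m <= (2 / a) exp(a m / 2). *)
Lemma exp_tail_geometric (p N : nat) (c : R) : (0 < p)%N ->
  exists (M : nat) (C r : R), [/\ 0 <= C, 0 <= r < 1 & forall m k : nat,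
    (M <= m)%N -> k = (m %/ (4 * p))%N ->
    (p * m + 2)%:R * (N%:R * (2 * expR (k%:R * (m%:R^-1 * c)
      + k%:R ^+ 2 * m%:R^-1 - k%:R * m%:R^-1 * (4 * k)%:R))) <= C * r ^+ m].
Proof.
move=> p0; pose M := (8 * p * (Num.truncn (Num.max c 0)%R).+2)%N.
pose a : R := (32 * p%:R ^+ 2)^-1.
have pR : 1 <= p%:R :> R by rewrite ler1n.
have a0 : 0 < a by rewrite invr_gt0 mulr_gt0 // exprn_gt0; lra.
have aE : a = (32 * p%:R ^+ 2)^-1 by [].
clearbody a.
exists M, (3 * p%:R * (2 / a) * (N%:R * 2)), (expR (- (a / 2))); split.
- by rewrite !mulr_ge0 // ?invr_ge0; lra.
- by rewrite expR_ge0 expR_lt1 oppr_lt0 divr_gt0.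
move=> m k hM hk; pose c' := (Num.truncn (Num.max c 0)).+1.
have cc' : c <= c'%:R.
  apply: (@le_trans _ _ (Num.max c 0)); first by rewrite le_max lexx.
  exact: ltW (truncnS_gt _).
have [m0 m8] : (0 < m)%N /\ (8 * p * c'.+1 <= m)%N.
  split; last exact: hM.
  by apply: leq_trans hM; rewrite /M !muln_gt0 p0.
have hk1 : (m < k.+1 * (4 * p))%N by rewrite hk ltn_ceil // muln_gt0.
have kc : (c' <= k)%N.
  rewrite leqNgt; apply/negP => kc.
  have : (k.+1 * (4 * p) <= c' * (4 * p))%N by rewrite leq_mul2r kc orbT.
  by nia.
have k8 : m%:R <= 8 * p%:R * k%:R :> R.
  rewrite -!natrM ler_nat.
  have : (8 * p <= m)%N by nia.
  by nia.
have mR : 0 < m%:R :> R by rewrite ltr0n.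
have kR : 0 <= k%:R :> R by [].
have ck : c <= k%:R by apply: le_trans cc' _; rewrite ler_nat.
set E := (X in expR X).
have EE : E <= - (a * m%:R).
  have -> : E = k%:R * (c - 3 * k%:R) / m%:R by rewrite /E natrM; field; lra.
  rewrite ler_pdivrMr // aE.
  have h1 : k%:R * (c - 3 * k%:R) <= k%:R * (- 2 * k%:R).
    by rewrite ler_wpM2l //; lra.
  apply: le_trans h1 _.
  have h2 : m%:R * m%:R <= (8 * p%:R * k%:R) * (8 * p%:R * k%:R) :> R.
    by rewrite ler_pM // ltW.
  have h3 : 0 < 32 * p%:R ^+ 2 :> R by rewrite mulr_gt0 // exprn_gt0; lra.
  have h4 : (32 * p%:R ^+ 2)^-1 * (m%:R * m%:R) <= 2 * k%:R * k%:R :> R.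
    by rewrite ler_pdivrMl // expr2; lra.
  by lra.
have hexp : a / 2 * m%:R <= expR (a / 2 * m%:R).
  by apply: le_trans (expR_ge1Dx _); lra.
have hm : m%:R <= 2 / a * expR (a / 2 * m%:R).
  rewrite -ler_pdivrMl; last by rewrite divr_gt0.
  by rewrite invf_div.
have pm : (p * m + 2)%:R <= 3 * p%:R * m%:R :> R.
  rewrite -!natrM ler_nat.
  have : (0 < p * m)%N by rewrite muln_gt0 p0.
  by rewrite -mulnA; move: (p * m)%N => z; rewrite !mulSn mul0n; lia.
apply: (@le_trans _ _ (3 * p%:R * (2 / a * expR (a / 2 * m%:R)) *
    (N%:R * (2 * expR (- (a * m%:R)))))).
  apply: ler_pM.
  - by [].
  - by rewrite !mulr_ge0 // expR_ge0.
  - by apply: le_trans pm _; rewrite ler_wpM2l // mulr_ge0.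
  - by rewrite !ler_wpM2l // ler_expR.
have -> : expR (- (a / 2)) ^+ m = expR (a / 2 * m%:R) * expR (- (a * m%:R)).
  by rewrite -expRM_natl -expRD; congr expR; field.
by rewrite le_eqVlt; apply/orP; left; apply/eqP; ring.
Qed.

End BorelCantelli.

(** * Depths of all the steps of the walk *)

Section DepthOfWalkSteps.
Context {R : realType} {n : nat} (hn : (1 <= n)%N).
Variables (j : nat -> 'I_n.+1) (hj : infinitely_often j).
Variables (nuhat : hhat R n) (hlev : hform nuhat delta = 1)
  (hdom : forall i : 'I_n.+1, 0 <= hform nuhat (alpha i)).
Local Notation p i x := (hform x (alpha i)).

Lemma mu_lawE m A : mu_law j nuhat m A =
  weighted j (fine (partition_function j nuhat m))^-1 (m%:R^-1 *: nuhat) A.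
Proof.
apply: eq_esum => eta _; congr (_%:E).
by rewrite hformZr mulrC.
Qed.

Lemma mu_law_depth_tail (m k x : nat) (i : 'I_n.+1) : mu_law j nuhat m setT = 1%E ->
  (mu_law j nuhat m [set eta | (x%:R <= depth i eta)%R] <=
   (2 * expR (k%:R * (m%:R^-1 * p i nuhat) + k%:R ^+ 2 * m%:R^-1
     - k%:R * m%:R^-1 * x%:R))%:E)%E.
Proof.
move=> h1; set q := (fine (partition_function j nuhat m))^-1.
have q0 : 0 <= q.
  rewrite invr_ge0 fine_ge0 // esum_ge0 // => eta _.
  by rewrite lee_fin expR_ge0.
have hd : hform (m%:R^-1 *: nuhat) delta = m%:R^-1.
  by rewrite hformZl hlev mulr1.
have hc : charq j q (m%:R^-1 *: nuhat) = 1%E.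
  by rewrite -h1 mu_lawE /weighted setTI.
rewrite mu_lawE -/q; apply: le_trans (@depth_tail _ _ hn j hj q i x _ q0 _) _.
  by rewrite hformZl mulr_ge0 // invr_ge0.
have := @end_tail _ _ hn j hj q i k x (m%:R^-1 *: nuhat) q0.
rewrite hd hc mule1 hformZl invr_ge0 => /(_ (ler0n _ _)) H.
rewrite mule2n mulrDl mul1r EFinD.
by apply: leeD.
Qed.

Context {d : measure_display} {T : measurableType d}.
Variable P : probability T R.
Variable eta : nat -> nat -> T -> R -> hhat R n.
Hypothesis heta : forall m : nat, (1 <= m)%N ->
  iid_discrete P (Bpi j) (mu_law j nuhat m) (eta m).

(** Union bound over the steps used up to time q m and over i. The threshold is 4 (m %/ (4 q)), the
    integer below m / q at which the tail exponent was optimised up to constants. *)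
Lemma ae_depth_small (q : nat) : (0 < q)%N ->
  {ae P, forall w, \forall m \near \oo, forall (l : nat) (i : 'I_n.+1),
    (l < q * m + 2)%N -> depth i (eta m l w) <= m%:R / q%:R}.
Proof.
move=> q0; pose c := \sum_i p i nuhat.
have cp i : p i nuhat <= c.
  by rewrite /c (bigD1 i) //= lerDl sumr_ge0.
have [M [C [r [C0 hr hM]]]] := exp_tail_geometric n.+1 c q0.
pose A (m : nat) (i : 'I_n.+1) : set (R -> hhat R n) :=
  [set z | ((4 * (m %/ (4 * q)))%:R <= depth i z)%R].
pose F m : set T := if (0 < m)%N then \big[setU/set0]_(l < q * m + 2)
  \big[setU/set0]_(i < n.+1) (eta m l @^-1` A m i) else set0.
have mE m l (i : 'I_n.+1) : (0 < m)%N -> measurable (eta m l @^-1` A m i).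
  by move=> m0; have [_ h _ _] := heta m0; exact: h.
have mF m : measurable (F m).
  rewrite /F; case: ifP => [m0|_]; last exact: measurable0.
  by apply: bigsetU_measurable => l _; apply: bigsetU_measurable => i _; exact: mE.
have PF m : (maxn M 1 <= m)%N -> (P (F m) <= (C * r ^+ m)%:E)%E.
  rewrite geq_max => /andP[Mm m0]; rewrite /F m0.
  (* The law of a random path has total mass one; with an infinite normalising constant, [fine] and
     the inverse would give mass zero. *)
  have mu1 : mu_law j nuhat m setT = 1%E.
    have [_ _ h _] := heta m0.
    by rewrite -(h 0%N) preimage_setT probability_setT.
  set k := (m %/ (4 * q))%N.
  set b := 2 * expR (k%:R * (m%:R^-1 * c) + k%:R ^+ 2 * m%:R^-1
     - k%:R * m%:R^-1 * (4 * k)%:R).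
  have b0 : 0 <= b by rewrite mulr_ge0 // expR_ge0.
  have Pb l (i : 'I_n.+1) : (P (eta m l @^-1` A m i) <= b%:E)%E.
    have [_ _ -> _] := heta m0.
    apply: le_trans (mu_law_depth_tail k _ _ mu1) _.
    rewrite lee_fin ler_wpM2l // ler_expR lerD2r lerD2r.
    by rewrite !ler_wpM2l // invr_ge0.
  have Pl (l : nat) : (P (\big[setU/set0]_(i < n.+1) (eta m l @^-1` A m i)) <=
      (n.+1%:R * b)%:E)%E.
    pose G (i : nat) := eta m l @^-1` A m (inord i).
    rewrite (eq_bigr (fun i : 'I_n.+1 => G i)); last first.
      by move=> i _; rewrite /G inord_val.
    apply: (le_trans (Boole_inequality _ _)); first by move=> i _; exact: mE.
    apply: (@le_trans _ _ (\sum_(i < n.+1) b%:E)%E).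
      by apply: lee_sum => i _; exact: Pb.
    by rewrite sumEFin sumr_const card_ord mulr_natl.
  pose G (l : nat) := \big[setU/set0]_(i < n.+1) (eta m l @^-1` A m i).
  apply: (le_trans (@Boole_inequality _ _ _ P G _ _)).
    by move=> l _; apply: bigsetU_measurable => i _; exact: mE.
  apply: (@le_trans _ _ (\sum_(l < q * m + 2) (n.+1%:R * b)%:E)%E).
    by apply: lee_sum => l _; exact: Pl.
  rewrite sumEFin sumr_const card_ord lee_fin -[_ *+ (q * m + 2)]mulr_natl.
  exact: (hM m k Mm erefl).
have := ae_eventually_not mF C0 hr PF.
apply: filterS => w hw.
near=> m; move=> l i lm.
have m0 : (0 < m)%N by near: m; exists 1%N.
have hF : ~ F m w by near: m.
have hA : ~ A m i (eta m l w).
  move=> hA; apply: hF; rewrite /F m0.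
  apply: (@bigsetU_sup _ l _
    (fun l : nat => \big[setU/set0]_(i < n.+1) (eta m l @^-1` A m i)) lm).
  by rewrite -bigcup_mkord_ord; exists i; rewrite /= ?inord_val.
apply: ltW; apply: (@lt_le_trans _ _ (4 * (m %/ (4 * q)))%:R).
  by rewrite ltNge; apply/negP.
rewrite ler_pdivlMr ?ltr0n // -natrM ler_nat.
by rewrite mulnAC mulnC leq_trunc_div.
Unshelve. all: by end_near. Qed.

End DepthOfWalkSteps.

(** * Stability of Pitman transforms and the scaling limit *)

Section QuotientSeminorm.
Context {R : realType} {n : nat} (hn : (1 <= n)%N).
Implicit Types (x y : hhat R n) (i : 'I_n.+1) (k : nat) (a : R).
Local Notation p i x := (hform x (alpha i)).

(* A seminorm with kernel R delta, that is, a norm on the quotient. *)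
Definition qnorm x : R := `|x 0 ord0| + \sum_i `|p i x|.

Lemma qnorm_ge0 x : 0 <= qnorm x.
Proof. by rewrite addr_ge0 // sumr_ge0. Qed.

Lemma hform_le_qnorm i x : `|p i x| <= qnorm x.
Proof.
by rewrite /qnorm (bigD1 i) //= addrCA lerDl addr_ge0 // sumr_ge0.
Qed.

Lemma level_le_qnorm x : `|x 0 ord0| <= qnorm x.
Proof. by rewrite lerDl sumr_ge0. Qed.

Lemma qnormD x y : qnorm (x + y) <= qnorm x + qnorm y.
Proof.
rewrite /qnorm addrACA lerD // ?mxE ?ler_normD // -big_split /=.
by apply: ler_sum => i _; rewrite hformDl ler_normD.
Qed.

Lemma qnormZ a x : qnorm (a *: x) = `|a| * qnorm x.
Proof.
rewrite /qnorm mulrDr mulr_sumr mxE normrM; congr (_ + _).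
by apply: eq_bigr => i _; rewrite hformZl normrM.
Qed.

Lemma qnormN x : qnorm (- x) = qnorm x.
Proof. by rewrite -scaleN1r qnormZ normrN normr1 mul1r. Qed.

Lemma qnormB x y : qnorm (x - y) <= qnorm x + qnorm y.
Proof. by apply: le_trans (qnormD _ _) _; rewrite qnormN. Qed.

Lemma delta_coord0 : (delta : hhat R n) 0 ord0 = 0.
Proof. by rewrite -hform_delta // hform_delta_delta. Qed.

Lemma delta_coord i : (delta : hhat R n) 0 (lift ord0 i) = 1.
Proof.
rewrite summxE (bigD1 i) //= mxE !eqxx big1 ?addr0 // => l nl.
by rewrite mxE eqxx (inj_eq (@lift_inj _ ord0)) eq_sym (negbTE nl).
Qed.

Lemma qnorm_modd x : qnorm (modd x) = qnorm x.
Proof.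
rewrite /qnorm /modd !mxE delta_coord0 mulr0 subr0; congr (_ + _).
by apply: eq_bigr => i _; rewrite hformBl hformZl hform_alpha_delta // mulr0 subr0.
Qed.

Lemma moddB x y : modd (x - y) = modd x - modd y.
Proof. by rewrite /modd; apply/rowP => q; rewrite !mxE; ring. Qed.

Lemma coord_le_norm x q : `|x 0 q| <= `|x|.
Proof.
rewrite [leRHS](_ : _ = mx_norm x) // mx_normrE.
exact: (le_bigmax _ (fun ij : 'I_1 * 'I_n.+2 => `|x ij.1 ij.2|) (0, q)).
Qed.

Lemma norm_le_coord x : `|x| <= \sum_q `|x 0 q|.
Proof.
have [->|] := eqVneq `|x| 0; first by rewrite sumr_ge0.
move=> /mx_norm_neq0[[u q] /= e]; rewrite [leLHS]e ord1.
by rewrite (bigD1 q) //= lerDl sumr_ge0.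
Qed.

Lemma qnorm_le_norm : exists2 C : R, 0 <= C & forall x, qnorm x <= C * `|x|.
Proof.
exists (1 + 5 * n.+1%:R) => [|x]; first by rewrite addr_ge0 // mulr_ge0.
rewrite mulrDl mul1r lerD ?coord_le_norm //.
apply: (@le_trans _ _ (\sum_(i < n.+1) 5 * `|x|)).
  apply: ler_sum => i _; rewrite hform_alpha // mulr2n.
  have h := coord_le_norm x.
  have hq q := h (lift ord0 q).
  have h0 : `|x 0 ord0 * (i == ord0)%:R| <= `|x|.
    rewrite normrM; apply: le_trans (h ord0); rewrite ler_piMr //.
    by case: (i == ord0); rewrite ?normr1 ?normr0 ?ler01.
  set u := x 0 ord0 * _ in h0 *; set v := x 0 (lift ord0 i).
  have := ler_normD (u + (v + v) - x 0 (lift ord0 (ordS i)))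
    (- x 0 (lift ord0 (ord_pred i))).
  have := ler_normD (u + (v + v)) (- x 0 (lift ord0 (ordS i))).
  have := ler_normD u (v + v); have := ler_normD v v.
  rewrite !normrN /v; have := hq i; have := hq (ordS i); have := hq (ord_pred i).
  by lra.
by rewrite sumr_const card_ord -[_ *+ n.+1]mulr_natl mulrCA mulrA.
Qed.

(* Along the cycle the second differences of the coordinates are bounded by
   [2 * qnorm x], and their first differences sum to zero. *)
Lemma norm_modd_le : exists2 C : R, 0 <= C & forall x, `|modd x| <= C * qnorm x.
Proof.
pose N : R := n.+1%:R; have N0 : 0 < N by rewrite ltr0n.
pose K : R := (N + N) * (4 * (N + N)).
have K0 : 0 <= K by rewrite !mulr_ge0 //; lra.
exists (1 + N * K) => [|x]; first by rewrite addr_ge0 // mulr_ge0 // ltW.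
set S := qnorm x; have S0 : 0 <= S by exact: qnorm_ge0.
pose e (k : nat) := x 0 (lift ord0 (iter k (@ordS n.+1) ord0)).
pose D (k : nat) := e k.+1 - e k.
have DS k : `|D k.+1 - D k| <= 2 * S.
  have -> : D k.+1 - D k = x 0 ord0 * (iter k.+1 (@ordS n.+1) ord0 == ord0)%:R
      - p (iter k.+1 (@ordS n.+1) ord0) x.
    by rewrite hform_alpha // /D /e /= ordSK mulr2n; ring.
  apply: le_trans (ler_normB _ _) _; rewrite mulr2n mulrDl mul1r.
  apply: lerD (hform_le_qnorm _ _); rewrite normrM.
  apply: le_trans (level_le_qnorm x); rewrite ler_piMr //.
  by case: (_ == _); rewrite ?normr1 ?normr0 ?ler01.
have D0 k : `|D k - D 0%N| <= k%:R * (2 * S).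
  elim: k => [|k IH]; first by rewrite subrr normr0 mul0r.
  rewrite -natr1 mulrDl mul1r.
  have := ler_normD (D k.+1 - D k) (D k - D 0%N); rewrite addrA subrK.
  by have := DS k; lra.
have eN : e n.+1 = e 0%N.
  rewrite /e; congr (x 0 (lift ord0 _)); apply: val_inj.
  have h := val_iter_ordS (ord0 : 'I_n.+1) n.+1.
  by rewrite add0n modnn in h; exact: h.
have sumD k : \sum_(0 <= l < k) D l = e k - e 0%N by rewrite telescope_sumr.
have D00 : `|D 0%N| <= N * (2 * S).
  have E : N * D 0%N = - \sum_(0 <= l < n.+1) (D l - D 0%N).
    by rewrite sumrB sumD eN subrr sub0r opprK sumr_const_nat subn0 mulr_natl.
  have : `|N * D 0%N| <= N * (N * (2 * S)).
    rewrite E normrN; apply: le_trans (ler_norm_sum _ _ _) _.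
    apply: (@le_trans _ _ (\sum_(0 <= l < n.+1) N * (2 * S))).
      rewrite big_nat [leRHS]big_nat; apply: ler_sum => l hl.
      apply: le_trans (D0 l) _; rewrite ler_wpM2r ?mulr_ge0 // ler_nat.
      by lia.
    by rewrite sumr_const_nat subn0 -[_ *+ n.+1]mulr_natl.
  by rewrite normrM (gtr0_norm N0) ler_pM2l.
have Dk k : (k <= n.+1 + n.+1)%N -> `|D k| <= 4 * (N + N) * S.
  move=> hk; have := ler_normD (D k - D 0%N) (D 0%N); rewrite subrK.
  have : k%:R * (2 * S) <= (N + N) * (2 * S).
    by rewrite ler_wpM2r ?mulr_ge0 // -natrD ler_nat.
  have : 0 <= N * S by rewrite mulr_ge0 // ltW.
  by have := D0 k; lra.
have ek k : (k <= n.+1 + n.+1)%N -> `|e k - e 0%N| <= K * S.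
  move=> hk; rewrite -sumD; apply: le_trans (ler_norm_sum _ _ _) _.
  apply: (@le_trans _ _ (\sum_(0 <= l < k) 4 * (N + N) * S)).
    by rewrite big_nat [leRHS]big_nat; apply: ler_sum => l hl; apply: Dk; lia.
  rewrite sumr_const_nat subn0 -[_ *+ k]mulr_natl /K -!mulrA ler_wpM2r //.
    by rewrite !mulr_ge0 //; lra.
  by rewrite -natrD ler_nat.
apply: le_trans (norm_le_coord _) _; rewrite big_ord_recl /= mulrDl mul1r.
apply: lerD; first by rewrite /S -(qnorm_modd x); exact: level_le_qnorm.
apply: (@le_trans _ _ (\sum_(k < n.+1) K * S)).
  apply: ler_sum => k _; have [m hm ->] := iter_ordS_surj hn ord0 k.
  by have := ek m hm; rewrite /modd /e /= !mxE -!/(delta _ _) delta_coord mulr1.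
by rewrite sumr_const card_ord -[_ *+ n.+1]mulr_natl mulrA.
Qed.

End QuotientSeminorm.

(** * Lipschitz stability of the iterated Pitman transforms *)

Section PitmanStability.
Context {R : realType} {n : nat} (hn : (1 <= n)%N).
Implicit Types (x y : hhat R n) (i : 'I_n.+1) (X Y : R -> hhat R n)
  (a b c e s t u v : R) (m : nat).
Local Notation p i x := (hform x (alpha i)).

(** Infima are 1-Lipschitz for the Hausdorff distance. The lower bounds guarantee that [inf] is not
    a default value. *)
Lemma inf_close (A B : set R) c e : 0 < c -> A !=set0 -> B !=set0 ->
  has_lbound A -> has_lbound B ->
  (forall u, A u -> exists2 v, B v & `|c * u - v| <= e) ->
  (forall v, B v -> exists2 u, A u & `|c * u - v| <= e) ->
  `|c * inf A - inf B| <= e.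
Proof.
move=> c0 A0 B0 lA lB AB BA; rewrite ler_norml; apply/andP; split.
  have : (inf B - e) / c <= inf A.
    apply: lb_le_inf => // x /AB[y By]; rewrite ler_norml => /andP[h _].
    have := ge_inf lB By; rewrite ler_pdivrMr // [x * c]mulrC; lra.
  by rewrite ler_pdivrMr // [_ * c]mulrC; lra.
have : c * inf A - e <= inf B.
  apply: lb_le_inf => // y /BA[x Ax]; rewrite ler_norml => /andP[_ h].
  have : c * inf A <= c * x by rewrite ler_pM2l //; exact: ge_inf.
  by lra.
by lra.
Qed.

Definition qbounded t b X := forall s, 0 <= s <= t -> qnorm (X s) <= b.

(* Closeness of the rescaled path to [X] on each interval of constancy of
   [ceil (m * s)]; this form is inherited by running infima, and no continuity
   of [X] is involved. *)
Definition close_paths t m e X Y := forall s s', 0 <= s <= t -> 0 <= s' ->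
  Num.ceil (m%:R * s) = Num.ceil (m%:R * s') ->
  qnorm (m%:R^-1 *: Y (m%:R * s') - X s) <= e.

(** A common Lipschitz constant of the transforms: an error e on the path moves the infimum by at
    most e, and the path by e more along a simple root. *)
Definition root_bound : R := 1 + \sum_i qnorm (alpha i : hhat R n).

Lemma root_bound_ge i : qnorm (alpha i : hhat R n) <= root_bound - 1.
Proof.
rewrite /root_bound addrC addKr (bigD1 i) //= lerDl sumr_ge0 // => k _.
exact: qnorm_ge0.
Qed.

Lemma root_bound_ge1 : 1 <= root_bound.
Proof. by rewrite lerDl sumr_ge0 // => k _; exact: qnorm_ge0. Qed.

Lemma qbounded_pitman i t b X :
  qbounded t b X -> qbounded t (root_bound * b) (pitman i X).
Proof.
move=> hb s hs; have b0 : 0 <= b by apply: le_trans (hb s hs); exact: qnorm_ge0.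
rewrite /pitman; set I := inf _.
have hI : `|I| <= b.
  have h u : 0 <= u <= s -> - b <= p i (X u) <= b.
    move=> hu; rewrite -ler_norml; apply: le_trans (hform_le_qnorm i _) _.
    by apply: hb; lra.
  have hA : [set p i (X u) | u in `[0, s]] (p i (X s)).
    by exists s => //=; rewrite in_itv /=; lra.
  have lA : lbound [set p i (X u) | u in `[0, s]] (- b).
    by move=> _ [u /= + <-]; rewrite in_itv /= => /h /andP[].
  rewrite ler_norml; apply/andP; split.
    by apply: lb_le_inf => //; exists (p i (X s)).
  apply: (@le_trans _ _ (p i (X s))); first by apply: ge_inf => //; exists (- b).
  by have /h /andP[] : 0 <= s <= s by lra.
apply: le_trans (qnormB _ _) _; rewrite qnormZ.
have : `|I| * qnorm (alpha i : hhat R n) <= b * (root_bound - 1).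
  by apply: ler_pM => //; [exact: qnorm_ge0|exact: root_bound_ge].
by have := hb s hs; lra.
Qed.

Lemma close_pitman i t m b e X Y : (0 < m)%N -> qbounded t b X ->
  close_paths t m e X Y ->
  close_paths t m (root_bound * e) (pitman i X) (pitman i Y).
Proof.
move=> m0 hb hc s s' hs hs' hcl; have m0R : 0 < m%:R :> R by rewrite ltr0n.
have hXY := hc s s' hs hs' hcl.
have e0 : 0 <= e by apply: le_trans hXY; exact: qnorm_ge0.
rewrite /pitman; set J := inf _; set I := inf _.
have diff u u' : 0 <= u <= t -> 0 <= u' -> Num.ceil (m%:R * u) = Num.ceil (m%:R * u') ->
    `|m%:R^-1 * p i (Y (m%:R * u')) - p i (X u)| <= e.
  move=> h1 h2 h3; have := hc u u' h1 h2 h3.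
  by apply: le_trans; rewrite -hformZl -hformBl; exact: hform_le_qnorm.
have fwd v : 0 <= v <= m%:R * s' -> exists2 u, 0 <= u <= s &
    `|m%:R^-1 * p i (Y v) - p i (X u)| <= e.
  move=> hv; pose v' := v / m%:R; have vE : v = m%:R * v' by rewrite /v' mulrC divfK ?gt_eqF.
  have v0 : 0 <= v' by rewrite divr_ge0 //; lra.
  have vs' : v' <= s' by rewrite ler_pdivrMr //; lra.
  rewrite vE; have [h|h] := leP v' s.
    by exists v'; [lra|apply: diff => //; lra].
  (* Here s < v' <= s', and the ceilings at the two ends agree, so v' lies in the same interval of
     constancy as s. *)
  exists s; first by lra.
  apply: diff => //; apply/eqP; rewrite eq_le; apply/andP; split.
    by apply: le_ceil; rewrite ler_wpM2l // ltW.
  by rewrite hcl; apply: le_ceil; rewrite ler_wpM2l.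
have bwd u : 0 <= u <= s -> exists2 v, 0 <= v <= m%:R * s' &
    `|m%:R^-1 * p i (Y v) - p i (X u)| <= e.
  move=> hu; have [h|h] := leP u s'.
    exists (m%:R * u); last by apply: diff => //; lra.
    by rewrite mulr_ge0 ?ler_wpM2l //; lra.
  exists (m%:R * s'); first by rewrite lexx mulr_ge0.
  apply: diff => //; first by lra.
  apply/eqP; rewrite eq_le; apply/andP; split.
    by rewrite -hcl; apply: le_ceil; rewrite ler_wpM2l //; lra.
  by apply: le_ceil; rewrite ler_wpM2l // ltW.
have Xb u : 0 <= u <= s -> - b <= p i (X u).
  move=> hu; have : `|p i (X u)| <= b.
    by apply: le_trans (hform_le_qnorm i _) _; apply: hb; lra.
  by rewrite ler_norml => /andP[].
have IJ : `|m%:R^-1 * J - I| <= e.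
  apply: inf_close; first by rewrite invr_gt0.
  - exists (p i (Y 0)); exists 0 => //=; rewrite in_itv /= lexx mulr_ge0 //.
  - by exists (p i (X 0)); exists 0 => //=; rewrite in_itv /=; lra.
  - exists (m%:R * (- b - e)) => _ [v /= + <-]; rewrite in_itv /= => hv.
    have [u hu] := fwd v hv; rewrite ler_norml => /andP[h _].
    have := Xb u hu; rewrite -ler_pdivlMl //; lra.
  - by exists (- b) => _ [u /= + <-]; rewrite in_itv /=; exact: Xb.
  - move=> _ [v /= + <-]; rewrite in_itv /= => hv; have [u hu h] := fwd v hv.
    by exists (p i (X u)) => //; exists u => //=; rewrite in_itv.
  - move=> _ [u /= + <-]; rewrite in_itv /= => hu; have [v hv h] := bwd u hu.
    by exists (p i (Y v)) => //; exists v => //=; rewrite in_itv.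
have -> : m%:R^-1 *: (Y (m%:R * s') - J *: alpha i) - (X s - I *: alpha i) =
    (m%:R^-1 *: Y (m%:R * s') - X s) - (m%:R^-1 * J - I) *: alpha i.
  by apply/rowP => q; rewrite !mxE; ring.
apply: le_trans (qnormB _ _) _; rewrite qnormZ.
have : `|m%:R^-1 * J - I| * qnorm (alpha i : hhat R n) <= e * (root_bound - 1).
  by apply: ler_pM => //; [exact: qnorm_ge0|exact: root_bound_ge].
by lra.
Qed.

Lemma close_pitman_iter (i : nat -> 'I_n.+1) k t m b e X Y : (0 < m)%N ->
  qbounded t b X -> close_paths t m e X Y ->
  close_paths t m (root_bound ^+ k * e) (pitman_iter i k X) (pitman_iter i k Y).
Proof.
move=> m0 hb hc.
suff [] : qbounded t (root_bound ^+ k * b) (pitman_iter i k X) /\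
  close_paths t m (root_bound ^+ k * e) (pitman_iter i k X) (pitman_iter i k Y)
  by [].
elim: k => [|k [IH1 IH2]]; first by rewrite !expr0 !mul1r.
rewrite !exprS -!mulrA; split; first exact: qbounded_pitman.
exact: close_pitman IH1 IH2.
Qed.

End PitmanStability.

(** * Fluctuations within one step *)

Section WalkSteps.
Context {R : realType} {n : nat} (hn : (1 <= n)%N).
Variables (j : nat -> 'I_n.+1) (hj : infinitely_often j).
Local Notation p i x := (hform x (alpha i)).

(** Each coordinate is at least -D, so its absolute value is at most itself plus 2 D; the
    coordinates sum to the level s <= 1, and the level itself adds at most 1. *)
Lemma Bpi_qnorm_le (eta : R -> hhat R n) (D s : R) : Bpi j eta ->
  (forall i, depth i eta <= D) -> 0 <= s <= 1 ->
  qnorm (eta s) <= 2 + 2 * n.+1%:R * D.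
Proof.
move=> he hD hs; have lev := Bpi_level he hs.
have [_ hLS] := (Bpi_LS hn hj eta).1 he; have [e0 hPL _] := hLS.
have lowD i : - D <= p i (eta s).
  apply: (@le_trans _ _ (- depth i eta)); first by rewrite lerN2.
  by rewrite opprK; apply: imin_le; [exact: PLpath_PL|lra..].
have D0 : 0 <= D by apply: le_trans (hD ord0); exact: depth_ge0.
rewrite /qnorm lev ger0_norm; last by lra.
have : \sum_i `|p i (eta s)| <= \sum_i (p i (eta s) + 2 * D).
  apply: ler_sum => i _; rewrite ler_norml; have := lowD i.
  by move=> h; apply/andP; split; lra.
rewrite big_split /= sum_hform_alpha // lev sumr_const card_ord.
by rewrite -[_ *+ n.+1]mulr_natl; lra.
Qed.

Lemma ceil_truncn (t : R) : 0 <= t -> let l := Num.truncn t in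
  t = l%:R /\ Num.ceil t = l \/ l%:R < t /\ Num.ceil t = l.+1.
Proof.
move=> t0 l; have /andP[h1 h2] := truncn_itv t0; rewrite -/l in h1 h2.
have [e|ne] := eqVneq t l%:R.
  by left; split=> //; rewrite e -[l%:R]/(l%:~R) intrKceil.
right; have lt : l%:R < t by rewrite lt_neqAle eq_sym ne.
split=> //; apply: ceil_def; rewrite -addn1 PoszD addrK.
by rewrite lt /= -PoszD addn1 ltW.
Qed.

Lemma walk_nat (eta : nat -> R -> hhat R n) (l : nat) :
  (forall l, eta l 0 = 0) -> walk eta l%:R = \sum_(1 <= i < l.+1) eta i 1.
Proof. by move=> e0; rewrite /walk natrK subrr e0 addr0. Qed.

Lemma walk_ceil (eta : nat -> R -> hhat R n) (N : nat) (C t : R) :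
  (forall l, eta l 0 = 0) -> 0 <= C ->
  (forall l s, (l <= N)%N -> 0 <= s <= 1 -> qnorm (eta l s) <= C) ->
  0 <= t <= N%:R ->
  qnorm (walk eta t - walk eta (Num.ceil t)%:~R) <= 2 * C.
Proof.
move=> e0 C0 hC /andP[t0 tN].
have [[tE ->]|[lt ->]] := ceil_truncn t0.
  by rewrite {1}tE subrr /qnorm mxE normr0 big1 ?addr0 ?mulr_ge0 // => i _;
    rewrite hform0l normr0.
rewrite (_ : (Posz (Num.truncn t).+1)%:~R = (Num.truncn t).+1%:R :> R) //.
rewrite walk_nat // /walk.
set l := Num.truncn t in lt *; rewrite [X in _ - X]big_nat_recr //= opprD addrACA subrr add0r.
have /andP[h1 h2] := truncn_itv t0.
have lN : (l.+1 <= N)%N.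
  by rewrite -(ltr_nat R); apply: lt_le_trans lt tN.
have h3 : qnorm (eta l.+1 (t - l%:R)) <= C.
  by apply: hC => //; rewrite -natr1 in h2; rewrite /l; lra.
have h4 : qnorm (eta l.+1 1) <= C by apply: hC => //; rewrite ler01 lexx.
by apply: le_trans (qnormB _ _) _; lra.
Qed.

End WalkSteps.

(** * Passage to the limit *)

Section ScalingLimit.
Context {R : realType} {n : nat} (hn : (1 <= n)%N).

Lemma uniform_itv_near (t : R) (F : nat -> R -> hhat R n) (g : R -> hhat R n) :
  {uniform `[0, t], F @ \oo --> g} -> forall e, 0 < e ->
  \forall m \near \oo, forall s, 0 <= s <= t -> `|g s - F m s| < e.
Proof.
move=> h e e0.
have : nbhs (g : {uniform` `[0, t] -> hhat R n})
    [set f | forall s, 0 <= s <= t -> `|g s - f s| < e].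
  apply/uniform_nbhs; exists [set xy | ball xy.1 e xy.2]; split.
    exact: (entourage_ball _ (PosNum e0)).
  move=> f /= hf s hs; have := hf s; rewrite /= in_itv /= hs => /(_ isT).
  by rewrite -ball_normE.
exact: h.
Qed.

Lemma modd_cvg (x : nat -> hhat R n) (y : hhat R n) :
  (forall e, 0 < e -> \forall m \near \oo, qnorm (x m - y) <= e) ->
  (fun m => modd (x m)) @ \oo --> modd y.
Proof.
move=> h; have [C C0 hC] := norm_modd_le (R := R) hn.
apply/cvgrPdist_le => e e0.
have e1 : 0 < e / (C + 1) by rewrite divr_gt0 //; lra.
apply: filterS (h _ e1) => m hm.
rewrite distrC -moddB; apply: le_trans (hC _) _.
apply: (@le_trans _ _ ((C + 1) * (e / (C + 1)))).
  by apply: ler_pM => //; [exact: qnorm_ge0|lra].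
by rewrite mulrC divfK // gt_eqF //; lra.
Qed.

Variables (j : nat -> 'I_n.+1) (hj : infinitely_often j).
Variables (eta : nat -> nat -> R -> hhat R n) (X : R -> hhat R n) (t : R).
Hypothesis t0 : 0 <= t.
Hypothesis eta_Bpi : forall m l, (1 <= m)%N -> Bpi j (eta m l).
Hypothesis depth_small : forall q, \forall m \near \oo,
  forall (l : nat) (i : 'I_n.+1), (l < q.+1 * m + 2)%N ->
  depth i (eta m l) <= m%:R / q.+1%:R.
Hypothesis ceil_close : forall e, 0 < e -> \forall m \near \oo,
  forall s, 0 <= s <= t ->
  `|modd (X s) - modd (m%:R^-1 *: walk (eta m) (Num.ceil (m%:R * s))%:~R)| < e.

Lemma qnorm_ceil_close e : 0 < e -> \forall m \near \oo,
  forall s, 0 <= s <= t ->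
  qnorm (m%:R^-1 *: walk (eta m) (Num.ceil (m%:R * s))%:~R - X s) <= e.
Proof.
move=> e0; have [C C0 hC] := qnorm_le_norm (R := R) hn.
have e1 : 0 < e / (C + 1) by rewrite divr_gt0 //; lra.
apply: filterS (ceil_close e1) => m hm s hs.
rewrite -qnorm_modd // moddB; apply: le_trans (hC _) _.
apply: (@le_trans _ _ ((C + 1) * (e / (C + 1)))).
  by apply: ler_pM => //; [lra|rewrite distrC ltW // hm].
by rewrite mulrC divfK // gt_eqF //; lra.
Qed.

(** For one fixed m the limit is within 1 of a path taking finitely many values up to time t. *)
Lemma limit_bounded : exists b, qbounded t b X.
Proof.
have [m hm m0] : exists2 m, forall s, 0 <= s <= t ->
    qnorm (m%:R^-1 *: walk (eta m) (Num.ceil (m%:R * s))%:~R - X s) <= 1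
    & (0 < m)%N.
  have [M _ hM] := qnorm_ceil_close ltr01.
  by exists M.+1 => //; apply: hM => /=.
pose y (l : nat) := m%:R^-1 *: walk (eta m) l%:R.
pose L := (Num.truncn (m%:R * t)).+2.
exists (1 + \sum_(l < L) qnorm (y l)) => s hs.
have ys (l : nat) : (l < L)%N -> qnorm (y l) <= \sum_(l < L) qnorm (y l).
  move=> lL; rewrite (bigD1 (Ordinal lL)) //= lerDl sumr_ge0 // => l' _.
  exact: qnorm_ge0.
have ms0 : 0 <= m%:R * s by rewrite mulr_ge0 //; lra.
have lL : (Num.truncn (m%:R * s) <= Num.truncn (m%:R * t))%N.
  by apply: le_truncn; rewrite ler_wpM2l //; lra.
have [l lL' hl] : exists2 l, (l < L)%N & Num.ceil (m%:R * s) = Posz l.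
  have [[_ ->]|[_ ->]] := ceil_truncn ms0.
    by exists (Num.truncn (m%:R * s)) => //; rewrite /L ltnW // !ltnS.
  by exists (Num.truncn (m%:R * s)).+1 => //; rewrite /L !ltnS.
have := hm s hs; rewrite hl => h.
have -> : X s = y l - (y l - X s) by rewrite subKr.
by apply: le_trans (qnormB _ _) _; rewrite addrC; apply: lerD => //; exact: ys.
Qed.

Lemma walk_close e : 0 < e ->
  \forall m \near \oo, close_paths t m e X (walk (eta m)).
Proof.
(* The fluctuation within a step is at most 2 C / m = 4 / m + 4 (n + 1) / q.+1; this q and m >= 16 /
   e make each term at most e / 4. The bound t <= q.+1 ensures that all steps used are
   controlled. *)
move=> e0; pose q := Num.truncn (Num.max t (16 * n.+1%:R / e)).
have [tq nq] : t <= q.+1%:R /\ 16 * n.+1%:R / e <= q.+1%:R.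
  have h := truncnS_gt (Num.max t (16 * n.+1%:R / e)).
  by split; apply/ltW; apply: le_lt_trans h; rewrite le_max lexx ?orbT.
have e2 : 0 < e / 2 by rewrite divr_gt0.
near=> m.
have m0 : (0 < m)%N by near: m; exists 1%N.
have m0R : 0 < m%:R :> R by rewrite ltr0n.
have hd : forall (l : nat) (i : 'I_n.+1), (l < q.+1 * m + 2)%N ->
  depth i (eta m l) <= m%:R / q.+1%:R by near: m; exact: depth_small.
have hm : 16 / e <= m%:R by near: m; exact: nbhs_infty_ger.
have hc : forall s, 0 <= s <= t ->
  qnorm (m%:R^-1 *: walk (eta m) (Num.ceil (m%:R * s))%:~R - X s) <= e / 2.
  by near: m; exact: qnorm_ceil_close.
move=> s s' hs hs' hcl.
set C : R := 2 + 2 * n.+1%:R * (m%:R / q.+1%:R).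
have C0 : 0 <= C by rewrite addr_ge0 // !mulr_ge0 // invr_ge0.
have e00 l : eta m l 0 = 0 by have [] := eta_Bpi l m0.
have hC l s1 : (l <= q.+1 * m)%N -> 0 <= s1 <= 1 -> qnorm (eta m l s1) <= C.
  move=> hl hs1; apply: (Bpi_qnorm_le hn hj (eta_Bpi l m0)) => // i.
  by apply: hd; rewrite addn2 ltnS leqW.
(* The time s' may exceed t, but m s' has the same ceiling as m s, and q.+1 * m is an integer above
   m s. *)
have ms' : 0 <= m%:R * s' <= (q.+1 * m)%:R.
  rewrite mulr_ge0 //=; apply: le_trans (ceil_ge _) _.
  rewrite -hcl -[(q.+1 * m)%:R]/((Posz (q.+1 * m))%:~R) ler_int ceil_le_int.
  rewrite -[(Posz (q.+1 * m))%:~R]/((q.+1 * m)%:R) natrM mulrC.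
  by rewrite ler_wpM2r //; lra.
have h1 := walk_ceil e00 C0 hC ms'.
have -> : m%:R^-1 *: walk (eta m) (m%:R * s') - X s =
    m%:R^-1 *: (walk (eta m) (m%:R * s') - walk (eta m) (Num.ceil (m%:R * s'))%:~R)
    + (m%:R^-1 *: walk (eta m) (Num.ceil (m%:R * s))%:~R - X s).
  by rewrite hcl scalerBr addrA subrK.
apply: le_trans (qnormD _ _) _; rewrite qnormZ ger0_norm ?invr_ge0 //.
have h2 := hc s hs.
suff h3 : m%:R^-1 * (2 * C) <= e / 2.
  have : m%:R^-1 * qnorm (walk (eta m) (m%:R * s') -
      walk (eta m) (Num.ceil (m%:R * s'))%:~R) <= m%:R^-1 * (2 * C).
    by rewrite ler_wpM2l // invr_ge0.
  by lra.
rewrite ler_pdivrMl // /C.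
have h4 : 8 * n.+1%:R * (m%:R / q.+1%:R) <= e / 2 * m%:R.
  rewrite mulrA ler_pdivrMr ?ltr0n //.
  have : 16 * n.+1%:R <= q.+1%:R * e by rewrite -ler_pdivrMr.
  move=> /(ler_wpM2r (ltW m0R)); lra.
have : 16 <= m%:R * e by rewrite -ler_pdivrMr.
move: h4; rewrite -!mulrA; set z := n.+1%:R * _.
by move: z => z; lra.
Unshelve. all: by end_near. Qed.

Lemma pitman_iter_cvg (i : nat -> 'I_n.+1) k :
  (fun m : nat => modd (m%:R^-1 *: pitman_iter i k (walk (eta m)) (m%:R * t)))
    @ \oo --> modd (pitman_iter i k X t) /\
  (fun m : nat => modd (m%:R^-1 *:
      pitman_iter i k (walk (eta m)) (Num.ceil (m%:R * t))%:~R))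
    @ \oo --> modd (pitman_iter i k X t).
Proof.
have [b hb] := limit_bounded; pose c : R := (root_bound (n := n)) ^+ k.
have c0 : 0 < c by rewrite exprn_gt0 // (lt_le_trans ltr01) // root_bound_ge1.
have H e : 0 < e -> \forall m \near \oo,
    (0 < m)%N /\ close_paths t m e (pitman_iter i k X) (pitman_iter i k (walk (eta m))).
  move=> e0; have e1 : 0 < e / c by rewrite divr_gt0.
  near=> m; have m0 : (0 < m)%N by near: m; exists 1%N.
  have hm : close_paths t m (e / c) X (walk (eta m)).
    by near: m; exact: walk_close.
  split=> //; have := close_pitman_iter i k m0 hb hm.
  by rewrite -/c mulrC divfK // gt_eqF.
have tt : 0 <= t <= t by rewrite t0 lexx.
split; apply: modd_cvg => e e0; apply: filterS (H e e0) => m [m0 hm].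
  exact: hm.
have m0R : 0 < m%:R :> R by rewrite ltr0n.
(* Both limits are instances of [close_paths] at s = t: the first with s' = t, the second with s' =
   ceil(m t) / m, where the ceiling is unchanged. *)
have E : m%:R * ((Num.ceil (m%:R * t))%:~R / m%:R) = (Num.ceil (m%:R * t))%:~R :> R.
  by rewrite mulrC divfK // gt_eqF.
rewrite -[in X in qnorm X]E; apply: hm => //.
  rewrite divr_ge0 // ler0z ceil_ge0 //; last by apply: lt_le_trans (ltrN10 _) _;
    rewrite mulr_ge0.
by rewrite E intrKceil.
Unshelve. all: by end_near. Qed.

End ScalingLimit.

Theorem theorem6p12 (R : realType) (n : nat) (hn : (1 <= n)%N)
  (j : nat -> 'I_n.+1) (hj : infinitely_often j)
  (nu : hhat R n) (hnu : hfin nu)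
  (hdom : forall i : 'I_n.+1, 0 <= hform (Lambda0 + nu) (alpha i))
  (d : measure_display) (T : measurableType d) (P : probability T R)
  (eta : nat -> nat -> T -> R -> hhat R n)
  (heta : forall m : nat, (1 <= m)%N ->
    iid_discrete P (Bpi j) (mu_law j (Lambda0 + nu) m) (eta m))
  (b : R -> T -> hhat R n) (hb : brownian_motion_with_drift P nu b)
  (pim : nat -> T -> R -> hhat R n)
  (hpim : forall m w t, pim m w t = walk (fun i => eta m i w) t)
  (B : T -> R -> hhat R n)
  (hB : forall w t, B w t = t *: Lambda0 + b t w)
  (hcvg : {ae P, forall w, forall K : set R, compact K ->
    K `<=` [set t | 0 <= t] ->
    {uniform K,
      (fun (m : nat) (t : R) =>
        modd (m%:R^-1 *: pim m w (Num.ceil (m%:R * t))%:~R)) @ \oo -->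
      (fun t : R => modd (B w t))}}) :
  forall (t : R) (i : nat -> 'I_n.+1) (k : nat), 0 <= t ->
    {ae P, forall w,
      (fun m : nat =>
        modd (m%:R^-1 *: pitman_iter i k.+1 (pim m w) (m%:R * t))) @ \oo -->
      modd (pitman_iter i k.+1 (B w) t)} /\
    {ae P, forall w,
      (fun m : nat =>
        modd (m%:R^-1 *:
          pitman_iter i k.+1 (pim m w) (Num.ceil (m%:R * t))%:~R)) @ \oo -->
      modd (pitman_iter i k.+1 (B w) t)}.
Proof.
move=> t i k t0.
have hlev : hform (Lambda0 + nu) delta = 1.
  by rewrite hform_delta // !mxE (proj1 hnu) addr0.
have hdepth : {ae P, forall w, forall q, \forall m \near \oo,
    forall (l : nat) (i : 'I_n.+1), (l < q.+1 * m + 2)%N ->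
    depth i (eta m l w) <= m%:R / q.+1%:R}.
  by apply: ae_foralln => q; exact: (ae_depth_small hn hj hlev hdom heta).
have key : {ae P, forall w,
    (fun m : nat =>
        modd (m%:R^-1 *: pitman_iter i k.+1 (pim m w) (m%:R * t))) @ \oo -->
      modd (pitman_iter i k.+1 (B w) t) /\
    (fun m : nat =>
        modd (m%:R^-1 *:
          pitman_iter i k.+1 (pim m w) (Num.ceil (m%:R * t))%:~R)) @ \oo -->
      modd (pitman_iter i k.+1 (B w) t)}.
  apply: filterS2 hcvg hdepth => w hu hd.
  have E : pim ^~ w = fun m => walk (fun l => eta m l w).
    by apply/funext => m; apply/funext => s; rewrite hpim.
  have hu' : {uniform `[0, t], (fun (m : nat) (s : R) =>
      modd (m%:R^-1 *: (pim ^~ w) m (Num.ceil (m%:R * s))%:~R)) @ \oo -->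
      (fun s : R => modd (B w s))}.
    apply: hu; first exact: segment_compact.
    by move=> s; rewrite /= in_itv /= => /andP[].
  (* The family is generalised so that the equality of functions [E] can be substituted under the
     binders. *)
  suff H (f : nat -> R -> hhat R n) : f = (fun m => walk (fun l => eta m l w)) ->
      {uniform `[0, t], (fun (m : nat) (s : R) =>
        modd (m%:R^-1 *: f m (Num.ceil (m%:R * s))%:~R)) @ \oo -->
        (fun s : R => modd (B w s))} ->
      (fun m : nat => modd (m%:R^-1 *: pitman_iter i k.+1 (f m) (m%:R * t)))
        @ \oo --> modd (pitman_iter i k.+1 (B w) t) /\
      (fun m : nat => modd (m%:R^-1 *:
          pitman_iter i k.+1 (f m) (Num.ceil (m%:R * t))%:~R))
        @ \oo --> modd (pitman_iter i k.+1 (B w) t).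
    exact: H E hu'.
  move=> {E hu'} -> hu'.
  apply: (pitman_iter_cvg hn hj (eta := fun m l => eta m l w) t0 _ hd).
    by move=> m l m1; have [h _ _ _] := heta m m1; exact: h.
  exact: uniform_itv_near hu'.
by split; apply: filterS key => w [].
Qed.
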